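(* Assume that $m=4$. Then, for an open and dense subset of $\mathcal W_0$, the umbilical point at the origin is of type $A_4$, i.e. the discriminant function $\delta$ has a singularity of type $A_4$ at the origin.
   Context: A line congruence near the origin is given by lines through $(x,y,0)$ with direction $(\xi^1(x,y),\xi^2(x,y),1)$, where $\xi=(\xi^1,\xi^2)$ is a real-analytic germ at the origin of $\mathbb R^2$ with $\xi(0,0)=0$. Write $g_{i,j}=\partial_x^i\partial_y^j g(0,0)$ and $p_{ij}=\xi^1_{i,j}$, $q_{ij}=\xi^2_{i,j}$. It is a $W$-congruence if $$W= (\xi^2_y-\xi^1_x)(\xi^2_{xx}\xi^1_{yy}-\xi^1_{xx}\xi^2_{yy})-2\xi^1_y(\xi^1_{xx}\xi^2_{xy}-\xi^2_{xx}\xi^1_{xy})+2\xi^2_x(\xi^1_{xy}\xi^2_{yy}-\xi^1_{yy}\xi^2_{xy})$$ vanishes identically near the origin. The discriminant is $\delta=(\xi^1_x-\xi^2_y)^2+4\xi^1_y\xi^2_x$. The origin is umbilical if $p_{10}=q_{01}$, $p_{01}=q_{10}=0$. Non-degenerate umbilical points are considered in the normalized form $p_{02}=p_{20}=q_{11}=0$, $p_{11}\ne0$, $q_{02}\neq0$, $p_{11}\ne q_{02}$, and $q_{20}=0$ whenever $p_{11}+q_{02}\neq0$; one sets $m=-q_{02}/p_{11}$. Only congruences for which every singular point is a limit of regular points are considered, where, with $a=-\xi^1_x$, $b=-\xi^1_y$, $c=-\xi^2_x$, $d=-\xi^2_y$, a point is singular if either $\delta=0$ there, or $\delta\neq0$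 and for some $i$ the derivative of the eigenvalue $\lambda_i$ of $\begin{pmatrix}a&b\\c&d\end{pmatrix}$ in the direction of the corresponding eigenvector vanishes; otherwise it is regular. $\mathcal W_0$ denotes the space of $W$-congruence germs with a non-degenerate umbilical point at the origin in this normalized form with the given value of $m$ ($m=4$), with the topology for which basic open sets are obtained by constraining finitely many Taylor coefficients $p_{ij},q_{ij}$ to lie in an open set. A function germ $g$ with a singular point at the origin is of type $A_4$ if, by a local change of variables in the source, it can be written as $y^2+x^5$. *)

(* Defs.v *)
From Stdlib Require Import Reals.
From Coquelicot Require Import Coquelicot.

Open Scope R_scope.

(** A germ at the origin is represented by any function R -> R -> R; every
    predicate below depends only on the values near the origin. *)

(** The double power series is summed along homogeneous parts; absolute
    convergence makes the order of summation irrelevant. *)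
Definition analytic_at_origin (f : R -> R -> R) : Prop :=
  exists a : nat -> nat -> R,
    locally_2d (fun x y =>
      ex_series (fun n =>
        sum_n (fun i => Rabs (a i (n - i)%nat * x ^ i * y ^ (n - i))) n) /\
      is_series (fun n =>
        sum_n (fun i => a i (n - i)%nat * x ^ i * y ^ (n - i)) n) (f x y)) 0 0.

(** The lines through (x, y, 0) with direction (xi1 x y, xi2 x y, 1). *)
Record congruence := Congruence { xi1 : R -> R -> R; xi2 : R -> R -> R }.

Definition congruence_germ (xi : congruence) : Prop :=
  analytic_at_origin (xi1 xi) /\ analytic_at_origin (xi2 xi) /\
  xi1 xi 0 0 = 0 /\ xi2 xi 0 0 = 0.

Definition p (xi : congruence) (i j : nat) : R := partial_derive i j (xi1 xi) 0 0.
Definition q (xi : congruence) (i j : nat) : R := partial_derive i j (xi2 xi) 0 0.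

Definition W (xi : congruence) (x y : R) : R :=
  let d1 i j := partial_derive i j (xi1 xi) x y in
  let d2 i j := partial_derive i j (xi2 xi) x y in
  (d2 0%nat 1%nat - d1 1%nat 0%nat)
    * (d2 2%nat 0%nat * d1 0%nat 2%nat - d1 2%nat 0%nat * d2 0%nat 2%nat)
  - 2 * d1 0%nat 1%nat
    * (d1 2%nat 0%nat * d2 1%nat 1%nat - d2 2%nat 0%nat * d1 1%nat 1%nat)
  + 2 * d2 1%nat 0%nat
    * (d1 1%nat 1%nat * d2 0%nat 2%nat - d1 0%nat 2%nat * d2 1%nat 1%nat).

Definition W_congruence (xi : congruence) : Prop :=
  locally_2d (fun x y => W xi x y = 0) 0 0.

Definition discriminant (xi : congruence) (x y : R) : R :=
  (partial_derive 1 0 (xi1 xi) x y - partial_derive 0 1 (xi2 xi) x y) ^ 2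
  + 4 * partial_derive 0 1 (xi1 xi) x y * partial_derive 1 0 (xi2 xi) x y.

(** [v] is an eigenvector, for the eigenvalue [l], of the matrix
    (a b; c d) = - D xi at (x, y). Everything is complex, since the eigenvalues
    are not real where the discriminant is negative. *)
Definition is_eigenpair (xi : congruence) (x y : R) (l : C) (v : C * C) : Prop :=
  let a := RtoC (- partial_derive 1 0 (xi1 xi) x y) in
  let b := RtoC (- partial_derive 0 1 (xi1 xi) x y) in
  let c := RtoC (- partial_derive 1 0 (xi2 xi) x y) in
  let d := RtoC (- partial_derive 0 1 (xi2 xi) x y) in
  v <> (RtoC 0, RtoC 0) /\
  Cplus (Cmult a (fst v)) (Cmult b (snd v)) = Cmult l (fst v) /\
  Cplus (Cmult c (fst v)) (Cmult d (snd v)) = Cmult l (snd v).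

(** Where the discriminant is nonzero, having partial derivatives forces a local
    choice [lam] of eigenvalue to follow a single one of the two branches along
    both coordinate lines through the point, so [lam_x], [lam_y] are the
    derivatives of that branch. *)
Definition stationary_eigenvalue (xi : congruence) (x y : R) : Prop :=
  exists (lam : R -> R -> C) (v : C * C) (lam_x lam_y : C),
    locally_2d (fun s t => exists w, is_eigenpair xi s t (lam s t) w) x y /\
    is_eigenpair xi x y (lam x y) v /\
    is_derive (K := R_AbsRing) (V := C_R_NormedModule)
      (fun s => lam s y) x lam_x /\
    is_derive (K := R_AbsRing) (V := C_R_NormedModule)
      (fun t => lam x t) y lam_y /\
    Cplus (Cmult (fst v) lam_x) (Cmult (snd v) lam_y) = RtoC 0.

Definition singular_point (xi : congruence) (x y : R) : Prop :=
  discriminant xi x y = 0 \/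
  (discriminant xi x y <> 0 /\ stationary_eigenvalue xi x y).

Definition regular_point (xi : congruence) (x y : R) : Prop :=
  ~ singular_point xi x y.

Definition singular_points_limits_of_regular (xi : congruence) : Prop :=
  locally_2d (fun x y =>
    singular_point xi x y ->
    forall eps : posreal, exists u v : R,
      Rabs (u - x) < eps /\ Rabs (v - y) < eps /\ regular_point xi u v) 0 0.

Definition umbilical_origin (xi : congruence) : Prop :=
  p xi 1 0 = q xi 0 1 /\ p xi 0 1 = 0 /\ q xi 1 0 = 0.

Definition nondegenerate_normal_form (xi : congruence) : Prop :=
  p xi 0 2 = 0 /\ p xi 2 0 = 0 /\ q xi 1 1 = 0 /\
  p xi 1 1 <> 0 /\ q xi 0 2 <> 0 /\ p xi 1 1 <> q xi 0 2 /\
  (p xi 1 1 + q xi 0 2 <> 0 -> q xi 2 0 = 0).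

Definition m_invariant (xi : congruence) : R := - q xi 0 2 / p xi 1 1.

Definition W0 (m : R) (xi : congruence) : Prop :=
  congruence_germ xi /\ W_congruence xi /\
  umbilical_origin xi /\ nondegenerate_normal_form xi /\
  m_invariant xi = m /\ singular_points_limits_of_regular xi.

Definition index (n : nat) : Set := {i : nat | (i < n)%nat}.

Definition jet (n : nat) (xi : congruence) : index n -> index n -> R * R :=
  fun i j => (p xi (proj1_sig i) (proj1_sig j), q xi (proj1_sig i) (proj1_sig j)).

(** The uniform topology on the function space [index n -> index n -> R * R] is
    the usual one, the index set being finite. *)
Definition basic_open (B : congruence -> Prop) : Prop :=
  exists (n : nat) (O : (index n -> index n -> R * R) -> Prop),
    open O /\ forall xi, B xi <-> O (jet n xi).

Definition open_in (S U : congruence -> Prop) : Prop :=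
  (forall xi, U xi -> S xi) /\
  forall xi, U xi ->
    exists B, basic_open B /\ B xi /\ forall eta, S eta -> B eta -> U eta.

Definition dense_in (S U : congruence -> Prop) : Prop :=
  forall B, basic_open B ->
    (exists xi, S xi /\ B xi) -> exists eta, S eta /\ U eta /\ B eta.

Definition analytic_map_germ (f1 f2 : R -> R -> R) : Prop :=
  analytic_at_origin f1 /\ analytic_at_origin f2 /\ f1 0 0 = 0 /\ f2 0 0 = 0.

Definition local_change_of_variables (f1 f2 : R -> R -> R) : Prop :=
  analytic_map_germ f1 f2 /\
  exists g1 g2 : R -> R -> R,
    analytic_map_germ g1 g2 /\
    locally_2d (fun x y =>
      f1 (g1 x y) (g2 x y) = x /\ f2 (g1 x y) (g2 x y) = y) 0 0 /\
    locally_2d (fun x y =>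
      g1 (f1 x y) (f2 x y) = x /\ g2 (f1 x y) (f2 x y) = y) 0 0.

Definition singular_function_germ (g : R -> R -> R) : Prop :=
  partial_derive 1 0 g 0 0 = 0 /\ partial_derive 0 1 g 0 0 = 0.

Definition type_A4 (g : R -> R -> R) : Prop :=
  singular_function_germ g /\
  exists f1 f2 : R -> R -> R,
    local_change_of_variables f1 f2 /\
    locally_2d (fun x y => g (f1 x y) (f2 x y) = y ^ 2 + x ^ 5) 0 0.

(* Main.v *)
Require Import Defs.
From Stdlib Require Import Reals Lra Lia FunctionalExtensionality Compare_dec Factorial.
From Coquelicot Require Import Coquelicot.

(** Write [xi1 = sum a_ij x^i y^j], [xi2 = sum b_ij x^i y^j] and [P = a_11]. The 2-jet of the
    discriminant is [25 P^2 y^2]. Give [x] and [y] the weights one and two. For m = 4 the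
    equation W = 0 forces, in degrees two and three, [b_30 = 0], [b_21 = - 10 a_30] and
    [P b_40 = - 9 a_30^2] ([W_relations]), so that the part of weight four of the discriminant
    is the square of [5 (P y + a_30 x^2)]. The type is then A4 as soon as the part of weight
    five does not vanish on the parabola [P y + a_30 x^2 = 0] ([A4_criterion]): in
    the coordinate [z = y + c x^2] the discriminant reads [z^2 al + x^3 z be + x^5 ga] with
    [al, ga] nonzero at the origin, and completing the square and extracting a fifth
    root gives [y^2 + x^5]. The value on the parabola is a polynomial in the jet
    ([A4_obstruction]), which contains [b_50] affinely with coefficient [20 P^3]. The open
    dense set is the one where this polynomial does not vanish; openness is clear.

    For density, start from a germ where the polynomial vanishes. The linearization of W at
    that germ has the leading part [2 P^2 (x u_xx - 4 u_x)] in the second component [u], whose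
    exponents in [x] are 0 and 5: it is at m = 4 that [x^5] is resonant with an
    integer degree giving A4, and that [b_50] can be varied. To perturb inside the solutions
    of W = 0, put [u = x^5 + x^6 w] and move the first component by [mu(y) u + phi(y) x^6]. Here
    W is the determinant of the rows [Q = (2 xi2_x, xi2_y - xi1_x, - 2 xi1_y)] and the two
    Hessians, and W = 0 lets one choose [mu] so that the principal symbol of the equation
    for [u] is divisible by [x], while [phi] removes the obstruction at the resonant order
    ([gauge_exists]). What remains is a nonlinear Fuchsian equation for [w]
    ([W_perturbed]). It is solved degree by degree, and the solution converges in the weighted
    norm with weights [s^(3n+j) / binomial(2n+j, j)], in which the inverse of the Fuchsian
    operator absorbs two derivatives in [y] for each factor [x] ([ctrl_fixpoint]). All
    bounds are uniform in the size [e] of the perturbation, so the jets converge as [e]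
    tends to 0.

    It remains to see that the perturbed germ is admissible, i.e. that singular points are limits of
    regular ones ([regular_points_dense]). A stationary eigenvalue [(trace + r) / 2] satisfies
    [X + r Y = 0] for two analytic functions, with [r^2 = del] the discriminant, so that
    [X^2 = del Y^2]. If the singular points filled an open set, this would hold (up to factors)
    near the origin by analytic continuation; but an A4 discriminant takes negative
    values, which would force [Y] to vanish identically, whereas its derivative in [y] at the
    origin is [80 P^2].

    Analytic germs are handled through their double series: a bounded linear functional on
    absolutely summable families is determined by monomials ([functional_zero]), which gives
    products, composition and derivatives, and fixed points of operators that are causal in
    the degree ([causal_fixpoint]) give the inverse function theorem and roots of units. *)

Open Scope R_scope.

(** * Finite sums *)

Fixpoint fsum (n : nat) (f : nat -> R) : R :=
  match n with O => 0 | S k => fsum k f + f k end.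

Lemma fsum_ext n f g : (forall i, (i < n)%nat -> f i = g i) -> fsum n f = fsum n g.
Proof.
  induction n as [|n IH]; intros H; simpl; [easy|].
  rewrite IH, H; [easy|lia|intros; apply H; lia].
Qed.

Lemma fsum_plus n f g : fsum n (fun i => f i + g i) = fsum n f + fsum n g.
Proof. induction n as [|n IH]; simpl; [ring|]. rewrite IH; ring. Qed.

Lemma fsum_scal n k f : fsum n (fun i => k * f i) = k * fsum n f.
Proof. induction n as [|n IH]; simpl; [ring|]. rewrite IH; ring. Qed.

Lemma fsum_scal_r n k f : fsum n (fun i => f i * k) = fsum n f * k.
Proof. induction n as [|n IH]; simpl; [ring|]. rewrite IH; ring. Qed.

Lemma fsum_0 n f : (forall i, (i < n)%nat -> f i = 0) -> fsum n f = 0.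
Proof.
  induction n as [|n IH]; intros H; simpl; [easy|].
  rewrite IH, H; [ring|lia|intros; apply H; lia].
Qed.

Lemma fsum_le n f g :
  (forall i, (i < n)%nat -> f i <= g i) -> fsum n f <= fsum n g.
Proof.
  induction n as [|n IH]; intros H; simpl; [lra|].
  apply Rplus_le_compat; [apply IH; intros; apply H|apply H]; lia.
Qed.

Lemma fsum_nonneg n f : (forall i, 0 <= f i) -> 0 <= fsum n f.
Proof.
  intros H. induction n as [|n IH]; simpl; [lra|]. specialize (H n); lra.
Qed.

Lemma fsum_mono n m f :
  (n <= m)%nat -> (forall i, 0 <= f i) -> fsum n f <= fsum m f.
Proof.
  intros Hnm H. induction Hnm as [|m _ IH]; [lra|]. simpl. specialize (H m); lra.
Qed.

Lemma fsum_Rabs n f : Rabs (fsum n f) <= fsum n (fun i => Rabs (f i)).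
Proof.
  induction n as [|n IH]; simpl; [rewrite Rabs_R0; lra|].
  eapply Rle_trans; [apply Rabs_triang|lra].
Qed.

Lemma fsum_switch n m (f : nat -> nat -> R) :
  fsum n (fun i => fsum m (fun j => f i j)) =
  fsum m (fun j => fsum n (fun i => f i j)).
Proof.
  induction n as [|n IH]; simpl.
  - symmetry; apply fsum_0; easy.
  - rewrite IH, <- fsum_plus. easy.
Qed.

Lemma fsum_single n k f :
  (k < n)%nat -> (forall i, i <> k -> f i = 0) -> fsum n f = f k.
Proof.
  induction n as [|n IH]; intros Hk H; [lia|]. simpl.
  destruct (Nat.eq_dec k n) as [->|Hn].
  - rewrite fsum_0; [ring|]. intros i Hi; apply H; lia.
  - rewrite IH, (H n); [ring|lia|lia|easy].
Qed.

Lemma fsum_split n m f :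
  fsum (n + m) f = fsum n f + fsum m (fun i => f (n + i)%nat).
Proof.
  induction m as [|m IH]; simpl.
  - rewrite Nat.add_0_r; ring.
  - rewrite Nat.add_succ_r; simpl. rewrite IH; ring.
Qed.

Lemma fsum_extend n m f :
  (n <= m)%nat -> (forall i, (n <= i < m)%nat -> f i = 0) -> fsum m f = fsum n f.
Proof.
  intros Hnm H. replace m with (n + (m - n))%nat by lia.
  rewrite fsum_split, (fsum_0 (m - n)); [ring|]. intros; apply H; lia.
Qed.

Lemma fsum_triangle N (f : nat -> nat -> R) :
  fsum N (fun n => fsum (S n) (fun i => f i (n - i)%nat)) =
  fsum N (fun i => fsum (N - i) (fun k => f i k)).
Proof.
  induction N as [|N IH]; [easy|].
  transitivity (fsum N (fun n => fsum (S n) (fun i => f i (n - i)%nat))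
          + fsum (S N) (fun i => f i (N - i)%nat)); [easy|].
  transitivity (fsum N (fun i => fsum (S N - i) (fun k => f i k))
          + fsum (S N - N) (fun k => f N k)); [|easy].
  replace (S N - N)%nat with 1%nat by lia.
  assert (H1 : forall g, fsum 1 g = g O) by (intros; simpl; ring).
  assert (H2 : forall n g, fsum (S n) g = fsum n g + g n) by easy.
  rewrite IH, H1, (H2 N (fun i => f i (N - i)%nat)), Nat.sub_diag, <- Rplus_assoc.
  f_equal. rewrite <- fsum_plus. apply fsum_ext. intros i Hi.
  replace (S N - i)%nat with (S (N - i)) by lia. easy.
Qed.

Lemma fsum_sum_n n f : sum_n f n = fsum (S n) f.
Proof.
  induction n as [|n IH].
  - rewrite sum_O. symmetry; apply Rplus_0_l.
  - rewrite sum_Sn, IH. easy.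
Qed.

(** * Absolutely summable double families *)

Definition fam := nat -> nat -> R.

Definition bsum (D : nat) (c : fam) : R := fsum D (fun i => fsum D (fun j => c i j)).

(** A bound on the sums over squares is a bound on the sum of the absolute values over
    any finite set, and finite sums suffice to speak of norms without extended reals. *)
Definition abs_bound (c : fam) (M : R) : Prop :=
  forall D, bsum D (fun i j => Rabs (c i j)) <= M.

(** Summation along homogeneous parts, the order in which double power series are summed
    in the definition of analyticity. *)
Definition diag (c : fam) (n : nat) : R := fsum (S n) (fun i => c i (n - i)%nat).

Definition dsum (c : fam) : R := Series (diag c).

Definition single (k l : nat) (v : R) : fam :=
  fun i j => if Nat.eq_dec i k then if Nat.eq_dec j l then v else 0 else 0.

Lemma fam_ext (c d : fam) : (forall i j, c i j = d i j) -> c = d.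
Proof. intros H. do 2 (apply functional_extensionality; intro). apply H. Qed.

Lemma bsum_le D c d : (forall i j, c i j <= d i j) -> bsum D c <= bsum D d.
Proof. intros H. unfold bsum. do 2 (apply fsum_le; intros). apply H. Qed.

Lemma bsum_plus D c d : bsum D (fun i j => c i j + d i j) = bsum D c + bsum D d.
Proof.
  unfold bsum. rewrite <- fsum_plus. apply fsum_ext; intros. apply fsum_plus.
Qed.

Lemma bsum_scal D k c : bsum D (fun i j => k * c i j) = k * bsum D c.
Proof.
  unfold bsum. rewrite <- fsum_scal. apply fsum_ext; intros. apply fsum_scal.
Qed.

Lemma bsum_mono D E c :
  (D <= E)%nat -> (forall i j, 0 <= c i j) -> bsum D c <= bsum E c.
Proof.
  intros HD H. unfold bsum. apply Rle_trans with (fsum D (fun i => fsum E (c i))).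
  - apply fsum_le; intros. now apply fsum_mono.
  - apply fsum_mono; [easy|]. intros; now apply fsum_nonneg.
Qed.

Lemma bsum_nonneg D c : (forall i j, 0 <= c i j) -> 0 <= bsum D c.
Proof. intros H. unfold bsum. do 2 (apply fsum_nonneg; intros). apply H. Qed.

Lemma abs_bound_nonneg c M : abs_bound c M -> 0 <= M.
Proof. intros H. specialize (H O). unfold bsum in H; simpl in H. lra. Qed.

Lemma abs_bound_le c d M :
  (forall i j, Rabs (c i j) <= Rabs (d i j)) -> abs_bound d M -> abs_bound c M.
Proof. intros H Hd D. eapply Rle_trans; [|apply (Hd D)]. now apply bsum_le. Qed.

Lemma abs_bound_weaken c M N : abs_bound c M -> M <= N -> abs_bound c N.
Proof. intros H HMN D. specialize (H D); lra. Qed.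

Lemma abs_bound_plus c d M N :
  abs_bound c M -> abs_bound d N -> abs_bound (fun i j => c i j + d i j) (M + N).
Proof.
  intros Hc Hd D. apply Rle_trans with (bsum D (fun i j => Rabs (c i j) + Rabs (d i j))).
  - apply bsum_le; intros; apply Rabs_triang.
  - rewrite bsum_plus. specialize (Hc D); specialize (Hd D); lra.
Qed.

Lemma abs_bound_scal k c M :
  abs_bound c M -> abs_bound (fun i j => k * c i j) (Rabs k * M).
Proof.
  intros Hc D. apply Rle_trans with (bsum D (fun i j => Rabs k * Rabs (c i j))).
  - apply bsum_le; intros; apply Req_le, Rabs_mult.
  - rewrite bsum_scal. apply Rmult_le_compat_l; [apply Rabs_pos|apply Hc].
Qed.

Lemma fsum_ge_entry n k f :
  (k < n)%nat -> (forall i, 0 <= f i) -> f k <= fsum n f.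
Proof.
  intros Hk H. apply Rle_trans with (fsum (S k) f); [|now apply fsum_mono].
  simpl. assert (0 <= fsum k f) by now apply fsum_nonneg. lra.
Qed.

Lemma abs_bound_entry c M i j : abs_bound c M -> Rabs (c i j) <= M.
Proof.
  intros H. eapply Rle_trans; [|apply (H (S (i + j)))]. unfold bsum.
  eapply Rle_trans; [|apply (fsum_ge_entry _ i); [lia|]].
  - apply (fsum_ge_entry _ j (fun j => Rabs (c i j))); [lia|intros; apply Rabs_pos].
  - intros; apply fsum_nonneg; intros; apply Rabs_pos.
Qed.

Lemma diag_box N c :
  (forall i j, 0 <= c i j) -> fsum N (diag c) <= bsum N c.
Proof.
  intros H. unfold diag. rewrite fsum_triangle. unfold bsum.
  apply fsum_le; intros. apply fsum_mono; [lia|easy].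
Qed.

Lemma box_diag N c :
  (forall i j, 0 <= c i j) -> bsum N c <= fsum (N + N) (diag c).
Proof.
  intros H. unfold diag. rewrite fsum_triangle. unfold bsum.
  eapply Rle_trans; [|apply fsum_mono with (n := N); [lia|]].
  - apply fsum_le; intros. apply fsum_mono; [lia|easy].
  - intros. now apply fsum_nonneg.
Qed.

Lemma diag_Rabs c n : Rabs (diag c n) <= diag (fun i j => Rabs (c i j)) n.
Proof. apply fsum_Rabs. Qed.

Lemma nonneg_series_bounded f M :
  (forall n, 0 <= f n) -> (forall N, fsum N f <= M) ->
  ex_series f /\ Series f <= M.
Proof.
  intros Hf HM.
  assert (H : ex_finite_lim_seq (sum_n f)).
  { apply ex_finite_lim_seq_incr with M; intros n; rewrite !fsum_sum_n.
    - apply fsum_mono; [lia|easy].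
    - apply HM. }
  split.
  - destruct H as [l Hl]. exists l. apply Hl.
  - unfold Series. destruct H as [l Hl]. rewrite (is_lim_seq_unique _ _ Hl). simpl.
    apply (is_lim_seq_le (sum_n f) (fun _ => M) l M); [|easy|apply is_lim_seq_const].
    intros n; rewrite fsum_sum_n; apply HM.
Qed.

Lemma dsum_abs_ex c M :
  abs_bound c M -> ex_series (diag (fun i j => Rabs (c i j))) /\
    Series (diag (fun i j => Rabs (c i j))) <= M.
Proof.
  intros H. apply nonneg_series_bounded.
  - intros n. apply fsum_nonneg; intros; apply Rabs_pos.
  - intros N. eapply Rle_trans; [apply diag_box; intros; apply Rabs_pos|apply H].
Qed.

Lemma dsum_ex c M : abs_bound c M -> ex_series (diag c).
Proof.
  intros H. apply (ex_series_le (V := R_CompleteNormedModule)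
    (diag c) (diag (fun i j => Rabs (c i j)))).
  - intros n. apply diag_Rabs.
  - apply (dsum_abs_ex c M H).
Qed.

Lemma dsum_bound c M : abs_bound c M -> Rabs (dsum c) <= M.
Proof.
  intros H. destruct (dsum_abs_ex c M H) as [He Hl].
  assert (Ha : ex_series (fun n => Rabs (diag c n))).
  { apply (ex_series_le (V := R_CompleteNormedModule) (fun n => Rabs (diag c n))
      (diag (fun i j => Rabs (c i j)))); [|easy].
    intros n. change (Rabs (Rabs (diag c n)) <= diag (fun i j => Rabs (c i j)) n).
    rewrite Rabs_Rabsolu. apply diag_Rabs. }
  eapply Rle_trans; [apply Series_Rabs, Ha|].
  eapply Rle_trans; [|apply Hl].
  apply Series_le; [|easy]. intros n; split; [apply Rabs_pos|apply diag_Rabs].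
Qed.

Lemma dsum_plus c d M N :
  abs_bound c M -> abs_bound d N ->
  dsum (fun i j => c i j + d i j) = dsum c + dsum d.
Proof.
  intros Hc Hd. unfold dsum.
  rewrite <- Series_plus; [|now apply dsum_ex with M|now apply dsum_ex with N].
  apply Series_ext; intros n. apply fsum_plus.
Qed.

Lemma dsum_scal k c : dsum (fun i j => k * c i j) = k * dsum c.
Proof.
  unfold dsum. rewrite <- Series_scal_l. apply Series_ext; intros n. apply fsum_scal.
Qed.

Lemma single_bound k l v : abs_bound (single k l v) (Rabs v).
Proof.
  intros D. unfold bsum, single.
  destruct (le_lt_dec D k) as [Hk|Hk].
  - rewrite fsum_0; [apply Rabs_pos|]. intros i Hi. apply fsum_0; intros j Hj.
    destruct (Nat.eq_dec i k); [lia|apply Rabs_R0].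
  - rewrite (fsum_single _ k); [|easy|].
    + destruct (Nat.eq_dec k k) as [_|]; [|easy].
      destruct (le_lt_dec D l) as [Hl|Hl].
      * rewrite fsum_0; [apply Rabs_pos|]. intros j Hj.
        destruct (Nat.eq_dec j l); [lia|apply Rabs_R0].
      * rewrite (fsum_single _ l); [|easy|].
        { destruct (Nat.eq_dec l l); [lra|easy]. }
        intros j Hj. destruct (Nat.eq_dec j l); [easy|apply Rabs_R0].
    + intros i Hi. apply fsum_0; intros j _.
      destruct (Nat.eq_dec i k); [easy|apply Rabs_R0].
Qed.

Lemma Series_single k (f : nat -> R) : (forall n, n <> k -> f n = 0) -> Series f = f k.
Proof.
  intros H. unfold Series. apply (f_equal real (y := Finite (f k))).
  apply is_lim_seq_unique.
  apply is_lim_seq_ext_loc with (fun _ => f k); [|apply is_lim_seq_const].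
  exists k. intros n Hn. rewrite fsum_sum_n, (fsum_single _ k); [easy|lia|easy].
Qed.

Lemma dsum_single k l v : dsum (single k l v) = v.
Proof.
  unfold dsum. rewrite (Series_single (k + l)).
  - unfold diag. rewrite (fsum_single _ k); [|lia|].
    + unfold single. destruct (Nat.eq_dec k k); [|easy].
      destruct (Nat.eq_dec (k + l - k) l); [easy|lia].
    + intros i Hi. unfold single. destruct (Nat.eq_dec i k); easy.
  - intros n Hn. apply fsum_0. intros i Hi. unfold single.
    destruct (Nat.eq_dec i k); [|easy]. destruct (Nat.eq_dec (n - i) l); [lia|easy].
Qed.

Definition box (D : nat) (c : fam) : fam :=
  fun i j => if lt_dec i D then if lt_dec j D then c i j else 0 else 0.

Definition off_box (D : nat) (c : fam) : fam :=
  fun i j => if lt_dec i D then if lt_dec j D then 0 else c i j else c i j.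

Lemma box_off_box D c : c = (fun i j => box D c i j + off_box D c i j).
Proof.
  apply fam_ext; intros i j. unfold box, off_box.
  destruct (lt_dec i D), (lt_dec j D); ring.
Qed.

Lemma bsum_box D E c : (D <= E)%nat -> bsum E (box D c) = bsum D c.
Proof.
  intros H. unfold bsum, box. rewrite (fsum_extend D E); [|easy|].
  - apply fsum_ext; intros i Hi. rewrite (fsum_extend D E); [|easy|].
    + apply fsum_ext; intros j Hj. destruct (lt_dec i D), (lt_dec j D); try lia; easy.
    + intros j Hj. destruct (lt_dec i D), (lt_dec j D); try lia; easy.
  - intros i Hi. apply fsum_0; intros j Hj. destruct (lt_dec i D); try lia; easy.
Qed.

(** The partial sums of the absolute values come as close as desired to their supremum, and
    the tail is what is left. *)
Lemma abs_bound_tail c M eps :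
  abs_bound c M -> 0 < eps -> exists D, abs_bound (off_box D c) eps.
Proof.
  intros H Heps. set (ac := fun i j => Rabs (c i j)).
  assert (Hac : forall i j, 0 <= ac i j) by (intros; apply Rabs_pos).
  destruct (completeness (fun s => exists D, s = bsum D ac)) as [L [HL1 HL2]].
  - exists M. intros s [D ->]. apply H.
  - exists (bsum O ac), O. easy.
  - assert (HD : exists D, L - eps < bsum D ac).
    { apply Classical_Prop.NNPP. intros Hn. specialize (HL2 (L - eps)).
      assert (L <= L - eps); [|lra]. apply HL2. intros s [D ->].
      apply Rnot_lt_le. intros Hlt. apply Hn. now exists D. }
    destruct HD as [D HD]. exists D. intros E.
    set (F := Nat.max D E).
    apply Rle_trans with (bsum F (fun i j => Rabs (off_box D c i j))).
    { apply bsum_mono; [lia|intros; apply Rabs_pos]. }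
    assert (Heq : bsum F ac = bsum F (box D ac) + bsum F (fun i j => Rabs (off_box D c i j))).
    { rewrite <- bsum_plus. f_equal. apply fam_ext; intros i j.
      unfold box, off_box, ac. destruct (lt_dec i D), (lt_dec j D);
      rewrite ?Rabs_R0; ring. }
    rewrite bsum_box in Heq by lia.
    assert (bsum F ac <= L) by (apply HL1; now exists F). lra.
Qed.

(** The finitely supported families are dense among the absolutely summable ones, so a
    bounded linear functional is determined by its values on single-entry families. All
    interchanges of infinite sums below are instances of this remark. *)
Lemma functional_zero (w : fam) (L : fam -> R) (K : R) :
  (forall c d M N, abs_bound (fun i j => c i j * w i j) M ->
     abs_bound (fun i j => d i j * w i j) N ->
     L (fun i j => c i j + d i j) = L c + L d) ->
  (forall c M, abs_bound (fun i j => c i j * w i j) M -> Rabs (L c) <= K * M) ->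
  (forall k l v, L (single k l v) = 0) ->
  forall c M, abs_bound (fun i j => c i j * w i j) M -> L c = 0.
Proof.
  intros Hadd Hbd Hsing c M Hc.
  assert (Hsb : forall k l v, exists N, abs_bound (fun i j => single k l v i j * w i j) N).
  { intros k l v. exists (Rabs (v * w k l)).
    apply abs_bound_le with (single k l (v * w k l)); [|apply single_bound].
    intros i j. unfold single.
    destruct (Nat.eq_dec i k) as [->|]; [destruct (Nat.eq_dec j l) as [->|]|];
      rewrite ?Rmult_0_l; lra. }
  assert (Hz : L (fun _ _ => 0) = 0).
  { transitivity (L (single O O 0)); [|apply Hsing]. f_equal. apply fam_ext; intros i j. unfold single.
    destruct (Nat.eq_dec i 0), (Nat.eq_dec j 0); easy. }
  assert (Hz0 : abs_bound (fun i j => 0 * w i j) 0).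
  { intros D. apply Req_le. unfold bsum. do 2 (apply fsum_0; intros).
    rewrite Rmult_0_l; apply Rabs_R0. }
  set (good := fun d : fam =>
    L d = 0 /\ exists N, abs_bound (fun i j => d i j * w i j) N).
  assert (Hgplus : forall d e, good d -> good e -> good (fun i j => d i j + e i j)).
  { intros d e [Hd [N HN]] [He [N' HN']]. split.
    - rewrite (Hadd d e N N'); [lra|easy|easy].
    - exists (N + N').
      apply abs_bound_le with (fun i j => d i j * w i j + e i j * w i j);
        [|now apply abs_bound_plus].
      intros i j. rewrite <- Rmult_plus_distr_r. apply Rle_refl. }
  assert (Hg0 : good (fun _ _ => 0)) by (split; [easy|now exists 0]).
  assert (Hgrow : forall k D, good (fun i j =>
      if Nat.eq_dec i k then if lt_dec j D then c i j else 0 else 0)).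
  { intros k D. induction D as [|D IH].
    - replace (fun i j : nat => if Nat.eq_dec i k then if lt_dec j 0 then c i j else 0 else 0)
        with (fun _ _ : nat => 0); [easy|].
      apply fam_ext; intros i j. destruct (Nat.eq_dec i k), (lt_dec j 0); try lia; easy.
    - replace (fun i j : nat =>
          if Nat.eq_dec i k then if lt_dec j (S D) then c i j else 0 else 0)
        with (fun i j => (if Nat.eq_dec i k then if lt_dec j D then c i j else 0 else 0)
          + single k D (c k D) i j); [apply Hgplus; [easy|now split]|].
      apply fam_ext; intros i j. unfold single.
      destruct (Nat.eq_dec i k) as [->|], (lt_dec j D), (lt_dec j (S D)),
        (Nat.eq_dec j D) as [->|]; try lia; ring. }
  assert (Hgbox : forall E D, good (fun i j =>
      if lt_dec i E then if lt_dec j D then c i j else 0 else 0)).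
  { intros E D. induction E as [|E IH].
    - replace (fun i j : nat => if lt_dec i 0 then if lt_dec j D then c i j else 0 else 0)
        with (fun _ _ : nat => 0); [easy|].
      apply fam_ext; intros i j. destruct (lt_dec i 0), (lt_dec j D); try lia; easy.
    - replace (fun i j : nat =>
          if lt_dec i (S E) then if lt_dec j D then c i j else 0 else 0)
        with (fun i j => (if lt_dec i E then if lt_dec j D then c i j else 0 else 0)
          + (if Nat.eq_dec i E then if lt_dec j D then c i j else 0 else 0));
        [now apply Hgplus|].
      apply fam_ext; intros i j.
      destruct (Nat.eq_dec i E), (lt_dec j D), (lt_dec i (S E)), (lt_dec i E);
        try lia; ring. }
  assert (Hsmall : forall eps, 0 < eps -> Rabs (L c) <= Rabs K * eps).
  { intros eps Heps. destruct (abs_bound_tail _ M eps Hc Heps) as [D HD].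
    destruct (Hgbox D D) as [HL [N HN]].
    assert (HD' : abs_bound (fun i j => off_box D c i j * w i j) eps).
    { apply abs_bound_le with (2 := HD). intros i j. unfold off_box.
      destruct (lt_dec i D), (lt_dec j D); rewrite ?Rmult_0_l; lra. }
    rewrite (box_off_box D c), (Hadd _ _ N eps); [|easy|easy].
    unfold box. rewrite HL, Rplus_0_l.
    eapply Rle_trans; [apply Hbd, HD'|].
    apply Rmult_le_compat_r; [lra|apply Rle_abs]. }
  apply Rabs_eq_0. apply Rle_antisym; [|apply Rabs_pos].
  apply Rnot_lt_le. intros Hpos.
  assert (HK : 0 <= Rabs K) by apply Rabs_pos.
  specialize (Hsmall (Rabs (L c) / (2 * (Rabs K + 1)))).
  assert (Hq : 0 < Rabs (L c) / (2 * (Rabs K + 1))).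
  { apply Rdiv_lt_0_compat; lra. }
  specialize (Hsmall Hq).
  assert (Rabs K * (Rabs (L c) / (2 * (Rabs K + 1))) <= Rabs (L c) / 2); [|lra].
  replace (Rabs (L c) / 2) with ((Rabs K + 1) * (Rabs (L c) / (2 * (Rabs K + 1))))
    by (field; lra).
  apply Rmult_le_compat_r; lra.
Qed.

(** * Double power series: norms and products *)

Definition bnd (a w : fam) (M : R) : Prop := abs_bound (fun i j => a i j * w i j) M.

(** Submultiplicative weights are those for which the weighted norm is an algebra norm. *)
Definition submult (w : fam) : Prop :=
  (forall i j, 0 <= w i j) /\
  forall i j k l, w (i + k)%nat (j + l)%nat <= w i j * w k l.

Definition padd (a b : fam) : fam := fun i j => a i j + b i j.
Definition pscal (k : R) (a : fam) : fam := fun i j => k * a i j.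
Definition pmul (a b : fam) : fam := fun n m =>
  fsum (S n) (fun i => fsum (S m) (fun j => a i j * b (n - i)%nat (m - j)%nat)).
Definition pconst (k : R) : fam := single 0 0 k.
Definition pzero : fam := pconst 0.
Definition px : fam := single 1 0 1.
Definition py : fam := single 0 1 1.
Definition dx (a : fam) : fam := fun i j => INR (S i) * a (S i) j.
Definition dy (a : fam) : fam := fun i j => INR (S j) * a i (S j).

Lemma bnd_le a w M N : bnd a w M -> M <= N -> bnd a w N.
Proof. apply abs_bound_weaken. Qed.

Lemma bnd_nonneg a w M : bnd a w M -> 0 <= M.
Proof. apply abs_bound_nonneg. Qed.

Lemma bnd_weight a v w M :
  (forall i j, 0 <= v i j <= w i j) -> bnd a w M -> bnd a v M.
Proof.
  intros H. apply abs_bound_le. intros i j. destruct (H i j).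
  rewrite !Rabs_mult. apply Rmult_le_compat_l; [apply Rabs_pos|].
  rewrite !Rabs_pos_eq; lra.
Qed.

Lemma bnd_add a b w M N : bnd a w M -> bnd b w N -> bnd (padd a b) w (M + N).
Proof.
  intros Ha Hb. eapply abs_bound_le; [|apply (abs_bound_plus _ _ _ _ Ha Hb)].
  intros i j. unfold padd. rewrite Rmult_plus_distr_r. apply Rle_refl.
Qed.

Lemma bnd_scal k a w M : bnd a w M -> bnd (pscal k a) w (Rabs k * M).
Proof.
  intros Ha. eapply abs_bound_le; [|apply (abs_bound_scal k _ _ Ha)].
  intros i j. unfold pscal. rewrite Rmult_assoc. apply Rle_refl.
Qed.

Lemma bnd_single k l v (w : fam) : bnd (single k l v) w (Rabs (v * w k l)).
Proof.
  apply abs_bound_le with (single k l (v * w k l)); [|apply single_bound].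
  intros i j. unfold single.
  destruct (Nat.eq_dec i k) as [->|]; [destruct (Nat.eq_dec j l) as [->|]|];
    rewrite ?Rmult_0_l; lra.
Qed.

Lemma fsum_cauchy_le D (G : nat -> nat -> R) : (forall i j, 0 <= G i j) ->
  fsum D (fun m => fsum (S m) (fun j => G j (m - j)%nat)) <=
  fsum D (fun j => fsum D (fun l => G j l)).
Proof.
  intros H. rewrite fsum_triangle. apply fsum_le; intros. apply fsum_mono; [lia|easy].
Qed.

Lemma bnd_mul a b w M N :
  submult w -> bnd a w M -> bnd b w N -> bnd (pmul a b) w (M * N).
Proof.
  intros [Hw0 Hw] Ha Hb D.
  set (A := fun i j => Rabs (a i j * w i j)). set (B := fun i j => Rabs (b i j * w i j)).
  assert (HA : forall i j, 0 <= A i j) by (intros; apply Rabs_pos).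
  assert (HB : forall i j, 0 <= B i j) by (intros; apply Rabs_pos).
  apply Rle_trans with (bsum D (pmul A B)).
  { apply bsum_le. intros n m. unfold pmul.
    rewrite Rabs_mult, (Rabs_pos_eq (w n m)) by easy.
    apply Rle_trans with (fsum (S n) (fun i => fsum (S m) (fun j =>
      Rabs (a i j * b (n - i)%nat (m - j)%nat))) * w n m).
    - apply Rmult_le_compat_r; [easy|]. eapply Rle_trans; [apply fsum_Rabs|].
      apply fsum_le; intros. apply fsum_Rabs.
    - rewrite <- fsum_scal_r. apply fsum_le; intros i Hi.
      rewrite <- fsum_scal_r. apply fsum_le; intros j Hj.
      unfold A, B. rewrite !Rabs_mult, !(Rabs_pos_eq (w _ _)) by easy.
      replace (Rabs (a i j) * w i j * (Rabs (b (n - i)%nat (m - j)%nat) * w (n - i)%nat (m - j)%nat))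
        with (Rabs (a i j) * Rabs (b (n - i)%nat (m - j)%nat) * (w i j * w (n - i)%nat (m - j)%nat))
        by ring.
      apply Rmult_le_compat_l; [apply Rmult_le_pos; apply Rabs_pos|].
      specialize (Hw i j (n - i)%nat (m - j)%nat).
      replace (i + (n - i))%nat with n in Hw by lia.
      replace (j + (m - j))%nat with m in Hw by lia. easy. }
  apply Rle_trans with (bsum D A * bsum D B).
  2:{ apply Rmult_le_compat; [now apply bsum_nonneg|now apply bsum_nonneg|apply Ha|apply Hb]. }
  unfold bsum, pmul.
  rewrite (fsum_ext D _ (fun n => fsum (S n) (fun i => fsum D (fun m => fsum (S m)
    (fun j => A i j * B (n - i)%nat (m - j)%nat)))))
    by (intros; apply fsum_switch).
  eapply Rle_trans.
  { apply (fsum_cauchy_le D (fun i k => fsum D (fun m => fsum (S m)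
      (fun j => A i j * B k (m - j)%nat)))).
    intros; do 2 (apply fsum_nonneg; intros); now apply Rmult_le_pos. }
  rewrite <- fsum_scal_r. apply fsum_le; intros i _.
  rewrite <- fsum_scal. apply fsum_le; intros k _.
  eapply Rle_trans.
  { apply (fsum_cauchy_le D (fun j l => A i j * B k l)). intros; now apply Rmult_le_pos. }
  rewrite <- fsum_scal_r. apply fsum_le; intros j _.
  rewrite <- fsum_scal. apply Rle_refl.
Qed.

(** * Evaluation *)

Definition monom (r s : R) : fam := fun i j => r ^ i * s ^ j.

Definition ev (a : fam) (x y : R) : R := dsum (fun i j => a i j * monom x y i j).

Lemma monom_submult r s : 0 <= r -> 0 <= s -> submult (monom r s).
Proof.
  intros Hr Hs. split; intros; unfold monom.
  - apply Rmult_le_pos; now apply pow_le.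
  - rewrite !pow_add. apply Req_le; ring.
Qed.

Lemma monom_mono r s r' s' i j :
  0 <= r <= r' -> 0 <= s <= s' -> 0 <= monom r s i j <= monom r' s' i j.
Proof.
  intros Hr Hs. unfold monom. split.
  - apply Rmult_le_pos; now apply pow_le.
  - apply Rmult_le_compat; try (apply pow_le; lra); now apply pow_incr.
Qed.

Lemma ev_family a x y r s M :
  Rabs x <= r -> Rabs y <= s -> bnd a (monom r s) M ->
  abs_bound (fun i j => a i j * monom x y i j) M.
Proof.
  intros Hx Hy. apply abs_bound_le. intros i j. unfold monom.
  rewrite !Rabs_mult, <- !RPow_abs. apply Rmult_le_compat_l; [apply Rabs_pos|].
  assert (0 <= r) by (generalize (Rabs_pos x); lra).
  assert (0 <= s) by (generalize (Rabs_pos y); lra).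
  rewrite (Rabs_pos_eq r), (Rabs_pos_eq s) by easy.
  apply Rmult_le_compat; try apply pow_le; try apply Rabs_pos;
    apply pow_incr; split; auto using Rabs_pos.
Qed.

Lemma ev_bound a x y r s M :
  Rabs x <= r -> Rabs y <= s -> bnd a (monom r s) M -> Rabs (ev a x y) <= M.
Proof. intros. apply dsum_bound. now apply ev_family with r s. Qed.

Lemma ev_add a b x y r s M N :
  Rabs x <= r -> Rabs y <= s -> bnd a (monom r s) M -> bnd b (monom r s) N ->
  ev (padd a b) x y = ev a x y + ev b x y.
Proof.
  intros Hx Hy Ha Hb. unfold ev.
  rewrite <- (dsum_plus _ _ M N); [|now apply ev_family with r s|now apply ev_family with r s].
  f_equal. apply fam_ext; intros. unfold padd. ring.
Qed.

Lemma ev_scal k a x y : ev (pscal k a) x y = k * ev a x y.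
Proof.
  unfold ev. rewrite <- dsum_scal. f_equal. apply fam_ext; intros. unfold pscal. ring.
Qed.

Lemma ev_single k l v x y : ev (single k l v) x y = v * (x ^ k * y ^ l).
Proof.
  unfold ev. rewrite <- (dsum_single k l (v * (x ^ k * y ^ l))). f_equal.
  apply fam_ext; intros i j. unfold single, monom.
  destruct (Nat.eq_dec i k) as [->|]; [destruct (Nat.eq_dec j l) as [->|]|]; ring.
Qed.

Lemma ev_const k x y : ev (pconst k) x y = k.
Proof. unfold pconst. rewrite ev_single. simpl; ring. Qed.

Lemma ev_px x y : ev px x y = x.
Proof. unfold px. rewrite ev_single. simpl; ring. Qed.

Lemma ev_py x y : ev py x y = y.
Proof. unfold py. rewrite ev_single. simpl; ring. Qed.

Lemma pmul_add_l a b c : pmul (padd a b) c = padd (pmul a c) (pmul b c).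
Proof.
  apply fam_ext; intros n m. unfold pmul, padd. rewrite <- fsum_plus.
  apply fsum_ext; intros. rewrite <- fsum_plus. apply fsum_ext; intros. ring.
Qed.

Lemma pmul_add_r a b c : pmul a (padd b c) = padd (pmul a b) (pmul a c).
Proof.
  apply fam_ext; intros n m. unfold pmul, padd. rewrite <- fsum_plus.
  apply fsum_ext; intros. rewrite <- fsum_plus. apply fsum_ext; intros. ring.
Qed.

Lemma pmul_single k l v b n m :
  pmul (single k l v) b n m =
  if le_dec k n then if le_dec l m then v * b (n - k)%nat (m - l)%nat else 0 else 0.
Proof.
  unfold pmul. destruct (le_dec k n) as [Hk|Hk].
  - rewrite (fsum_single _ k); [|lia|].
    + destruct (le_dec l m) as [Hl|Hl].
      * rewrite (fsum_single _ l); [|lia|].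
        { unfold single. destruct (Nat.eq_dec k k), (Nat.eq_dec l l); easy. }
        intros j Hj. unfold single. destruct (Nat.eq_dec k k), (Nat.eq_dec j l); try easy; ring.
      * apply fsum_0; intros j Hj. unfold single.
        destruct (Nat.eq_dec k k), (Nat.eq_dec j l); try lia; ring.
    + intros i Hi. apply fsum_0; intros j Hj. unfold single.
      destruct (Nat.eq_dec i k); try easy; ring.
  - apply fsum_0; intros i Hi. apply fsum_0; intros j Hj. unfold single.
    destruct (Nat.eq_dec i k); try lia; ring.
Qed.

Lemma pmul_single_single k l v k' l' v' :
  pmul (single k l v) (single k' l' v') = single (k + k') (l + l') (v * v').
Proof.
  apply fam_ext; intros n m. rewrite pmul_single. unfold single.
  destruct (le_dec k n), (le_dec l m), (Nat.eq_dec (n - k) k'), (Nat.eq_dec (m - l) l'),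
    (Nat.eq_dec n (k + k')), (Nat.eq_dec m (l + l')); try lia; ring.
Qed.

(** Both sides are bounded and bilinear in [a] and [b], so it suffices to compare them on
    monomials. *)
Lemma ev_mul a b x y r s M N :
  Rabs x <= r -> Rabs y <= s -> bnd a (monom r s) M -> bnd b (monom r s) N ->
  ev (pmul a b) x y = ev a x y * ev b x y.
Proof.
  intros Hx Hy Ha Hb.
  assert (Hr : 0 <= r) by (generalize (Rabs_pos x); lra).
  assert (Hs : 0 <= s) by (generalize (Rabs_pos y); lra).
  pose proof (monom_submult r s Hr Hs) as Hw.
  assert (HN := bnd_nonneg _ _ _ Hb).
  apply Rminus_diag_uniq.
  apply (functional_zero (monom r s) (fun a => ev (pmul a b) x y - ev a x y * ev b x y)
    (N + N)) with M; [| | |easy].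
  - intros c d M1 M2 Hc Hd. change (fun i j => c i j + d i j) with (padd c d).
    rewrite pmul_add_l, (ev_add _ _ _ _ r s (M1 * N) (M2 * N)), (ev_add c d x y r s M1 M2);
      try easy; try (now apply bnd_mul). ring.
  - intros c M1 Hc. assert (HM1 := bnd_nonneg _ _ _ Hc).
    eapply Rle_trans; [apply Rabs_triang|]. rewrite Rabs_Ropp, Rabs_mult.
    assert (Rabs (ev (pmul c b) x y) <= M1 * N)
      by (apply ev_bound with r s; try easy; now apply bnd_mul).
    assert (Rabs (ev c x y) * Rabs (ev b x y) <= M1 * N).
    { apply Rmult_le_compat; try apply Rabs_pos; now apply ev_bound with r s. }
    lra.
  - intros k l v.
    assert (Hsv := bnd_single k l v (monom r s)).
    set (K := Rabs (v * monom r s k l)) in *.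
    apply (functional_zero (monom r s) (fun b => ev (pmul (single k l v) b) x y
      - ev (single k l v) x y * ev b x y) (K + K)) with N; [| | |easy].
    + intros c d M1 M2 Hc Hd. change (fun i j => c i j + d i j) with (padd c d).
      rewrite pmul_add_r, (ev_add _ _ _ _ r s (K * M1) (K * M2)), (ev_add c d x y r s M1 M2);
        try easy; try (now apply bnd_mul). ring.
    + intros c M1 Hc. assert (HM1 := bnd_nonneg _ _ _ Hc).
      eapply Rle_trans; [apply Rabs_triang|]. rewrite Rabs_Ropp, Rabs_mult.
      assert (Rabs (ev (pmul (single k l v) c) x y) <= K * M1)
        by (apply ev_bound with r s; try easy; now apply bnd_mul).
      assert (Rabs (ev (single k l v) x y) * Rabs (ev c x y) <= K * M1).
      { apply Rmult_le_compat; try apply Rabs_pos; now apply ev_bound with r s. }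
      lra.
    + intros k' l' v'. rewrite pmul_single_single, !ev_single, !pow_add. ring.
Qed.

(** * Termwise differentiation *)

Lemma pow_incr_quotient x h sg i : 0 < sg -> Rabs h <= sg ->
  Rabs ((x + h) ^ i - x ^ i) <= Rabs h / sg * (Rabs x + sg) ^ i.
Proof.
  intros Hs Hh. assert (Hx := Rabs_pos x). assert (Hh0 := Rabs_pos h).
  assert (Hq : 0 <= Rabs h / sg) by (apply Rdiv_le_0_compat; lra).
  induction i as [|i IH]; simpl.
  - rewrite Rminus_diag, Rabs_R0. lra.
  - replace ((x + h) * (x + h) ^ i - x * x ^ i)
      with (x * ((x + h) ^ i - x ^ i) + h * (x + h) ^ i) by ring.
    eapply Rle_trans; [apply Rabs_triang|]. rewrite !Rabs_mult.
    assert (Rabs ((x + h) ^ i) <= (Rabs x + sg) ^ i).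
    { rewrite <- RPow_abs. apply pow_incr. split; [apply Rabs_pos|].
      generalize (Rabs_triang x h); lra. }
    apply Rle_trans with (Rabs x * (Rabs h / sg * (Rabs x + sg) ^ i)
      + Rabs h * (Rabs x + sg) ^ i).
    + apply Rplus_le_compat; apply Rmult_le_compat_l; easy.
    + apply Req_le. field. lra.
Qed.

Lemma pow_derive_bound x sg i : 0 < sg ->
  Rabs (INR (S i) * x ^ i) <= / sg * (Rabs x + sg) ^ S i.
Proof.
  intros Hs. assert (Hx := Rabs_pos x).
  rewrite Rabs_mult, <- RPow_abs, (Rabs_pos_eq (INR _)) by apply pos_INR.
  apply Rmult_le_reg_l with sg; [easy|].
  rewrite <- (Rmult_assoc sg (/ sg)), Rinv_r, Rmult_1_l by lra.
  induction i as [|i IH]; [simpl; nra|].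
  rewrite S_INR. change (Rabs x ^ S i) with (Rabs x * Rabs x ^ i).
  change ((Rabs x + sg) ^ S (S i)) with ((Rabs x + sg) * (Rabs x + sg) ^ S i).
  assert (Rabs x ^ S i <= (Rabs x + sg) ^ S i) by (apply pow_incr; lra).
  change (Rabs x ^ S i) with (Rabs x * Rabs x ^ i) in H.
  assert (sg * (Rabs x * Rabs x ^ i) <= sg * (Rabs x + sg) ^ S i)
    by (apply Rmult_le_compat_l; lra).
  assert (Rabs x * (sg * (INR (S i) * Rabs x ^ i)) <= Rabs x * (Rabs x + sg) ^ S i)
    by (apply Rmult_le_compat_l; lra).
  lra.
Qed.

(** Termwise second-order Taylor bound with constants uniform in the exponent, at the price of
    the larger radius [|x| + sg]. *)
Lemma pow_taylor2_bound x h sg i : 0 < sg -> Rabs h <= sg ->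
  Rabs ((x + h) ^ i - x ^ i - h * (INR i * x ^ pred i))
    <= (Rabs h / sg) ^ 2 * (Rabs x + sg) ^ i.
Proof.
  intros Hs Hh. assert (Hx := Rabs_pos x).
  assert (Hq : 0 <= Rabs h / sg) by (apply Rdiv_le_0_compat; [apply Rabs_pos|lra]).
  induction i as [|i IH].
  - simpl. replace (1 - 1 - h * (0 * 1)) with 0 by ring. rewrite Rabs_R0. nra.
  - replace ((x + h) ^ S i - x ^ S i - h * (INR (S i) * x ^ pred (S i))) with
      (x * ((x + h) ^ i - x ^ i - h * (INR i * x ^ pred i)) + h * ((x + h) ^ i - x ^ i)).
    2:{ rewrite S_INR. destruct i; [simpl; ring|]. simpl pred. simpl pow. ring. }
    eapply Rle_trans; [apply Rabs_triang|]. rewrite !Rabs_mult.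
    apply Rle_trans with (Rabs x * ((Rabs h / sg) ^ 2 * (Rabs x + sg) ^ i)
      + Rabs h * (Rabs h / sg * (Rabs x + sg) ^ i)).
    + apply Rplus_le_compat; apply Rmult_le_compat_l; try apply Rabs_pos; [easy|].
      now apply pow_incr_quotient.
    + apply Req_le. simpl. field. lra.
Qed.

Lemma bsum_shift_le (c : fam) D : (forall i j, 0 <= c i j) ->
  bsum D (fun i j => c (S i) j) <= bsum (S D) c.
Proof.
  intros H. unfold bsum.
  apply Rle_trans with (fsum D (fun i => fsum (S D) (fun j => c (S i) j))).
  - apply fsum_le; intros. apply fsum_mono; [lia|easy].
  - change (S D) with (1 + D)%nat at 2. rewrite fsum_split.
    assert (0 <= fsum 1 (fun i => fsum (S D) (fun j => c i j)))
      by (do 2 (apply fsum_nonneg; intros); easy).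
    simpl (1 + _)%nat. lra.
Qed.

Lemma abs_bound_shift c M : abs_bound c M -> abs_bound (fun i j => c (S i) j) M.
Proof.
  intros H D. eapply Rle_trans; [|apply (H (S D))].
  apply (bsum_shift_le (fun i j => Rabs (c i j))). intros; apply Rabs_pos.
Qed.

Lemma bnd_dx a r r' s M :
  0 <= r' < r -> 0 <= s -> bnd a (monom r s) M -> bnd (dx a) (monom r' s) (/ (r - r') * M).
Proof.
  intros Hr Hs Ha.
  assert (H := abs_bound_scal (/ (r - r')) _ _ (abs_bound_shift _ _ Ha)).
  rewrite Rabs_pos_eq in H by (left; apply Rinv_0_lt_compat; lra).
  eapply abs_bound_le; [|apply H].
  intros i j. unfold dx, monom.
  generalize (pow_derive_bound r' (r - r') i ltac:(lra)).
  rewrite (Rabs_pos_eq r') by lra. replace (r' + (r - r')) with r by ring.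
  intros Hb. rewrite !Rabs_mult.
  rewrite (Rabs_pos_eq (/ (r - r'))) by (left; apply Rinv_0_lt_compat; lra).
  rewrite Rabs_mult in Hb. rewrite (Rabs_pos_eq (r ^ S i)) by (apply pow_le; lra).
  replace (Rabs (INR (S i)) * Rabs (a (S i) j) * (Rabs (r' ^ i) * Rabs (s ^ j)))
    with (Rabs (a (S i) j) * Rabs (s ^ j) * (Rabs (INR (S i)) * Rabs (r' ^ i))) by ring.
  replace (/ (r - r') * (Rabs (a (S i) j) * (r ^ S i * Rabs (s ^ j))))
    with (Rabs (a (S i) j) * Rabs (s ^ j) * (/ (r - r') * r ^ S i)) by ring.
  apply Rmult_le_compat_l; [apply Rmult_le_pos; apply Rabs_pos|easy].
Qed.

Definition transpose (a : fam) : fam := fun i j => a j i.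

Lemma abs_bound_transpose c M : abs_bound c M -> abs_bound (transpose c) M.
Proof.
  intros H D. unfold bsum, transpose. rewrite fsum_switch. apply H.
Qed.

Lemma bnd_transpose a r s M : bnd a (monom r s) M -> bnd (transpose a) (monom s r) M.
Proof.
  intros H. eapply abs_bound_le; [|apply (abs_bound_transpose _ _ H)].
  intros i j. unfold transpose, monom. apply Req_le. f_equal. ring.
Qed.

Lemma dy_transpose a : dy a = transpose (dx (transpose a)).
Proof. easy. Qed.

Lemma fsum_rev n f : fsum (S n) f = fsum (S n) (fun i => f (n - i)%nat).
Proof.
  induction n as [|n IH]; [easy|].
  transitivity (fsum (S n) f + f (S n)); [easy|].
  change (S (S n)) with (1 + S n)%nat. rewrite fsum_split, IH.
  assert (H : fsum 1 (fun i => f (1 + n - i)%nat) = f (S n))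
    by (simpl; apply Rplus_0_l).
  simpl (1 + n)%nat in *. rewrite H, Rplus_comm. easy.
Qed.

Lemma ev_transpose a x y : ev (transpose a) y x = ev a x y.
Proof.
  unfold ev, dsum. apply Series_ext; intros n. unfold diag.
  rewrite fsum_rev. apply fsum_ext; intros i Hi. unfold transpose, monom.
  replace (n - (n - i))%nat with i by lia. ring.
Qed.

Lemma bnd_dy a r s s' M :
  0 <= r -> 0 <= s' < s -> bnd a (monom r s) M -> bnd (dy a) (monom r s') (/ (s - s') * M).
Proof.
  intros Hr Hs Ha. rewrite dy_transpose. apply bnd_transpose, bnd_dx; [easy|easy|].
  now apply bnd_transpose.
Qed.

Lemma is_derive_ev_x a x y r s M :
  Rabs x < r -> Rabs y <= s -> bnd a (monom r s) M ->
  is_derive (fun x => ev a x y) x (ev (dx a) x y).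
Proof.
  intros Hx Hy Ha. apply is_derive_Reals. intros eps Heps.
  assert (HM := bnd_nonneg _ _ _ Ha). assert (Hx0 := Rabs_pos x).
  set (sg := r - Rabs x).
  assert (Hsg : 0 < sg) by (unfold sg; lra).
  assert (Hd : 0 < Rmin sg (eps * sg ^ 2 / (M + 1))).
  { apply Rmin_glb_lt; [easy|]. apply Rdiv_lt_0_compat; [|lra].
    apply Rmult_lt_0_compat; [easy|]. now apply pow_lt. }
  exists (mkposreal _ Hd). intros h Hh0 Hh. simpl in Hh.
  assert (Hh1 : Rabs h < sg) by (eapply Rlt_le_trans; [apply Hh|apply Rmin_l]).
  assert (Hh2 : Rabs h < eps * sg ^ 2 / (M + 1))
    by (eapply Rlt_le_trans; [apply Hh|apply Rmin_r]).
  assert (Hq : ev a (x + h) y - ev a x y - h * ev (dx a) x y =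
    dsum (fun i j => a i j * (((x + h) ^ i - x ^ i - h * (INR i * x ^ pred i)) * y ^ j))).
  { assert (H1 : abs_bound (fun i j => a i j * monom (x + h) y i j) M).
    { apply ev_family with r s; [|easy|easy].
      eapply Rle_trans; [apply Rabs_triang|]. unfold sg in *; lra. }
    assert (H2 : abs_bound (fun i j => a i j * monom x y i j) M)
      by (apply ev_family with r s; try easy; lra).
    assert (H3 : exists N, abs_bound (fun i j => a i j * (INR i * x ^ pred i * y ^ j)) N /\
      ev (dx a) x y = dsum (fun i j => a i j * (INR i * x ^ pred i * y ^ j))).
    { (* the constant terms disappear, whence a shift of the summation index *)
      set (c := fun i j => a i j * (INR i * x ^ pred i * y ^ j)).
      assert (Hc : abs_bound c (/ sg * M)).
      { assert (H := abs_bound_scal (/ sg) _ _ Ha).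
        rewrite Rabs_pos_eq in H by (left; now apply Rinv_0_lt_compat).
        eapply abs_bound_le; [|apply H]. intros i j. unfold c, monom.
        assert (Hyj : Rabs (y ^ j) <= Rabs (s ^ j)).
        { rewrite <- !RPow_abs. apply pow_incr; split; [apply Rabs_pos|].
          rewrite (Rabs_pos_eq s); [easy|generalize (Rabs_pos y); lra]. }
        assert (Hxi : Rabs (INR i * x ^ pred i) <= / sg * Rabs (r ^ i)).
        { destruct i as [|i]; simpl pred.
          - simpl. rewrite Rmult_0_l, Rabs_R0, Rabs_R1.
            left; apply Rmult_lt_0_compat; [now apply Rinv_0_lt_compat|lra].
          - eapply Rle_trans; [apply pow_derive_bound, Hsg|].
            apply Rmult_le_compat_l; [left; now apply Rinv_0_lt_compat|].
            unfold sg. replace (Rabs x + (r - Rabs x)) with r by ring.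
            apply Rle_abs. }
        rewrite !(Rabs_mult (a i j)), !(Rabs_mult (/ sg)), (Rabs_mult _ (y ^ j)),
          !(Rabs_mult (a i j)), (Rabs_mult (r ^ i)).
        rewrite (Rabs_pos_eq (/ sg)) by (left; now apply Rinv_0_lt_compat).
        replace (/ sg * (Rabs (a i j) * (Rabs (r ^ i) * Rabs (s ^ j)))) with
          (Rabs (a i j) * (/ sg * Rabs (r ^ i) * Rabs (s ^ j))) by ring.
        apply Rmult_le_compat_l; [apply Rabs_pos|].
        apply Rmult_le_compat; try apply Rabs_pos; easy. }
      exists (/ sg * M). split; [easy|].
      unfold ev, dsum. rewrite (Series_incr_1 (diag c)) by now apply dsum_ex with (/ sg * M).
      replace (diag c 0) with 0 by (unfold diag, c; simpl; ring).
      rewrite Rplus_0_l. apply Series_ext; intros n.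
      unfold diag. change (S (S n)) with (1 + S n)%nat. rewrite fsum_split.
      replace (fsum 1 (fun i => c i (S n - i)%nat)) with 0 by (unfold c; simpl; ring).
      rewrite Rplus_0_l. apply fsum_ext; intros i Hi. unfold dx, c, monom.
      change (1 + i)%nat with (S i). rewrite Nat.sub_succ. simpl pred. ring. }
    destruct H3 as [N [H3 ->]]. unfold ev.
    assert (H4 := abs_bound_plus _ _ _ _ H1 (abs_bound_scal (-1) _ _ H2)).
    transitivity (dsum (fun i j => (a i j * monom (x + h) y i j + -1 * (a i j * monom x y i j))
      + (- h) * (a i j * (INR i * x ^ pred i * y ^ j)))).
    - rewrite (dsum_plus _ _ _ _ H4 (abs_bound_scal (- h) _ _ H3)).
      rewrite (dsum_plus _ _ _ _ H1 (abs_bound_scal (-1) _ _ H2)).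
      rewrite !dsum_scal. ring.
    - f_equal. apply fam_ext; intros i j. unfold monom. ring. }
  assert (Hb : Rabs (ev a (x + h) y - ev a x y - h * ev (dx a) x y) <= (Rabs h / sg) ^ 2 * M).
  { rewrite Hq. apply dsum_bound.
    assert (Hp : 0 <= (Rabs h / sg) ^ 2) by apply pow2_ge_0.
    assert (H := abs_bound_scal ((Rabs h / sg) ^ 2) _ _ Ha).
    rewrite (Rabs_pos_eq _ Hp) in H. eapply abs_bound_le; [|apply H].
    intros i j. rewrite !Rabs_mult, (Rabs_pos_eq _ Hp). unfold monom.
    rewrite Rabs_mult.
    assert (Hyj : Rabs (y ^ j) <= Rabs (s ^ j)).
    { rewrite <- !RPow_abs. apply pow_incr; split; [apply Rabs_pos|].
      rewrite (Rabs_pos_eq s); [easy|generalize (Rabs_pos y); lra]. }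
    assert (Hxi : Rabs ((x + h) ^ i - x ^ i - h * (INR i * x ^ pred i))
      <= (Rabs h / sg) ^ 2 * Rabs (r ^ i)).
    { eapply Rle_trans; [apply pow_taylor2_bound with (sg := sg); lra|].
      apply Rmult_le_compat_l; [easy|].
      unfold sg. replace (Rabs x + (r - Rabs x)) with r by ring. apply Rle_abs. }
    replace ((Rabs h / sg) ^ 2 * (Rabs (a i j) * (Rabs (r ^ i) * Rabs (s ^ j)))) with
      (Rabs (a i j) * ((Rabs h / sg) ^ 2 * Rabs (r ^ i) * Rabs (s ^ j))) by ring.
    apply Rmult_le_compat_l; [apply Rabs_pos|].
    apply Rmult_le_compat; try apply Rabs_pos; easy. }
  replace ((ev a (x + h) y - ev a x y) / h - ev (dx a) x y)
    with ((ev a (x + h) y - ev a x y - h * ev (dx a) x y) / h) by (field; easy).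
  rewrite Rabs_div by easy.
  assert (Hhp : 0 < Rabs h) by now apply Rabs_pos_lt.
  apply Rmult_lt_reg_r with (Rabs h); [easy|].
  replace (Rabs (ev a (x + h) y - ev a x y - h * ev (dx a) x y) / Rabs h * Rabs h)
    with (Rabs (ev a (x + h) y - ev a x y - h * ev (dx a) x y)) by (field; lra).
  eapply Rle_lt_trans; [apply Hb|].
  assert (Hs2 : 0 < sg ^ 2) by now apply pow_lt.
  apply Rle_lt_trans with (Rabs h * (Rabs h * (M / sg ^ 2))).
  { apply Req_le. field. lra. }
  rewrite (Rmult_comm eps). apply Rmult_lt_compat_l; [easy|].
  apply Rle_lt_trans with (Rabs h * ((M + 1) / sg ^ 2)).
  { apply Rmult_le_compat_l; [lra|]. apply Rmult_le_compat_r; [|lra].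
    left; now apply Rinv_0_lt_compat. }
  apply Rmult_lt_reg_r with (sg ^ 2 / (M + 1)); [apply Rdiv_lt_0_compat; lra|].
  replace (Rabs h * ((M + 1) / sg ^ 2) * (sg ^ 2 / (M + 1))) with (Rabs h) by (field; lra).
  replace (eps * (sg ^ 2 / (M + 1))) with (eps * sg ^ 2 / (M + 1)) by (field; lra).
  easy.
Qed.

Lemma is_derive_ev_y a x y r s M :
  Rabs x <= r -> Rabs y < s -> bnd a (monom r s) M ->
  is_derive (fun y => ev a x y) y (ev (dy a) x y).
Proof.
  intros Hx Hy Ha. rewrite dy_transpose, ev_transpose.
  apply is_derive_ext with (fun y => ev (transpose a) y x);
    [intros t; apply ev_transpose|].
  apply is_derive_ev_x with s r M; try easy. now apply bnd_transpose.
Qed.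

(** * Analytic germs and their coefficients *)

(** Convergence on an open polydisc is stated through all smaller radii, so that it is
    inherited by derivatives without loss. *)
Definition cvr (r : R) (a : fam) : Prop :=
  forall r', 0 < r' < r -> exists M, bnd a (monom r' r') M.

(** The function [f] is given near the origin by the series [a]; everything about germs
    is read off such a series. *)
Definition rep (r : R) (f : R -> R -> R) (a : fam) : Prop :=
  0 < r /\ cvr r a /\
  forall x y, Rabs x < r -> Rabs y < r -> f x y = ev a x y.

Lemma cvr_shrink (r s : R) a : s <= r -> cvr r a -> cvr s a.
Proof. intros H Ha r' Hr'. apply Ha. lra. Qed.

Lemma cvr_bnd s M a : 0 < s -> bnd a (monom s s) M -> cvr s a.
Proof.
  intros Hs Ha r' Hr'. exists M. apply bnd_weight with (2 := Ha).
  intros; apply monom_mono; lra.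
Qed.

Lemma cvr_add r a b : cvr r a -> cvr r b -> cvr r (padd a b).
Proof.
  intros Ha Hb r' Hr'. destruct (Ha r' Hr') as [M HM], (Hb r' Hr') as [N HN].
  exists (M + N). now apply bnd_add.
Qed.

Lemma cvr_scal r k a : cvr r a -> cvr r (pscal k a).
Proof.
  intros Ha r' Hr'. destruct (Ha r' Hr') as [M HM].
  exists (Rabs k * M). now apply bnd_scal.
Qed.

Lemma cvr_mul r a b : cvr r a -> cvr r b -> cvr r (pmul a b).
Proof.
  intros Ha Hb r' Hr'. destruct (Ha r' Hr') as [M HM], (Hb r' Hr') as [N HN].
  exists (M * N). apply bnd_mul; try easy. apply monom_submult; lra.
Qed.

Lemma cvr_single r k l v : cvr r (single k l v).
Proof. intros r' Hr'. eexists. apply bnd_single. Qed.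

Lemma cvr_dx r a : cvr r a -> cvr r (dx a).
Proof.
  intros Ha r' Hr'. destruct (Ha ((r' + r) / 2)) as [M HM]; [lra|].
  exists (/ ((r' + r) / 2 - r') * M).
  apply bnd_weight with (monom r' ((r' + r) / 2)); [intros; apply monom_mono; lra|].
  apply bnd_dx; lra || easy.
Qed.

Lemma cvr_dy r a : cvr r a -> cvr r (dy a).
Proof.
  intros Ha r' Hr'. destruct (Ha ((r' + r) / 2)) as [M HM]; [lra|].
  exists (/ ((r' + r) / 2 - r') * M).
  apply bnd_weight with (monom ((r' + r) / 2) r'); [intros; apply monom_mono; lra|].
  apply bnd_dy; lra || easy.
Qed.

Lemma cvr_at r a x y : cvr r a -> Rabs x < r -> Rabs y < r ->
  exists r' M, Rabs x < r' < r /\ Rabs y < r' /\ bnd a (monom r' r') M.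
Proof.
  intros Ha Hx Hy. assert (Hm : Rmax (Rabs x) (Rabs y) < r) by now apply Rmax_lub_lt.
  assert (H1 := Rmax_l (Rabs x) (Rabs y)). assert (H2 := Rmax_r (Rabs x) (Rabs y)).
  assert (H3 := Rabs_pos x).
  destruct (Ha ((Rmax (Rabs x) (Rabs y) + r) / 2)) as [M HM]; [lra|].
  exists ((Rmax (Rabs x) (Rabs y) + r) / 2), M. repeat split; lra || easy.
Qed.



Lemma eva_add r a b x y : cvr r a -> cvr r b -> Rabs x < r -> Rabs y < r ->
  ev (padd a b) x y = ev a x y + ev b x y.
Proof.
  intros Ha Hb Hx Hy. destruct (cvr_at r a x y Ha Hx Hy) as (r' & M & H1 & H2 & HM).
  assert (0 <= Rabs x) by apply Rabs_pos.
  destruct (Hb r') as [N HN]; [lra|]. apply ev_add with r' r' M N; lra || easy.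
Qed.

Lemma eva_mul r a b x y : cvr r a -> cvr r b -> Rabs x < r -> Rabs y < r ->
  ev (pmul a b) x y = ev a x y * ev b x y.
Proof.
  intros Ha Hb Hx Hy. destruct (cvr_at r a x y Ha Hx Hy) as (r' & M & H1 & H2 & HM).
  assert (0 <= Rabs x) by apply Rabs_pos.
  destruct (Hb r') as [N HN]; [lra|]. apply ev_mul with r' r' M N; lra || easy.
Qed.

Lemma eva_dx r a x y : cvr r a -> Rabs x < r -> Rabs y < r ->
  is_derive (fun x => ev a x y) x (ev (dx a) x y).
Proof.
  intros Ha Hx Hy. destruct (cvr_at r a x y Ha Hx Hy) as (r' & M & H1 & H2 & HM).
  apply is_derive_ev_x with r' r' M; lra || easy.
Qed.

Lemma eva_dy r a x y : cvr r a -> Rabs x < r -> Rabs y < r ->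
  is_derive (fun y => ev a x y) y (ev (dy a) x y).
Proof.
  intros Ha Hx Hy. destruct (cvr_at r a x y Ha Hx Hy) as (r' & M & H1 & H2 & HM).
  apply is_derive_ev_y with r' r' M; lra || easy.
Qed.

Lemma rep_shrink r s f a : 0 < s <= r -> rep r f a -> rep s f a.
Proof.
  intros Hs (Hr & Ha & Hf). split; [lra|]. split; [now apply cvr_shrink with r|].
  intros; apply Hf; lra.
Qed.

Lemma rep_ev r a : 0 < r -> cvr r a -> rep r (ev a) a.
Proof. intros; repeat split; easy. Qed.

Lemma rep_ext r f g a :
  (forall x y, Rabs x < r -> Rabs y < r -> g x y = f x y) -> rep r f a -> rep r g a.
Proof.
  intros H (Hr & Ha & Hf). repeat split; try easy. intros. rewrite H; auto.
Qed.

Lemma rep_add r f g a b : rep r f a -> rep r g b -> rep r (fun x y => f x y + g x y) (padd a b).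
Proof.
  intros (Hr & Ha & Hf) (_ & Hb & Hg). repeat split; [easy|now apply cvr_add|].
  intros. rewrite (eva_add r), Hf, Hg; easy.
Qed.

Lemma rep_mul r f g a b : rep r f a -> rep r g b -> rep r (fun x y => f x y * g x y) (pmul a b).
Proof.
  intros (Hr & Ha & Hf) (_ & Hb & Hg). repeat split; [easy|now apply cvr_mul|].
  intros. rewrite (eva_mul r), Hf, Hg; easy.
Qed.

Lemma rep_scal r k f a : rep r f a -> rep r (fun x y => k * f x y) (pscal k a).
Proof.
  intros (Hr & Ha & Hf). repeat split; [easy|now apply cvr_scal|].
  intros. rewrite ev_scal, Hf; easy.
Qed.

Lemma rep_const r k : 0 < r -> rep r (fun _ _ => k) (pconst k).
Proof.
  intros. repeat split; [easy|apply cvr_single|]. intros; now rewrite ev_const.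
Qed.

Lemma rep_px r : 0 < r -> rep r (fun x _ => x) px.
Proof. intros. repeat split; [easy|apply cvr_single|]. intros; now rewrite ev_px. Qed.

Lemma rep_py r : 0 < r -> rep r (fun _ y => y) py.
Proof. intros. repeat split; [easy|apply cvr_single|]. intros; now rewrite ev_py. Qed.

Lemma ball_nbhd x r : Rabs x < r -> locally x (fun t => Rabs t < r).
Proof.
  intros H. assert (Hp : 0 < r - Rabs x) by lra.
  exists (mkposreal _ Hp). intros t Ht.
  assert (H1 : Rabs (Rminus t x) < r - Rabs x) by apply Ht.
  assert (H2 : Rabs t <= Rabs (Rminus t x) + Rabs x).
  { eapply Rle_trans; [|apply Rabs_triang]. apply Req_le; f_equal.
    unfold Rminus. rewrite Rplus_assoc, Rplus_opp_l, Rplus_0_r. easy. }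
  lra.
Qed.

Lemma rep_is_derive_x r f a x y : rep r f a -> Rabs x < r -> Rabs y < r ->
  is_derive (fun t => f t y) x (ev (dx a) x y).
Proof.
  intros (Hr & Ha & Hf) Hx Hy. apply is_derive_ext_loc with (fun t => ev a t y).
  - generalize (ball_nbhd x r Hx). apply filter_imp. intros; symmetry; auto.
  - now apply eva_dx with r.
Qed.

Lemma rep_is_derive_y r f a x y : rep r f a -> Rabs x < r -> Rabs y < r ->
  is_derive (fun t => f x t) y (ev (dy a) x y).
Proof.
  intros (Hr & Ha & Hf) Hx Hy. apply is_derive_ext_loc with (fun t => ev a x t).
  - generalize (ball_nbhd y r Hy). apply filter_imp. intros; symmetry; auto.
  - now apply eva_dy with r.
Qed.

Lemma rep_Derive_x r f a : rep r f a -> rep r (fun x y => Derive (fun t => f t y) x) (dx a).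
Proof.
  intros H. repeat split; [apply H|apply cvr_dx, H|].
  intros. apply is_derive_unique. now apply rep_is_derive_x with r.
Qed.

Lemma rep_Derive_y r f a : rep r f a -> rep r (fun x y => Derive (fun t => f x t) y) (dy a).
Proof.
  intros H. repeat split; [apply H|apply cvr_dy, H|].
  intros. apply is_derive_unique. now apply rep_is_derive_y with r.
Qed.

Lemma rep_partial r f a i j : rep r f a ->
  rep r (partial_derive i j f) (Nat.iter i dx (Nat.iter j dy a)).
Proof.
  intros H.
  assert (Hj : rep r (fun x y => Derive_n (fun z => f x z) j y) (Nat.iter j dy a)).
  { induction j as [|j IH]; [easy|]. apply rep_Derive_y in IH. apply IH. }
  unfold partial_derive. induction i as [|i IH]; [easy|].
  apply rep_Derive_x in IH. apply IH.
Qed.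

Lemma ev_0 a : ev a 0 0 = a O O.
Proof.
  transitivity (ev (single 0 0 (a O O)) 0 0); [|rewrite ev_single; simpl; ring].
  unfold ev. f_equal. apply fam_ext; intros i j. unfold single, monom.
  destruct i, j; simpl; ring.
Qed.

Lemma iter_dx k a i j :
  INR (fact i) * Nat.iter k dx a i j = INR (fact (i + k)) * a (i + k)%nat j.
Proof.
  revert i. induction k as [|k IH]; intros i.
  - simpl. rewrite Nat.add_0_r. easy.
  - change (Nat.iter (S k) dx a i j) with (INR (S i) * Nat.iter k dx a (S i) j).
    replace (i + S k)%nat with (S i + k)%nat by lia. rewrite <- IH.
    change (fact (S i)) with (S i * fact i)%nat. rewrite mult_INR. ring.
Qed.

Lemma iter_dy k a i j :
  INR (fact j) * Nat.iter k dy a i j = INR (fact (j + k)) * a i (j + k)%nat.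
Proof.
  revert j. induction k as [|k IH]; intros j.
  - simpl. rewrite Nat.add_0_r. easy.
  - change (Nat.iter (S k) dy a i j) with (INR (S j) * Nat.iter k dy a i (S j)).
    replace (j + S k)%nat with (S j + k)%nat by lia. rewrite <- IH.
    change (fact (S j)) with (S j * fact j)%nat. rewrite mult_INR. ring.
Qed.

Lemma rep_coeff r f a i j : rep r f a ->
  partial_derive i j f 0 0 = INR (fact i) * INR (fact j) * a i j.
Proof.
  intros H. destruct (rep_partial r f a i j H) as (Hr & _ & ->);
    [|rewrite Rabs_R0; easy|rewrite Rabs_R0; easy].
  rewrite ev_0. generalize (iter_dx i (Nat.iter j dy a) 0 0) (iter_dy j a i 0).
  simpl (0 + _)%nat. simpl (INR (fact 0)). rewrite !Rmult_1_l.
  intros -> ->. ring.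
Qed.

Lemma rep_unique r s f a b : rep r f a -> rep s f b -> a = b.
Proof.
  intros Ha Hb. apply fam_ext; intros i j.
  generalize (rep_coeff r f a i j Ha). rewrite (rep_coeff s f b i j Hb). intros H.
  apply Rmult_eq_reg_l with (INR (fact i) * INR (fact j)); [easy|].
  apply Rmult_integral_contrapositive; split; apply INR_fact_neq_0.
Qed.

Lemma rep_analytic r f a : rep r f a -> analytic_at_origin f.
Proof.
  intros (Hr & Ha & Hf). exists a, (mkposreal r Hr). simpl. intros x y.
  rewrite !Rminus_0_r. intros Hx Hy.
  destruct (cvr_at r a x y Ha Hx Hy) as (r' & M & H1 & H2 & HM).
  assert (H : abs_bound (fun i j => a i j * monom x y i j) M)
    by (apply ev_family with r' r'; lra || easy).
  assert (Hd : forall n, sum_n (fun i => a i (n - i)%nat * x ^ i * y ^ (n - i)) n =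
    diag (fun i j => a i j * monom x y i j) n).
  { intros n. rewrite fsum_sum_n. apply fsum_ext; intros. unfold monom. ring. }
  split.
  - destruct (dsum_abs_ex _ _ H) as [He _]. revert He. apply ex_series_ext. intros n.
    rewrite fsum_sum_n. apply fsum_ext; intros. f_equal. unfold monom; ring.
  - rewrite (Hf x y Hx Hy).
    apply is_series_ext with (diag (fun i j => a i j * monom x y i j)); [easy|].
    apply Series_correct. now apply dsum_ex with M.
Qed.

Lemma analytic_rep f : analytic_at_origin f -> exists r a, rep r f a.
Proof.
  intros (a & d & H). exists (d / 2), a. assert (Hd := cond_pos d).
  split; [lra|]. split.
  - destruct (H (d / 2) (d / 2)) as [He _];
      try (rewrite Rminus_0_r, Rabs_pos_eq; lra).
    apply cvr_bnd with
      (Series (fun n => sum_n (fun i => Rabs (a i (n - i)%nat * (d / 2) ^ i * (d / 2) ^ (n - i))) n));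
      [lra|].
    intros D. eapply Rle_trans; [apply box_diag; intros; apply Rabs_pos|].
    set (u := fun n => _) in *.
    assert (Hu : forall n, 0 <= u n).
    { intros n. unfold u. rewrite fsum_sum_n. apply fsum_nonneg; intros; apply Rabs_pos. }
    rewrite (fsum_ext _ _ u).
    + apply Rle_trans with (fsum (S (D + D)) u); [apply fsum_mono; [lia|easy]|].
      rewrite <- fsum_sum_n.
      apply (is_lim_seq_incr_compare (sum_n u)); [apply (Series_correct _ He)|].
      intros n. rewrite !fsum_sum_n. apply fsum_mono; [lia|easy].
    + intros n _. unfold u, diag. rewrite fsum_sum_n.
      apply fsum_ext; intros. unfold monom. f_equal; ring.
  - intros x y Hx Hy. destruct (H x y) as [_ Hs]; try (rewrite Rminus_0_r; lra).
    symmetry. unfold ev, dsum. rewrite <- (is_series_unique _ _ Hs).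
    apply Series_ext; intros n. rewrite fsum_sum_n. apply fsum_ext; intros.
    unfold monom; ring.
Qed.

Definition row0 (a : fam) : fam := fun i j => if Nat.eq_dec i 0 then a i j else 0.
Definition divx (a : fam) : fam := fun i j => a (S i) j.

Lemma row0_divx a : a = padd (row0 a) (pmul px (divx a)).
Proof.
  apply fam_ext; intros i j. unfold padd, row0, px. rewrite pmul_single.
  destruct (le_dec 0 j); [|lia]. unfold divx.
  destruct (Nat.eq_dec i 0) as [->|]; destruct (le_dec 1 _); try lia; try ring.
  rewrite Nat.sub_0_r. replace (S (i - 1)) with i by lia. ring.
Qed.

Lemma cvr_row0 r a : cvr r a -> cvr r (row0 a).
Proof.
  intros Ha r' Hr'. destruct (Ha r' Hr') as [M HM]. exists M.
  eapply abs_bound_le; [|apply HM]. intros i j. unfold row0.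
  destruct (Nat.eq_dec i 0); [lra|]. rewrite Rmult_0_l, Rabs_R0. apply Rabs_pos.
Qed.

Lemma cvr_divx r a : cvr r a -> cvr r (divx a).
Proof.
  intros Ha r' Hr'. destruct (Ha r' Hr') as [M HM]. exists (/ r' * M).
  assert (H := abs_bound_scal (/ r') _ _ (abs_bound_shift _ _ HM)).
  rewrite Rabs_pos_eq in H by (left; apply Rinv_0_lt_compat; lra).
  eapply abs_bound_le; [|apply H]. intros i j. unfold divx, monom. simpl.
  apply Req_le. f_equal. field. lra.
Qed.

Definition divy (a : fam) : fam := transpose (divx (transpose a)).

Lemma cvr_transpose r a : cvr r a -> cvr r (transpose a).
Proof.
  intros Ha r' Hr'. destruct (Ha r' Hr') as [M HM]. exists M. now apply bnd_transpose.
Qed.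

Lemma cvr_divy r a : cvr r a -> cvr r (divy a).
Proof. intros. now apply cvr_transpose, cvr_divx, cvr_transpose. Qed.

(** * Composition of power series *)

Definition ord (k : nat) (a : fam) : Prop := forall n m, (n + m < k)%nat -> a n m = 0.
Definition agree (d : nat) (a b : fam) : Prop := forall n m, (n + m < d)%nat -> a n m = b n m.

Definition ppow (a : fam) (n : nat) : fam := Nat.iter n (pmul a) (pconst 1).

(** When [A] and [B] have no constant term, the monomials omitted here contribute nothing to
    the coefficient [(n, m)]. *)
Definition pcomp (F A B : fam) : fam := fun n m =>
  fsum (S (n + m)) (fun i => fsum (S (n + m)) (fun j =>
    F i j * pmul (ppow A i) (ppow B j) n m)).

Lemma ord_mul k l a b : ord k a -> ord l b -> ord (k + l) (pmul a b).
Proof.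
  intros Ha Hb n m H. apply fsum_0; intros i Hi. apply fsum_0; intros j Hj.
  destruct (lt_dec (i + j) k); [rewrite Ha by lia; ring|].
  rewrite Hb by lia; ring.
Qed.

Lemma ord_ppow a i : ord 1 a -> ord i (ppow a i).
Proof.
  intros Ha. induction i as [|i IH]; [intros n m H; lia|].
  apply (ord_mul 1 i a (ppow a i) Ha IH).
Qed.

Lemma agree_mul d e k l a a' b b' :
  agree d a a' -> agree e b b' -> ord k a -> ord k a' -> ord l b -> ord l b' ->
  agree (Nat.min (d + l) (e + k)) (pmul a b) (pmul a' b').
Proof.
  intros Ha Hb Hoa Hoa' Hob Hob' n m H.
  apply fsum_ext; intros i Hi. apply fsum_ext; intros j Hj.
  destruct (lt_dec (i + j) d) as [H1|H1].
  - rewrite (Ha i j H1).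
    destruct (lt_dec (n - i + (m - j)) e) as [H2|H2]; [now rewrite Hb|].
    rewrite Hoa' by lia; ring.
  - rewrite Hob, Hob' by lia; ring.
Qed.

Lemma agree_ppow d a a' i :
  agree d a a' -> ord 1 a -> ord 1 a' -> agree (d + i) (ppow a (S i)) (ppow a' (S i)).
Proof.
  intros H Ha Ha'. induction i as [|i IH].
  - replace (d + 0)%nat with (Nat.min (d + 0) (d + 1)) by lia.
    apply (agree_mul d d 1 0); try easy; intros n m Hn; lia.
  - replace (d + S i)%nat with (Nat.min (d + S i) (d + i + 1)) by lia.
    change (ppow a (S (S i))) with (pmul a (ppow a (S i))).
    change (ppow a' (S (S i))) with (pmul a' (ppow a' (S i))).
    apply agree_mul; try easy; now apply ord_ppow.
Qed.

Lemma agree_le d e a b : (e <= d)%nat -> agree d a b -> agree e a b.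
Proof. intros H Hab n m Hn. apply Hab. lia. Qed.

Lemma agree_monomial d a a' b b' i j :
  agree d a a' -> agree d b b' -> ord 1 a -> ord 1 a' -> ord 1 b -> ord 1 b' ->
  (2 <= i + j)%nat ->
  agree (S d) (pmul (ppow a i) (ppow b j)) (pmul (ppow a' i) (ppow b' j)).
Proof.
  intros Ha Hb Hoa Hoa' Hob Hob' Hij.
  assert (Hi := ord_ppow a i Hoa). assert (Hi' := ord_ppow a' i Hoa').
  assert (Hj := ord_ppow b j Hob). assert (Hj' := ord_ppow b' j Hob').
  destruct i as [|i]; destruct j as [|j]; [lia| | |].
  - apply agree_le with (Nat.min (S d + S j) (d + j + 0)); [lia|].
    apply agree_mul; try easy. now apply agree_ppow.
  - apply agree_le with (Nat.min (d + i + 0) (S d + S i)); [lia|].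
    apply agree_mul; try easy. now apply agree_ppow.
  - apply agree_le with (Nat.min (d + i + S j) (d + j + S i)); [lia|].
    apply agree_mul; try easy; now apply agree_ppow.
Qed.

Lemma bnd_ppow a w M i : submult w -> w O O = 1 -> bnd a w M -> bnd (ppow a i) w (M ^ i).
Proof.
  intros Hw Hw0 Ha. induction i as [|i IH]; simpl.
  - eapply bnd_le; [apply bnd_single|]. rewrite Hw0, Rmult_1_l, Rabs_R1. lra.
  - now apply bnd_mul.
Qed.

Lemma bsum_switch D E (G : nat -> nat -> nat -> nat -> R) :
  bsum D (fun n m => bsum E (fun i j => G i j n m)) =
  bsum E (fun i j => bsum D (fun n m => G i j n m)).
Proof.
  unfold bsum.
  transitivity (fsum D (fun n => fsum E (fun i => fsum D (fun m => fsum E (fun j => G i j n m))))).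
  { apply fsum_ext; intros n _. apply fsum_switch. }
  rewrite fsum_switch. apply fsum_ext; intros i _.
  transitivity (fsum D (fun n => fsum E (fun j => fsum D (fun m => G i j n m)))).
  { apply fsum_ext; intros n _. apply fsum_switch. }
  apply fsum_switch.
Qed.

Lemma bnd_comp F A B w MA MB K :
  submult w -> w O O = 1 -> bnd A w MA -> bnd B w MB -> bnd F (monom MA MB) K ->
  bnd (pcomp F A B) w K.
Proof.
  intros Hw Hw0 HA HB HF D. assert (Hwn := proj1 Hw).
  assert (HMA := bnd_nonneg _ _ _ HA). assert (HMB := bnd_nonneg _ _ _ HB).
  set (T := fun i j => pmul (ppow A i) (ppow B j)).
  apply Rle_trans with (bsum D (fun n m => bsum (D + D) (fun i j =>
    Rabs (F i j) * Rabs (T i j n m * w n m)))).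
  - unfold bsum at 1 2. apply fsum_le; intros n Hn. apply fsum_le; intros m Hm.
    apply Rle_trans with (bsum (S (n + m)) (fun i j => Rabs (F i j) * Rabs (T i j n m * w n m))).
    + unfold pcomp, bsum. rewrite Rabs_mult, (Rabs_pos_eq (w n m)) by easy.
      eapply Rle_trans; [apply Rmult_le_compat_r; [easy|apply fsum_Rabs]|].
      rewrite <- fsum_scal_r. apply fsum_le; intros i _.
      eapply Rle_trans; [apply Rmult_le_compat_r; [easy|apply fsum_Rabs]|].
      rewrite <- fsum_scal_r. apply fsum_le; intros j _.
      fold (T i j). rewrite !Rabs_mult, (Rabs_pos_eq (w n m)) by easy.
      apply Req_le; ring.
    + apply bsum_mono; [lia|]. intros; apply Rmult_le_pos; apply Rabs_pos.
  - rewrite bsum_switch. eapply Rle_trans; [|apply (HF (D + D)%nat)].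
    apply bsum_le; intros i j. rewrite bsum_scal, Rabs_mult.
    apply Rmult_le_compat_l; [apply Rabs_pos|].
    rewrite Rabs_pos_eq by (apply Rmult_le_pos; now apply pow_le).
    apply (bnd_mul _ _ w); [easy|now apply bnd_ppow|now apply bnd_ppow].
Qed.

Lemma comp_add F G A B : pcomp (padd F G) A B = padd (pcomp F A B) (pcomp G A B).
Proof.
  apply fam_ext; intros n m. unfold pcomp, padd. rewrite <- fsum_plus.
  apply fsum_ext; intros. rewrite <- fsum_plus. apply fsum_ext; intros. ring.
Qed.

Lemma comp_single k l v A B : ord 1 A -> ord 1 B ->
  pcomp (single k l v) A B = pscal v (pmul (ppow A k) (ppow B l)).
Proof.
  intros HA HB. apply fam_ext; intros n m. unfold pcomp, pscal.
  assert (Hz : forall i j, (i <> k \/ j <> l) ->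
    single k l v i j * pmul (ppow A i) (ppow B j) n m = 0).
  { intros i j H. unfold single. destruct (Nat.eq_dec i k), (Nat.eq_dec j l); try ring. lia. }
  destruct (le_dec (k + l) (n + m)) as [H|H].
  - rewrite (fsum_single _ k); [|lia|].
    + rewrite (fsum_single _ l); [|lia|intros; apply Hz; now right].
      unfold single. destruct (Nat.eq_dec k k), (Nat.eq_dec l l); easy.
    + intros i Hi. apply fsum_0; intros; apply Hz; now left.
  - rewrite (ord_mul k l _ _ (ord_ppow A k HA) (ord_ppow B l HB) n m) by lia.
    rewrite Rmult_0_r. apply fsum_0; intros i Hi. apply fsum_0; intros j Hj.
    destruct (Nat.eq_dec i k) as [->|]; [|apply Hz; now left].
    destruct (Nat.eq_dec j l) as [->|]; [|apply Hz; now right].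
    rewrite (ord_mul k l _ _ (ord_ppow A k HA) (ord_ppow B l HB) n m) by lia. ring.
Qed.

Lemma ev_ppow a x y r s M i :
  Rabs x <= r -> Rabs y <= s -> bnd a (monom r s) M -> ev (ppow a i) x y = ev a x y ^ i.
Proof.
  intros Hx Hy Ha.
  assert (Hr : 0 <= r) by (generalize (Rabs_pos x); lra).
  assert (Hs : 0 <= s) by (generalize (Rabs_pos y); lra).
  induction i as [|i IH]; [apply ev_const|].
  change (ppow a (S i)) with (pmul a (ppow a i)).
  rewrite (ev_mul a (ppow a i) x y r s M (M ^ i)); try easy.
  - now rewrite IH.
  - apply (bnd_ppow a (monom r s) M i); [now apply monom_submult|unfold monom; simpl; ring|easy].
Qed.

(** Both sides are bounded and linear in [F], so [F] may be taken a monomial. *)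
Lemma ev_comp F A B x y r MA MB K :
  ord 1 A -> ord 1 B -> Rabs x <= r -> Rabs y <= r ->
  bnd A (monom r r) MA -> bnd B (monom r r) MB -> bnd F (monom MA MB) K ->
  ev (pcomp F A B) x y = ev F (ev A x y) (ev B x y).
Proof.
  intros HoA HoB Hx Hy HA HB HF.
  assert (Hr : 0 <= r) by (generalize (Rabs_pos x); lra).
  assert (Hw := monom_submult r r Hr Hr).
  assert (Hw0 : monom r r O O = 1) by (unfold monom; simpl; ring).
  assert (HeA := ev_bound _ _ _ _ _ _ Hx Hy HA).
  assert (HeB := ev_bound _ _ _ _ _ _ Hx Hy HB).
  apply Rminus_diag_uniq.
  apply (functional_zero (monom MA MB) (fun F => ev (pcomp F A B) x y - ev F (ev A x y) (ev B x y)) 2)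
    with K; [| | |easy].
  - intros c d M N Hc Hd. change (fun i j => c i j + d i j) with (padd c d).
    rewrite comp_add, (ev_add (pcomp c A B) (pcomp d A B) x y r r M N);
      try easy; try (now apply bnd_comp with MA MB).
    rewrite (ev_add c d _ _ MA MB M N) by easy. ring.
  - intros c M Hc. eapply Rle_trans; [apply Rabs_triang|]. rewrite Rabs_Ropp.
    assert (Rabs (ev (pcomp c A B) x y) <= M).
    { apply ev_bound with r r; try easy. now apply bnd_comp with MA MB. }
    assert (Rabs (ev c (ev A x y) (ev B x y)) <= M) by now apply ev_bound with MA MB.
    lra.
  - intros k l v. rewrite comp_single, ev_scal, ev_single by easy.
    rewrite (ev_mul _ _ x y r r (MA ^ k) (MB ^ l)); try easy; try now apply bnd_ppow.
    rewrite (ev_ppow A x y r r MA), (ev_ppow B x y r r MB) by easy. ring.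
Qed.

Lemma bnd_ord k a r s M :
  0 < s <= r -> ord k a -> bnd a (monom r r) M -> bnd a (monom s s) ((s / r) ^ k * M).
Proof.
  intros Hs Ho Ha. assert (H := abs_bound_scal ((s / r) ^ k) _ _ Ha).
  assert (Hq : 0 <= s / r <= 1).
  { split; [apply Rdiv_le_0_compat; lra|]. apply Rmult_le_reg_r with r; [lra|].
    unfold Rdiv. rewrite Rmult_assoc, Rinv_l by lra. lra. }
  rewrite (Rabs_pos_eq ((s / r) ^ k)) in H by (apply pow_le; easy).
  eapply abs_bound_le; [|apply H]. intros i j.
  destruct (lt_dec (i + j) k) as [Hk|Hk].
  - rewrite Ho by easy. rewrite Rmult_0_l, Rabs_R0. apply Rabs_pos.
  - unfold monom. rewrite <- !pow_add, !Rabs_mult.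
    rewrite !(Rabs_pos_eq (_ ^ _)) by (apply pow_le; lra).
    replace ((s / r) ^ k * (Rabs (a i j) * r ^ (i + j)))
      with (Rabs (a i j) * ((s / r) ^ k * r ^ (i + j))) by ring.
    apply Rmult_le_compat_l; [apply Rabs_pos|].
    replace (s ^ (i + j)) with ((s / r) ^ (i + j) * r ^ (i + j)).
    2:{ rewrite <- Rpow_mult_distr. f_equal. field. lra. }
    apply Rmult_le_compat_r; [apply pow_le; lra|].
    replace (i + j)%nat with (k + (i + j - k))%nat by lia. rewrite pow_add.
    rewrite <- (Rmult_1_r ((s / r) ^ k)) at 2.
    apply Rmult_le_compat_l; [now apply pow_le|].
    rewrite <- (pow1 (i + j - k)). now apply pow_incr.
Qed.

Lemma cvr_ord k a r : 0 < r -> cvr r a -> ord k a ->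
  exists C, 0 < C /\ forall t, 0 < t <= r / 2 -> bnd a (monom t t) (C * t ^ k).
Proof.
  intros Hr Ha Ho. destruct (Ha (r / 2)) as [M HM]; [lra|].
  assert (HM0 := bnd_nonneg _ _ _ HM).
  assert (Hp : 0 < (/ (r / 2)) ^ k) by (apply pow_lt, Rinv_0_lt_compat; lra).
  exists ((/ (r / 2)) ^ k * (M + 1)). split; [nra|]. intros t Ht.
  eapply bnd_le; [apply (bnd_ord k _ (r / 2) t M); try easy; lra|].
  unfold Rdiv at 1. rewrite Rpow_mult_distr.
  assert (0 < t ^ k) by (apply pow_lt; lra).
  assert (0 < t ^ k * (/ (r / 2)) ^ k) by now apply Rmult_lt_0_compat.
  nra.
Qed.

Lemma cvr_comp R0 r F A B : 0 < R0 -> 0 < r -> cvr R0 F -> cvr r A -> cvr r B ->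
  ord 1 A -> ord 1 B ->
  exists s, 0 < s <= r /\ cvr s (pcomp F A B) /\
    forall x y, Rabs x < s -> Rabs y < s ->
      Rabs (ev A x y) < R0 /\ Rabs (ev B x y) < R0 /\
      ev (pcomp F A B) x y = ev F (ev A x y) (ev B x y).
Proof.
  intros HR Hr HF HA HB HoA HoB.
  destruct (cvr_ord 1 A r Hr HA HoA) as [C1 [HC1 H1]].
  destruct (cvr_ord 1 B r Hr HB HoB) as [C2 [HC2 H2]].
  destruct (HF (R0 / 2)) as [K HK]; [lra|].
  set (s := Rmin (r / 2) (R0 / 2 / (C1 + C2))).
  assert (Hq : 0 < R0 / 2 / (C1 + C2)) by (apply Rdiv_lt_0_compat; lra).
  assert (Hs : 0 < s) by (apply Rmin_glb_lt; lra).
  assert (Hs1 : s <= r / 2) by apply Rmin_l.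
  assert (Hs2 : s * (C1 + C2) <= R0 / 2).
  { replace (R0 / 2) with (R0 / 2 / (C1 + C2) * (C1 + C2)) by (field; lra).
    apply Rmult_le_compat_r; [lra|apply Rmin_r]. }
  specialize (H1 s ltac:(lra)). specialize (H2 s ltac:(lra)).
  rewrite pow_1 in H1, H2.
  apply bnd_le with (N := R0 / 2) in H1; [|nra].
  apply bnd_le with (N := R0 / 2) in H2; [|nra].
  exists s. split; [lra|]. split.
  - apply cvr_bnd with K; [easy|]. apply bnd_comp with (R0 / 2) (R0 / 2); try easy.
    + apply monom_submult; lra.
    + unfold monom; simpl; ring.
  - intros x y Hx Hy.
    assert (Rabs (ev A x y) <= R0 / 2) by (apply ev_bound with s s; lra || easy).
    assert (Rabs (ev B x y) <= R0 / 2) by (apply ev_bound with s s; lra || easy).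
    repeat split; try lra.
    apply ev_comp with s (R0 / 2) (R0 / 2) K; lra || easy.
Qed.

Lemma rep_comp R0 r f g h F A B : rep R0 f F -> rep r g A -> rep r h B ->
  A O O = 0 -> B O O = 0 ->
  exists s, 0 < s <= r /\ rep s (fun x y => f (g x y) (h x y)) (pcomp F A B).
Proof.
  intros (HR & HF & Hf) (Hr & HA & Hg) (_ & HB & Hh) HA0 HB0.
  assert (HoA : ord 1 A) by (intros [|] [|] H; try lia; easy).
  assert (HoB : ord 1 B) by (intros [|] [|] H; try lia; easy).
  destruct (cvr_comp R0 r F A B) as (s & Hs & Hc & H); try easy.
  exists s. split; [easy|]. repeat split; [lra|easy|].
  intros x y Hx Hy. destruct (H x y Hx Hy) as (H1 & H2 & ->).
  rewrite Hg, Hh by lra. now apply Hf.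
Qed.

(** * Fixed points of causal operators *)

(** The values in degree [d] stabilize after [d + 1] iterations, since each degree depends only
    on the lower ones. Any property preserved by the operator is inherited by truncations of
    the fixed point; this replaces completeness arguments. *)
Lemma causal_fixpoint (I : Type) (deg : I -> nat) (Phi : (I -> R) -> I -> R) :
  (forall d f g, (forall i, (deg i < d)%nat -> f i = g i) ->
     forall i, (deg i < S d)%nat -> Phi f i = Phi g i) ->
  exists f, (forall i, Phi f i = f i) /\
    forall P : (I -> R) -> Prop, P (fun _ => 0) -> (forall g, P g -> P (Phi g)) ->
      forall d, exists g, P g /\ forall i, (deg i < d)%nat -> g i = f i.
Proof.
  intros H. set (it := fun k => Nat.iter k Phi (fun _ => 0)).
  assert (Hit : forall k i, (deg i < k)%nat -> it k i = it (S k) i).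
  { induction k as [|k IH]; intros i Hi; [lia|].
    apply (H k (it k) (it (S k)) IH i Hi). }
  assert (Hst : forall k l i, (k <= l)%nat -> (deg i < k)%nat -> it l i = it k i).
  { intros k l i Hkl Hi. induction Hkl as [|l Hl IH]; [easy|].
    rewrite <- Hit by lia. easy. }
  exists (fun i => it (S (deg i)) i). split.
  - intros i. apply (H (deg i)); [|lia]. intros j Hj. symmetry.
    apply Hst; lia.
  - intros P HP0 HPS d. exists (it d). split.
    + induction d as [|d IH]; [easy|]. now apply HPS.
    + intros i Hi. apply Hst; lia.
Qed.

Lemma bnd_limit f w M :
  (forall d, exists g, bnd g w M /\ agree d g f) -> bnd f w M.
Proof.
  intros H D. destruct (H (D + D)%nat) as [g [Hg Ha]].
  eapply Rle_trans; [|apply (Hg D)]. apply Req_le.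
  apply fsum_ext; intros i Hi. apply fsum_ext; intros j Hj. rewrite Ha by lia. easy.
Qed.

(** * The analytic inverse function theorem *)

Definition strip (a : fam) : fam := fun n m => match n, m with O, O => 0 | _, _ => a n m end.

Lemma ord_strip a : ord 1 (strip a).
Proof. intros [|] [|] H; easy || lia. Qed.

Lemma bnd_strip a w M : bnd a w M -> bnd (strip a) w M.
Proof.
  apply abs_bound_le. intros [|i] [|j]; simpl; try apply Rle_refl.
  rewrite Rmult_0_l, Rabs_R0. apply Rabs_pos.
Qed.

(** A monomial of degree at least two in [A, B] sees, in degree [d], only coefficients of
    degree less than [d]: the other factor has no constant term. *)
Lemma comp_causal N d A A' B B' : ord 2 N -> agree d A A' -> agree d B B' ->
  ord 1 A -> ord 1 A' -> ord 1 B -> ord 1 B' -> agree (S d) (pcomp N A B) (pcomp N A' B').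
Proof.
  intros HN HA HB HoA HoA' HoB HoB' n m H. unfold pcomp.
  apply fsum_ext; intros i Hi. apply fsum_ext; intros j Hj.
  destruct (le_dec 2 (i + j)) as [Hij|Hij]; [|rewrite HN by lia; ring].
  f_equal. now apply (agree_monomial d).
Qed.

Lemma ord_comp k N A B : ord k N -> ord 1 A -> ord 1 B -> ord k (pcomp N A B).
Proof.
  intros HN HA HB n m H. apply fsum_0; intros i Hi. apply fsum_0; intros j Hj.
  destruct (lt_dec (i + j) k); [rewrite HN by easy; ring|].
  rewrite (ord_mul i j _ _ (ord_ppow A i HA) (ord_ppow B j HB)) by lia. ring.
Qed.

Lemma bnd_px r : 0 <= r -> bnd px (monom r r) r.
Proof.
  intros Hr. eapply bnd_le; [apply bnd_single|]. unfold monom; simpl.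
  rewrite Rabs_pos_eq; lra.
Qed.

Lemma bnd_py r : 0 <= r -> bnd py (monom r r) r.
Proof.
  intros Hr. eapply bnd_le; [apply bnd_single|]. unfold monom; simpl.
  rewrite Rabs_pos_eq; lra.
Qed.

(** Right inverse of the map germ [id + N], as the solution of [f = id - N o f]. *)
Lemma right_inverse R0 N1 N2 : 0 < R0 -> cvr R0 N1 -> cvr R0 N2 -> ord 2 N1 -> ord 2 N2 ->
  exists r M1 M2, 0 < r /\ cvr r M1 /\ cvr r M2 /\ ord 2 M1 /\ ord 2 M2 /\
    forall x y, Rabs x < r -> Rabs y < r ->
      let u := x + ev M1 x y in let v := y + ev M2 x y in
      Rabs u < R0 /\ Rabs v < R0 /\ u + ev N1 u v = x /\ v + ev N2 u v = y.
Proof.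
  intros HR HN1 HN2 Ho1 Ho2.
  set (fst_ := fun f : bool * (nat * nat) -> R => strip (fun n m => f (true, (n, m)))).
  set (snd_ := fun f : bool * (nat * nat) -> R => strip (fun n m => f (false, (n, m)))).
  set (Phi := fun (f : bool * (nat * nat) -> R) (i : bool * (nat * nat)) =>
    let (b, p) := i in let (n, m) := p in
    if b then px n m + -1 * pcomp N1 (fst_ f) (snd_ f) n m
    else py n m + -1 * pcomp N2 (fst_ f) (snd_ f) n m).
  destruct (causal_fixpoint _ (fun i => (fst (snd i) + snd (snd i))%nat) Phi)
    as [f [Hf HP]].
  { intros d f g Hfg [b [n m]] Hi. simpl in Hi. unfold Phi.
    assert (H1 : agree d (fst_ f) (fst_ g)).
    { intros [|n'] [|m'] Hn; unfold fst_, strip; try easy; now apply Hfg. }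
    assert (H2 : agree d (snd_ f) (snd_ g)).
    { intros [|n'] [|m'] Hn; unfold snd_, strip; try easy; now apply Hfg. }
    destruct b; f_equal; f_equal; apply (comp_causal _ d); try easy; apply ord_strip. }
  assert (Hsm : exists s, 0 < s < R0 / 2 /\ bnd N1 (monom (2 * s) (2 * s)) s
    /\ bnd N2 (monom (2 * s) (2 * s)) s).
  { destruct (cvr_ord 2 N1 R0 HR HN1 Ho1) as [C1 [HC1 H1]].
    destruct (cvr_ord 2 N2 R0 HR HN2 Ho2) as [C2 [HC2 H2]].
    set (s := Rmin (R0 / 4) (/ (4 * (C1 + C2)))).
    assert (Hq : 0 < / (4 * (C1 + C2))) by (apply Rinv_0_lt_compat; lra).
    assert (Hs : 0 < s) by (apply Rmin_glb_lt; lra).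
    assert (Hs1 : s <= R0 / 4) by apply Rmin_l.
    assert (Hs2 : s * (4 * (C1 + C2)) <= 1).
    { replace 1 with (/ (4 * (C1 + C2)) * (4 * (C1 + C2))) by (field; lra).
      apply Rmult_le_compat_r; [lra|apply Rmin_r]. }
    exists s. split; [lra|]. split.
    - eapply bnd_le; [apply H1; lra|]. simpl. nra.
    - eapply bnd_le; [apply H2; lra|]. simpl. nra. }
  destruct Hsm as (s & Hs & HbN1 & HbN2).
  assert (Hw : submult (monom s s)) by (apply monom_submult; lra).
  assert (Hw0 : monom s s O O = 1) by (unfold monom; simpl; ring).
  assert (Hm1 : Rabs (-1) = 1) by (rewrite Rabs_left; lra).
  assert (Hbd : bnd (fst_ f) (monom s s) (2 * s) /\ bnd (snd_ f) (monom s s) (2 * s)).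
  { assert (Hd : forall d, exists g, (bnd (fst_ g) (monom s s) (2 * s) /\
      bnd (snd_ g) (monom s s) (2 * s)) /\ agree d (fst_ g) (fst_ f) /\
      agree d (snd_ g) (snd_ f)).
    { intros d. destruct (HP (fun g => bnd (fst_ g) (monom s s) (2 * s) /\
        bnd (snd_ g) (monom s s) (2 * s))) with (d := d) as [g [Hg Ha]].
      - assert (Hz : bnd (strip (fun n m : nat => 0)) (monom s s) (2 * s)).
        { apply bnd_strip. intros D. apply Rle_trans with 0; [|lra]. apply Req_le.
          apply fsum_0; intros. apply fsum_0; intros. rewrite Rmult_0_l; apply Rabs_R0. }
        split; apply Hz.
      - intros g [Hg1 Hg2]. split.
        + apply bnd_strip. replace (2 * s) with (s + Rabs (-1) * s)
            by (rewrite Hm1; ring).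
          apply (bnd_add px (pscal (-1) (pcomp N1 (fst_ g) (snd_ g)))); [apply bnd_px; lra|].
          apply bnd_scal. now apply bnd_comp with (2 * s) (2 * s).
        + apply bnd_strip. replace (2 * s) with (s + Rabs (-1) * s)
            by (rewrite Hm1; ring).
          apply (bnd_add py (pscal (-1) (pcomp N2 (fst_ g) (snd_ g)))); [apply bnd_py; lra|].
          apply bnd_scal. now apply bnd_comp with (2 * s) (2 * s).
      - exists g. split; [easy|].
        split; intros [|n] [|m] Hn; try easy;
          first [apply (Ha (true, (_, _)) Hn)|apply (Ha (false, (_, _)) Hn)]. }
    split; apply bnd_limit; intros d; destruct (Hd d) as (g & [H1 H2] & H3 & H4);
      [now exists (fst_ g)|now exists (snd_ g)]. }
  destruct Hbd as [Hb1 Hb2].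
  assert (HoA : ord 1 (fst_ f)) by apply ord_strip.
  assert (HoB : ord 1 (snd_ f)) by apply ord_strip.
  set (M1 := pscal (-1) (pcomp N1 (fst_ f) (snd_ f))).
  set (M2 := pscal (-1) (pcomp N2 (fst_ f) (snd_ f))).
  assert (HM1 : ord 2 M1) by (intros n m H; unfold M1, pscal; rewrite (ord_comp 2 N1 _ _ Ho1 HoA HoB n m H); ring).
  assert (HM2 : ord 2 M2) by (intros n m H; unfold M2, pscal; rewrite (ord_comp 2 N2 _ _ Ho2 HoA HoB n m H); ring).
  assert (Hf1 : fst_ f = padd px M1).
  { apply fam_ext; intros n m. unfold fst_, strip.
    destruct n as [|n], m as [|m]; [|now rewrite <- Hf..].
    unfold padd. rewrite HM1 by lia. unfold px, single. simpl. ring. }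
  assert (Hf2 : snd_ f = padd py M2).
  { apply fam_ext; intros n m. unfold snd_, strip.
    destruct n as [|n], m as [|m]; [|now rewrite <- Hf..].
    unfold padd. rewrite HM2 by lia. unfold py, single. simpl. ring. }
  assert (HbM1 : bnd M1 (monom s s) (Rabs (-1) * s))
    by (apply bnd_scal; now apply bnd_comp with (2 * s) (2 * s)).
  assert (HbM2 : bnd M2 (monom s s) (Rabs (-1) * s))
    by (apply bnd_scal; now apply bnd_comp with (2 * s) (2 * s)).
  exists s, M1, M2. split; [easy|]. split; [now apply cvr_bnd with (Rabs (-1) * s)|].
  split; [now apply cvr_bnd with (Rabs (-1) * s)|]. split; [easy|]. split; [easy|].
  intros x y Hx Hy. simpl.
  assert (Hu : x + ev M1 x y = ev (fst_ f) x y).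
  { rewrite Hf1, (ev_add _ _ x y s s s (Rabs (-1) * s)), ev_px; try easy; try lra.
    apply bnd_px; lra. }
  assert (Hv : y + ev M2 x y = ev (snd_ f) x y).
  { rewrite Hf2, (ev_add _ _ x y s s s (Rabs (-1) * s)), ev_py; try easy; try lra.
    apply bnd_py; lra. }
  rewrite Hu, Hv.
  assert (Rabs (ev (fst_ f) x y) <= 2 * s) by (apply ev_bound with s s; lra || easy).
  assert (Rabs (ev (snd_ f) x y) <= 2 * s) by (apply ev_bound with s s; lra || easy).
  repeat split; try lra.
  - rewrite <- (ev_comp N1 _ _ x y s (2 * s) (2 * s) s), <- Hu by (lra || easy).
    unfold M1. rewrite ev_scal. ring.
  - rewrite <- (ev_comp N2 _ _ x y s (2 * s) (2 * s) s), <- Hv by (lra || easy).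
    unfold M2. rewrite ev_scal. ring.
Qed.

(** A right inverse [f] of [g] has itself a right inverse [h], and
    [g = g o (f o h) = h]; so [f] is two-sided. *)
Lemma inverse_function R0 N1 N2 : 0 < R0 -> cvr R0 N1 -> cvr R0 N2 -> ord 2 N1 -> ord 2 N2 ->
  exists r M1 M2, 0 < r /\ cvr r M1 /\ cvr r M2 /\ ord 2 M1 /\ ord 2 M2 /\
    (forall x y, Rabs x < r -> Rabs y < r ->
      let u := x + ev M1 x y in let v := y + ev M2 x y in
      u + ev N1 u v = x /\ v + ev N2 u v = y /\ Rabs u < R0 /\ Rabs v < R0) /\
    (forall x y, Rabs x < r -> Rabs y < r ->
      let u := x + ev N1 x y in let v := y + ev N2 x y in
      u + ev M1 u v = x /\ v + ev M2 u v = y).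
Proof.
  intros HR HN1 HN2 Ho1 Ho2.
  destruct (right_inverse R0 N1 N2 HR HN1 HN2 Ho1 Ho2)
    as (r & M1 & M2 & Hr & HM1 & HM2 & HoM1 & HoM2 & HM).
  destruct (right_inverse r M1 M2 Hr HM1 HM2 HoM1 HoM2)
    as (s & L1 & L2 & Hs & HL1 & HL2 & HoL1 & HoL2 & HL).
  exists (Rmin r s), M1, M2. assert (H1 := Rmin_l r s). assert (H2 := Rmin_r r s).
  split; [apply Rmin_glb_lt; easy|].
  split; [now apply cvr_shrink with r|]. split; [now apply cvr_shrink with r|].
  split; [easy|]. split; [easy|]. split.
  - intros x y Hx Hy u v. destruct (HM x y) as (H3 & H4 & H5 & H6); try lra. easy.
  - intros x y Hx Hy u v.
    destruct (HL x y) as (Ha & Hb & Hc & Hd); try lra.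
    set (a := x + ev L1 x y) in *. set (b := y + ev L2 x y) in *.
    destruct (HM a b Ha Hb) as (_ & _ & He & Hg).
    rewrite Hc, Hd in He, Hg.
    assert (Hua : u = a) by (unfold u; lra). assert (Hvb : v = b) by (unfold v; lra).
    rewrite Hua, Hvb. easy.
Qed.

Ltac cvr_tac := repeat match goal with
  | H : cvr ?r ?a |- cvr ?r ?a => exact H
  | |- cvr _ (padd _ _) => apply cvr_add
  | |- cvr _ (pmul _ _) => apply cvr_mul
  | |- cvr _ (pscal _ _) => apply cvr_scal
  | |- cvr _ (single _ _ _) => apply cvr_single
  | |- cvr _ (pconst _) => apply cvr_single
  | |- cvr _ px => apply cvr_single
  | |- cvr _ py => apply cvr_single
  | |- cvr _ (dx _) => apply cvr_dx
  | |- cvr _ (dy _) => apply cvr_dy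
  | |- cvr _ ?a => is_var a; unfold a
  | |- _ => lra
  | |- _ => assumption
  end.

(** * Roots and reciprocals of units *)

Lemma eva_single_mul r k l v a x y : cvr r a -> Rabs x < r -> Rabs y < r ->
  ev (pmul (single k l v) a) x y = v * (x ^ k * y ^ l) * ev a x y.
Proof.
  intros Ha Hx Hy. rewrite (eva_mul r), ev_single; try easy. apply cvr_single.
Qed.

Lemma ord_single k l v d : (d <= k + l)%nat -> ord d (single k l v).
Proof.
  intros H n m Hn. unfold single. destruct (Nat.eq_dec n k), (Nat.eq_dec m l); easy || lia.
Qed.

Lemma ord_padd d a b : ord d a -> ord d b -> ord d (padd a b).
Proof. intros Ha Hb n m H. unfold padd. rewrite Ha, Hb by easy. ring. Qed.

Lemma ord_le d e a : (d <= e)%nat -> ord e a -> ord d a.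
Proof. intros H Ha n m Hn. apply Ha. lia. Qed.

Lemma ord1_iff a : a O O = 0 -> ord 1 a.
Proof. intros H [|] [|] Hn; easy || lia. Qed.

(** The branch of an n-th root at 1 is read off the inverse of the map germ
    [((1 + x) ^ n - 1) / n], whose linear part is the identity. *)
Lemma unit_root (n : nat) (N : fam) :
  INR n <> 0 -> ord 2 N -> (forall r, cvr r N) ->
  (forall u v, u + ev N u v = ((1 + u) ^ n - 1) / INR n) ->
  forall r V, 0 < r -> cvr r V -> V O O = 0 ->
  exists s U, 0 < s <= r /\ cvr s U /\ U O O = 0 /\
    forall x y, Rabs x < s -> Rabs y < s -> (1 + ev U x y) ^ n = 1 + ev V x y.
Proof.
  intros Hn Ho HN Hroot r V Hr HV HV0.
  destruct (inverse_function 1 N (single 0 0 0)) as (R1 & M & M' & HR1 & HM & HM' & HoM & _ & H & _);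
    [lra|apply HN|apply cvr_single|easy| |].
  { intros i j Hij. unfold single. destruct (Nat.eq_dec i 0), (Nat.eq_dec j 0); easy. }
  set (A := pscal (/ INR n) V). set (B := single 0 0 0).
  assert (HA : cvr r A) by now apply cvr_scal.
  assert (HoA : ord 1 A) by (apply ord1_iff; unfold A, pscal; rewrite HV0; ring).
  assert (HoB : ord 1 B) by (apply ord1_iff; easy).
  assert (HF : cvr R1 (padd px M)) by (apply cvr_add; [apply cvr_single|easy]).
  destruct (cvr_comp R1 r (padd px M) A B) as (s & Hs & Hc & Hev); try easy; [apply cvr_single|].
  exists s, (pcomp (padd px M) A B). split; [easy|]. split; [easy|].
  assert (Hkey : forall x y, Rabs x < s -> Rabs y < s ->
    ev (pcomp (padd px M) A B) x y = ev A x y + ev M (ev A x y) 0 /\ Rabs (ev A x y) < R1).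
  { intros x y Hx Hy. destruct (Hev x y Hx Hy) as (H1 & H2 & ->).
    unfold B in *. rewrite ev_single in *. rewrite Rmult_0_l in *.
    rewrite (eva_add R1), ev_px; try easy. apply cvr_single. }
  split.
  - assert (H0 : ord 1 (pcomp (padd px M) A B)); [|apply H0; lia].
    apply ord_comp; try easy. apply ord_padd; [now apply ord_single|].
    now apply ord_le with 2%nat; [lia|].
  - intros x y Hx Hy. destruct (Hkey x y Hx Hy) as [-> Ha].
    destruct (H (ev A x y) 0 Ha) as [H1 _]; [rewrite Rabs_R0; easy|].
    cbv zeta in H1. rewrite Hroot in H1.
    set (u := ev A x y + ev M (ev A x y) 0) in *.
    assert (H2 : (1 + u) ^ n - 1 = INR n * ev A x y) by (rewrite <- H1; field; easy).
    unfold A in H2. rewrite ev_scal in H2.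
    replace (INR n * (/ INR n * ev V x y)) with (ev V x y) in H2 by (field; easy). lra.
Qed.

(** [u (1 + v) = x, v = y] inverts to [u = x / (1 + y)], which at [(-V, V)] is
    [1 / (1 + V) - 1]. *)
Lemma unit_inverse r V : 0 < r -> cvr r V -> V O O = 0 ->
  exists s U, 0 < s <= r /\ cvr s U /\
    forall x y, Rabs x < s -> Rabs y < s -> (1 + ev V x y) * ev U x y = 1.
Proof.
  intros Hr HV HV0.
  destruct (inverse_function 1 (single 1 1 1) (single 0 0 0))
    as (R1 & M & M' & HR1 & HM & HM' & HoM & HoM' & H & _);
    [lra|apply cvr_single|apply cvr_single|now apply ord_single| |].
  { intros i j Hij. unfold single. destruct (Nat.eq_dec i 0), (Nat.eq_dec j 0); easy. }
  set (A := pscal (-1) V).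
  assert (HA : cvr r A) by now apply cvr_scal.
  assert (HoA : ord 1 A) by (apply ord1_iff; unfold A, pscal; rewrite HV0; ring).
  assert (HoV : ord 1 V) by now apply ord1_iff.
  assert (HF : cvr R1 (padd px M)) by (apply cvr_add; [apply cvr_single|easy]).
  destruct (cvr_comp R1 r (padd px M) A V) as (s & Hs & Hc & Hev); try easy.
  exists s, (padd (pconst 1) (pcomp (padd px M) A V)). split; [easy|].
  split; [apply cvr_add; [apply cvr_single|easy]|].
  intros x y Hx Hy. destruct (Hev x y Hx Hy) as (H1 & H2 & H3).
  rewrite (eva_add s), ev_const, H3 by cvr_tac.
  rewrite (eva_add R1), ev_px by cvr_tac.
  destruct (H (ev A x y) (ev V x y) H1 H2) as [Ha [Hb _]]. cbv zeta in Ha, Hb.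
  rewrite !ev_single in Ha, Hb.
  set (u := ev A x y + ev M (ev A x y) (ev V x y)) in *.
  set (v := ev V x y + ev M' (ev A x y) (ev V x y)) in *.
  assert (Hv : v = ev V x y) by lra. rewrite Hv in Ha.
  assert (HAV : ev A x y = - ev V x y) by (unfold A; rewrite ev_scal; ring).
  rewrite HAV in Ha. simpl in Ha. lra.
Qed.

Lemma sqrt_unit r V : 0 < r -> cvr r V -> V O O = 0 ->
  exists s U, 0 < s <= r /\ cvr s U /\ U O O = 0 /\
    forall x y, Rabs x < s -> Rabs y < s -> (1 + ev U x y) ^ 2 = 1 + ev V x y.
Proof.
  apply (unit_root 2 (single 2 0 (1 / 2))).
  - simpl; lra.
  - now apply ord_single.
  - intros; apply cvr_single.
  - intros u v. rewrite ev_single. simpl. field.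
Qed.

Lemma fifth_root_unit r V : 0 < r -> cvr r V -> V O O = 0 ->
  exists s U, 0 < s <= r /\ cvr s U /\ U O O = 0 /\
    forall x y, Rabs x < s -> Rabs y < s -> (1 + ev U x y) ^ 5 = 1 + ev V x y.
Proof.
  apply (unit_root 5 (padd (single 2 0 2) (padd (single 3 0 2)
    (padd (single 4 0 1) (single 5 0 (1 / 5)))))).
  - simpl; lra.
  - repeat apply ord_padd; apply ord_single; lia.
  - intros; repeat apply cvr_add; apply cvr_single.
  - intros u v. set (q := Rabs u + Rabs v + 1).
    assert (Hu : Rabs u < q) by (unfold q; generalize (Rabs_pos v); lra).
    assert (Hv : Rabs v < q) by (unfold q; generalize (Rabs_pos u); lra).
    rewrite !(eva_add q), !ev_single by cvr_tac.
    simpl. field.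
Qed.

Lemma real_fifth_root J : J <> 0 -> exists j, j <> 0 /\ j ^ 5 = J.
Proof.
  intros HJ.
  assert (Hp : forall t, 0 < t -> exists j, 0 < j /\ j ^ 5 = t).
  { intros t Ht. exists (Rpower t (/ 5)). split; [apply exp_pos|].
    rewrite <- Rpower_pow by apply exp_pos. rewrite Rpower_mult.
    replace (/ 5 * INR 5) with 1 by (simpl; field). now apply Rpower_1. }
  destruct (Rlt_le_dec 0 J) as [H|H].
  - destruct (Hp J H) as [j [Hj H5]]. exists j. split; [lra|easy].
  - destruct (Hp (- J)) as [j [Hj H5]]; [lra|]. exists (- j). split; [lra|].
    replace ((- j) ^ 5) with (- j ^ 5) by ring. lra.
Qed.

Lemma ev_small_near_0 r a e : 0 < r -> cvr r a -> a O O = 0 -> 0 < e ->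
  exists d, 0 < d < r /\ forall x y, Rabs x < d -> Rabs y < d -> Rabs (ev a x y) < e.
Proof.
  intros Hr Ha Ha0 He. destruct (cvr_ord 1 a r Hr Ha (ord1_iff a Ha0)) as (C & HC & H).
  set (d := Rmin (r / 2) (e / (2 * C))).
  assert (Hq : 0 < e / (2 * C)) by (apply Rdiv_lt_0_compat; lra).
  assert (Hd : 0 < d) by (apply Rmin_glb_lt; lra).
  assert (Hd1 : d <= r / 2) by apply Rmin_l.
  assert (Hd2 : C * d <= e / 2).
  { replace (e / 2) with (C * (e / (2 * C))) by (field; lra).
    apply Rmult_le_compat_l; [lra|apply Rmin_r]. }
  exists d. split; [lra|]. intros x y Hx Hy.
  assert (Rabs (ev a x y) <= C * d ^ 1) by (apply ev_bound with d d; try lra; apply H; lra).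
  rewrite pow_1 in H0. lra.
Qed.

(** * Recognizing the singularity A4 *)

(** Completing the square absorbs the middle term into the square of
    [sqrt a (z + x^3 b / 2 a)] and leaves [x^5] times a unit, whose fifth root exists. *)
Lemma square_plus_fifth_power r a b c : 0 < r -> cvr r a -> cvr r b -> cvr r c ->
  0 < a O O -> c O O <> 0 ->
  exists s N1 N2 j k, 0 < s <= r /\ cvr s N1 /\ cvr s N2 /\ ord 2 N1 /\ ord 2 N2 /\
    j <> 0 /\ k <> 0 /\
    forall x z, Rabs x < s -> Rabs z < s ->
      z ^ 2 * ev a x z + x ^ 3 * z * ev b x z + x ^ 5 * ev c x z =
      (k * (z + ev N2 x z)) ^ 2 + (j * (x + ev N1 x z)) ^ 5.
Proof.
  intros Hr Ha Hb Hc Ha0 Hc0. set (A := a O O) in *. set (J := c O O) in *.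
  assert (Hcst : forall s v, cvr s (pconst v)) by (intros; apply cvr_single).
  set (V := padd (pscal (/ A) a) (pconst (-1))).
  assert (HV : cvr r V) by (apply cvr_add; [now apply cvr_scal|easy]).
  assert (HV0 : V O O = 0).
  { unfold V, padd, pscal, pconst, single; simpl. fold A. field. lra. }
  destruct (unit_inverse r V Hr HV HV0) as (s1 & K & Hs1 & HK & HVK).
  assert (HV1 : cvr s1 V) by (apply cvr_shrink with r; lra || easy).
  destruct (sqrt_unit s1 V ltac:(lra) HV1 HV0) as (s2 & S & Hs2 & HS & HS0 & HS2).
  assert (Hb2 : cvr s2 b) by (apply cvr_shrink with r; lra || easy).
  assert (Hc2 : cvr s2 c) by (apply cvr_shrink with r; lra || easy).
  assert (HK2 : cvr s2 K) by (apply cvr_shrink with s1; lra || easy).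
  set (V' := padd (pscal (/ J) (padd c (pscal (- / (4 * A)) (pmul px (pmul (pmul b b) K)))))
    (pconst (-1))).
  assert (HV' : cvr s2 V').
  { cvr_tac. }
  assert (HV'0 : V' O O = 0).
  { unfold V', padd, pscal, pconst, px. rewrite pmul_single. unfold single; simpl.
    fold J. field. split; [lra|easy]. }
  destruct (fifth_root_unit s2 V' ltac:(lra) HV' HV'0) as (s & S' & Hs & HS' & HS'0 & HS'5).
  destruct (real_fifth_root J Hc0) as (j & Hj0 & Hj).
  assert (HKs : cvr s K) by (apply cvr_shrink with s2; lra || easy).
  assert (Hbs : cvr s b) by (apply cvr_shrink with s2; lra || easy).
  assert (Hcs : cvr s c) by (apply cvr_shrink with s2; lra || easy).
  assert (Has : cvr s a) by (apply cvr_shrink with r; lra || easy).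
  assert (HSs : cvr s S) by (apply cvr_shrink with s2; lra || easy).
  set (T := pmul (padd (pconst 1) S) (pmul b K)).
  assert (HT : cvr s T) by cvr_tac.
  exists s, (pmul px S'), (padd (pmul py S) (pmul (single 3 0 (/ (2 * A))) T)), j, (sqrt A).
  split; [lra|]. split; [apply cvr_mul; [apply cvr_single|easy]|].
  split; [apply cvr_add; apply cvr_mul; easy || apply cvr_single|].
  split; [apply (ord_mul 1 1); [now apply ord_single|now apply ord1_iff]|].
  split.
  { apply ord_padd.
    - apply (ord_mul 1 1); [now apply ord_single|now apply ord1_iff].
    - apply (ord_mul 2 0); [apply ord_single; lia|]. intros ? ? ?; lia. }
  split; [easy|]. split; [apply Rgt_not_eq, sqrt_lt_R0; easy|].
  intros x z Hx Hz.
  assert (Hpx : cvr s px) by apply cvr_single. assert (Hpy : cvr s py) by apply cvr_single.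
  rewrite (eva_mul s px S'), ev_px by easy.
  rewrite (eva_add s), (eva_mul s py S), ev_py, (eva_single_mul s)
    by cvr_tac.
  unfold T. rewrite (eva_mul s), (eva_add s), ev_const, (eva_mul s b K)
    by cvr_tac.
  assert (E1 := HVK x z ltac:(lra) ltac:(lra)).
  assert (E2 := HS2 x z ltac:(lra) ltac:(lra)).
  assert (E3 := HS'5 x z ltac:(lra) ltac:(lra)).
  assert (EV : 1 + ev V x z = ev a x z / A).
  { unfold V. rewrite (eva_add s), ev_scal, ev_const by cvr_tac.
    field. lra. }
  assert (EV' : 1 + ev V' x z = (ev c x z - x * (ev b x z * ev b x z * ev K x z) / (4 * A)) / J).
  { unfold V'. rewrite (eva_add s), ev_const, ev_scal, (eva_add s), ev_scal, (eva_mul s),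
      ev_px, (eva_mul s), (eva_mul s)
      by cvr_tac.
    field. split; [lra|easy]. }
  rewrite EV in E1, E2. rewrite EV' in E3.
  set (va := ev a x z) in *. set (vb := ev b x z) in *. set (vc := ev c x z) in *.
  set (vK := ev K x z) in *. set (vS := ev S x z) in *. set (vS' := ev S' x z) in *.
  replace ((j * (x + x * vS')) ^ 5) with (j ^ 5 * (x ^ 5 * (1 + vS') ^ 5)) by ring.
  rewrite E3, Hj.
  replace ((sqrt A * (z + (z * vS + / (2 * A) * (x ^ 3 * z ^ 0) * ((1 + vS) * (vb * vK))))) ^ 2)
    with (sqrt A ^ 2 * ((1 + vS) ^ 2 * (z + x ^ 3 * vb * vK / (2 * A)) ^ 2)) by (field; lra).
  rewrite E2, pow2_sqrt by lra.
  assert (E4 : va * vK = A).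
  { apply Rmult_eq_reg_r with (/ A); [|apply Rinv_neq_0_compat; lra].
    rewrite Rinv_r by lra. rewrite <- E1. field. lra. }
  replace (A * (va / A * (z + x ^ 3 * vb * vK / (2 * A)) ^ 2)) with
    (z ^ 2 * va + x ^ 3 * z * vb * (va * vK) / A + x ^ 6 * vb ^ 2 * vK * (va * vK) / (4 * A ^ 2))
    by (field; lra).
  rewrite E4. field. split; [lra|easy].
Qed.

Lemma cvr_shift r k l a : cvr r a -> cvr r (fun i j => a (k + i)%nat (l + j)%nat).
Proof.
  intros Ha. induction l as [|l IH].
  - induction k as [|k IH]; [easy|]. apply cvr_divx in IH. unfold divx in IH.
    replace (fun i j : nat => a (S k + i)%nat (0 + j)%nat)
      with (fun i j : nat => a (k + S i)%nat (0 + j)%nat); [easy|].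
    apply fam_ext; intros. f_equal. lia.
  - apply cvr_divy in IH. unfold divy, divx, transpose in IH.
    replace (fun i j : nat => a (k + i)%nat (S l + j)%nat)
      with (fun i j : nat => a (k + i)%nat (l + S j)%nat); [easy|].
    apply fam_ext; intros. f_equal. lia.
Qed.

Lemma cvr_dominated r a b : (forall i j, Rabs (a i j) <= Rabs (b i j)) -> cvr r b -> cvr r a.
Proof.
  intros H Hb r' Hr'. destruct (Hb r' Hr') as [M HM]. exists M.
  eapply abs_bound_le; [|apply HM]. intros i j. rewrite !Rabs_mult.
  apply Rmult_le_compat_r; [apply Rabs_pos|easy].
Qed.

Definition col0 (a : fam) : fam := fun i j => if Nat.eq_dec j 0 then a i j else 0.

Lemma cvr_col0 r a : cvr r a -> cvr r (col0 a).
Proof.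
  apply cvr_dominated. intros i j. unfold col0. destruct (Nat.eq_dec j 0); [lra|].
  rewrite Rabs_R0. apply Rabs_pos.
Qed.

Lemma shear r k a : 0 < r -> cvr r a ->
  exists s b, 0 < s <= r /\ cvr s b /\ b O O = a O O /\
    forall x z, Rabs x < s -> Rabs z < s ->
      Rabs (z + k * x ^ 2) < r /\ ev b x z = ev a x (z + k * x ^ 2).
Proof.
  intros Hr Ha. set (B := padd py (single 2 0 k)).
  assert (HB : cvr r B) by (apply cvr_add; apply cvr_single).
  destruct (cvr_comp r r a px B) as (s & Hs & Hc & H); try easy.
  - apply cvr_single.
  - now apply ord_single.
  - apply ord_padd; apply ord_single; lia.
  - assert (H' : forall x z, Rabs x < s -> Rabs z < s ->
      Rabs (z + k * x ^ 2) < r /\ ev (pcomp a px B) x z = ev a x (z + k * x ^ 2)).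
    { intros x z Hx Hz. destruct (H x z Hx Hz) as (_ & H2 & H3).
      rewrite H3, ev_px. unfold B in *.
      rewrite (eva_add r), ev_py, ev_single in H2 |- * by cvr_tac.
      replace (k * (x ^ 2 * z ^ 0)) with (k * x ^ 2) in * by (simpl; ring). easy. }
    exists s, (pcomp a px B). split; [easy|]. split; [easy|]. split; [|easy].
    destruct (H' 0 0) as [_ H0]; try (rewrite Rabs_R0; lra).
    rewrite ev_0 in H0. rewrite H0. rewrite <- ev_0. f_equal. ring.
Qed.

(** In the sheared coordinate [z = y + c x^2] the part of weight four, for [x] and [y] of weights
    one and two, is [A z^2]. Everything else is divisible by [x z^2], [z^3], [x^3 z] or [x^5],
    and the coefficient of [x^5] is the value of the part of weight five at [z = 0]. *)
Theorem A4_criterion r g G c : rep r g G ->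
  G 0%nat 0%nat = 0 -> G 1%nat 0%nat = 0 -> G 2%nat 0%nat = 0 -> G 3%nat 0%nat = 0 ->
  G 0%nat 1%nat = 0 -> G 1%nat 1%nat = 0 ->
  0 < G 0%nat 2%nat ->
  G 2%nat 1%nat = 2 * c * G 0%nat 2%nat -> G 4%nat 0%nat = c ^ 2 * G 0%nat 2%nat ->
  G 1%nat 2%nat * c ^ 2 - G 3%nat 1%nat * c + G 5%nat 0%nat <> 0 ->
  type_A4 g /\
  forall e, 0 < e -> exists u v, Rabs u < e /\ Rabs v < e /\ g u v < 0.
Proof.
  intros Hg G00 G10 G20 G30 G01 G11 G02 G21 G40 HJ.
  destruct Hg as (Hr & HG & Hgev).
  assert (Hrep : rep r g G) by easy.
  set (A := G 0%nat 2%nat) in *. set (D := G 1%nat 2%nat) in *.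
  set (E := G 3%nat 1%nat) in *. set (F := G 5%nat 0%nat) in *.
  set (R1 := fun i j : nat => G (0 + i)%nat (3 + j)%nat).
  set (R2 := col0 (fun i j : nat => G (2 + i)%nat (2 + j)%nat)).
  set (R3 := col0 (fun i j : nat => G (4 + i)%nat (1 + j)%nat)).
  set (R4 := col0 (fun i j : nat => G (6 + i)%nat (0 + j)%nat)).
  assert (HR1 : cvr r R1) by (apply (cvr_shift r 0 3); easy).
  assert (HR2 : cvr r R2) by (apply cvr_col0, (cvr_shift r 2 2); easy).
  assert (HR3 : cvr r R3) by (apply cvr_col0, (cvr_shift r 4 1); easy).
  assert (HR4 : cvr r R4) by (apply cvr_col0, (cvr_shift r 6 0); easy).
  assert (HGdec : G = padd (single 0 2 A) (padd (single 2 1 (2 * c * A)) (padd (single 4 0 (c ^ 2 * A))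
    (padd (single 1 2 D) (padd (single 3 1 E) (padd (single 5 0 F)
    (padd (pmul (single 0 3 1) R1) (padd (pmul (single 2 2 1) R2)
    (padd (pmul (single 4 1 1) R3) (pmul (single 6 0 1) R4)))))))))).
  { apply fam_ext; intros i j. unfold padd. rewrite !pmul_single. unfold R1, R2, R3, R4, col0.
    destruct j as [|[|[|j]]].
    - do 6 (destruct i as [|i]; [unfold single; simpl; fold A D E F; lra|]).
      unfold single; simpl. rewrite Nat.sub_0_r. ring.
    - do 4 (destruct i as [|i]; [unfold single; simpl; fold A D E F; lra|]).
      unfold single; simpl. rewrite ?Nat.sub_0_r.
      destruct i as [|[|i]]; simpl; ring.
    - do 2 (destruct i as [|i]; [unfold single; simpl; fold A D E F; lra|]).
      unfold single; simpl. rewrite ?Nat.sub_0_r.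
      destruct i as [|[|[|[|i]]]]; simpl; ring.
    - unfold single; simpl. rewrite ?Nat.sub_0_r.
      destruct i as [|[|[|[|[|[|i]]]]]]; simpl; rewrite ?Nat.sub_0_r; ring. }
  destruct (shear r (- c) R1 Hr HR1) as (s1 & P1 & Hs1 & HP1 & _ & E1).
  destruct (shear r (- c) R2 Hr HR2) as (s2 & P2 & Hs2 & HP2 & _ & E2).
  destruct (shear r (- c) R3 Hr HR3) as (s3 & P3 & Hs3 & HP3 & _ & E3).
  destruct (shear r (- c) R4 Hr HR4) as (s4 & P4 & Hs4 & HP4 & _ & E4).
  set (t := Rmin (Rmin s1 s2) (Rmin s3 s4)).
  assert (Ht : 0 < t) by (repeat apply Rmin_glb_lt; lra).
  assert (Ht1 : t <= s1 /\ t <= s2 /\ t <= s3 /\ t <= s4).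
  { unfold t. generalize (Rmin_l (Rmin s1 s2) (Rmin s3 s4)) (Rmin_r (Rmin s1 s2) (Rmin s3 s4))
      (Rmin_l s1 s2) (Rmin_r s1 s2) (Rmin_l s3 s4) (Rmin_r s3 s4). lra. }
  assert (HP1t : cvr t P1) by (apply cvr_shrink with s1; lra || easy).
  assert (HP2t : cvr t P2) by (apply cvr_shrink with s2; lra || easy).
  assert (HP3t : cvr t P3) by (apply cvr_shrink with s3; lra || easy).
  assert (HP4t : cvr t P4) by (apply cvr_shrink with s4; lra || easy).
  set (al := padd (pconst A) (padd (single 1 0 D)
    (padd (pmul (padd py (single 2 0 (-3 * c))) P1) (pmul (single 2 0 1) P2)))).
  set (be := padd (pconst (-2 * c * D + E)) (padd (pmul (single 1 0 (3 * c ^ 2)) P1)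
    (padd (pmul (single 1 0 (-2 * c)) P2) (pmul (single 1 0 1) P3)))).
  set (ga := padd (pconst (D * c ^ 2 - E * c + F)) (padd (pmul (single 1 0 (- c ^ 3)) P1)
    (padd (pmul (single 1 0 (c ^ 2)) P2) (padd (pmul (single 1 0 (- c)) P3)
    (pmul (single 1 0 1) P4))))).
  assert (Hal : cvr t al) by cvr_tac.
  assert (Hbe : cvr t be) by cvr_tac.
  assert (Hga : cvr t ga) by cvr_tac.
  assert (Hal0 : al O O = A).
  { unfold al, padd, pconst, pmul, py, single; simpl. ring. }
  assert (Hga0 : ga O O = D * c ^ 2 - E * c + F).
  { unfold ga, padd, pconst, pmul, py, single; simpl. ring. }
  destruct (square_plus_fifth_power t al be ga Ht Hal Hbe Hga)
    as (s & N1 & N2 & j & k & Hs & HN1 & HN2 & Ho1 & Ho2 & Hj & Hk & Hsq);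
    [lra|lra|].
  (* the germ in the sheared coordinates (x, z) with y = z - c x^2 *)
  assert (Hnf : forall x z, Rabs x < s -> Rabs z < s ->
    g x (z + - c * x ^ 2) = (k * (z + ev N2 x z)) ^ 2 + (j * (x + ev N1 x z)) ^ 5).
  { intros x z Hx Hz. rewrite <- Hsq by easy.
    destruct (E1 x z) as [Hb F1]; try lra. destruct (E2 x z) as [_ F2]; try lra.
    destruct (E3 x z) as [_ F3]; try lra. destruct (E4 x z) as [_ F4]; try lra.
    rewrite Hgev by lra. rewrite HGdec.
    rewrite !(eva_add r), !ev_single, !(eva_single_mul r), <- F1, <- F2, <- F3, <- F4
      by cvr_tac.
    unfold al, be, ga.
    rewrite !(eva_add t), !ev_const, !(eva_single_mul t), (eva_mul t), (eva_add t), ev_py, !ev_single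
      by cvr_tac.
    simpl. ring. }
  destruct (inverse_function s N1 N2) as (q & M1 & M2 & Hq & HM1 & HM2 & HoM1 & HoM2 & HR & HL);
    try easy; try lra.
  set (u := fun x y => x + ev M1 x y). set (v := fun x y => y + ev M2 x y).
  set (f1 := fun x y => u (x / j) (y / k)).
  set (f2 := fun x y => v (x / j) (y / k) + - c * (f1 x y * f1 x y)).
  set (g1 := fun x y => j * (x + ev N1 x (y + c * (x * x)))).
  set (g2 := fun x y => k * ((y + c * (x * x)) + ev N2 x (y + c * (x * x)))).
  assert (Hq0 : 0 < q) by lra. assert (Hs0 : 0 < s) by lra.
  assert (Hf : exists d F1 F2, rep d f1 F1 /\ rep d f2 F2).
  { assert (Hu : rep q u (padd px M1)) by (apply rep_add; [now apply rep_px|now apply rep_ev]).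
    assert (Hv : rep q v (padd py M2)) by (apply rep_add; [now apply rep_py|now apply rep_ev]).
    assert (HX : rep 1 (fun x y => x / j) (pscal (/ j) px)).
    { apply rep_ext with (fun x y => / j * x); [intros; apply Rmult_comm|].
      apply (rep_scal 1 (/ j) (fun x _ => x)), rep_px; lra. }
    assert (HY : rep 1 (fun x y => y / k) (pscal (/ k) py)).
    { apply rep_ext with (fun x y => / k * y); [intros; apply Rmult_comm|].
      apply (rep_scal 1 (/ k) (fun _ y => y)), rep_py; lra. }
    assert (HX0 : pscal (/ j) px O O = 0) by (unfold pscal, px, single; simpl; ring).
    assert (HY0 : pscal (/ k) py O O = 0) by (unfold pscal, py, single; simpl; ring).
    destruct (rep_comp q 1 u _ _ _ _ _ Hu HX HY HX0 HY0) as (d1 & Hd1 & Hr1).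
    destruct (rep_comp q 1 v _ _ _ _ _ Hv HX HY HX0 HY0) as (d2 & Hd2 & Hr2).
    assert (Hm : 0 < Rmin d1 d2) by (apply Rmin_glb_lt; lra).
    apply (rep_shrink _ (Rmin d1 d2)) in Hr1; [|split; [easy|apply Rmin_l]].
    apply (rep_shrink _ (Rmin d1 d2)) in Hr2; [|split; [easy|apply Rmin_r]].
    do 3 eexists. split; [apply Hr1|].
    apply rep_add; [apply Hr2|]. apply rep_scal, rep_mul; apply Hr1. }
  assert (Hg : exists d G1 G2, rep d g1 G1 /\ rep d g2 G2).
  { assert (HX : rep s (fun x y => x) px) by now apply rep_px.
    assert (HY : rep s (fun x y => y + c * (x * x)) (padd py (pscal c (pmul px px)))).
    { apply rep_add; [now apply rep_py|]. apply (rep_scal s c (fun x _ => x * x)).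
      apply (rep_mul s (fun x _ => x) (fun x _ => x)); now apply rep_px. }
    assert (HX0 : px O O = 0) by easy.
    assert (HY0 : padd py (pscal c (pmul px px)) O O = 0)
      by (unfold padd, pscal, pmul, px, py, single; simpl; ring).
    destruct (rep_comp s s _ _ _ _ _ _ (rep_ev s N1 Hs0 HN1) HX HY HX0 HY0) as (d1 & Hd1 & Hr1).
    destruct (rep_comp s s _ _ _ _ _ _ (rep_ev s N2 Hs0 HN2) HX HY HX0 HY0) as (d2 & Hd2 & Hr2).
    assert (Hm : 0 < Rmin d1 d2) by (apply Rmin_glb_lt; lra).
    assert (Hm1 := Rmin_l d1 d2). assert (Hm2 := Rmin_r d1 d2).
    apply (rep_shrink _ (Rmin d1 d2)) in Hr1, Hr2; try lra.
    apply (rep_shrink _ (Rmin d1 d2)) in HX, HY; try lra.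
    do 3 eexists. split.
    - apply (rep_scal _ j (fun x y => x + _)). apply (rep_add _ (fun x _ => x)); [apply HX|apply Hr1].
    - apply (rep_scal _ k (fun x y => _ + _)). apply rep_add; [apply HY|apply Hr2]. }
  destruct Hf as (df & F1 & F2 & Hf1 & Hf2). destruct Hg as (dg & G1 & G2 & Hg1 & Hg2).
  assert (HM10 : ev M1 0 0 = 0) by (rewrite ev_0; apply HoM1; lia).
  assert (HM20 : ev M2 0 0 = 0) by (rewrite ev_0; apply HoM2; lia).
  assert (HN10 : ev N1 0 0 = 0) by (rewrite ev_0; apply Ho1; lia).
  assert (HN20 : ev N2 0 0 = 0) by (rewrite ev_0; apply Ho2; lia).
  assert (Hf10 : f1 0 0 = 0).
  { unfold f1, u. replace (0 / j) with 0 by (field; easy).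
    replace (0 / k) with 0 by (field; easy). lra. }
  assert (Hf20 : f2 0 0 = 0).
  { unfold f2, v. rewrite Hf10. replace (0 / j) with 0 by (field; easy).
    replace (0 / k) with 0 by (field; easy). rewrite HM20. ring. }
  assert (Hg10 : g1 0 0 = 0).
  { unfold g1. replace (0 + c * (0 * 0)) with 0 by ring. rewrite HN10. ring. }
  assert (Hg20 : g2 0 0 = 0).
  { unfold g2. replace (0 + c * (0 * 0)) with 0 by ring. rewrite HN20. ring. }
  (* the scaled point (x / j, y / k) stays in the domain of (u, v) *)
  assert (Hdom : exists d, 0 < d /\ forall x y, Rabs x < d -> Rabs y < d ->
    Rabs (x / j) < q /\ Rabs (y / k) < q /\ Rabs x < q /\ Rabs (y + c * (x * x)) < q).
  { assert (Hj1 : 0 < Rabs j) by now apply Rabs_pos_lt.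
    assert (Hk1 : 0 < Rabs k) by now apply Rabs_pos_lt.
    assert (Hc1 := Rabs_pos c).
    set (d := Rmin (Rmin (q * Rabs j) (q * Rabs k)) (Rmin 1 (q / (1 + Rabs c)))).
    assert (Hqc : 0 < q / (1 + Rabs c)) by (apply Rdiv_lt_0_compat; lra).
    assert (Hd1 : d <= q * Rabs j) by (eapply Rle_trans; [apply Rmin_l|apply Rmin_l]).
    assert (Hd2 : d <= q * Rabs k) by (eapply Rle_trans; [apply Rmin_l|apply Rmin_r]).
    assert (Hd3 : d <= 1) by (eapply Rle_trans; [apply Rmin_r|apply Rmin_l]).
    assert (Hd4 : d <= q / (1 + Rabs c)) by (eapply Rle_trans; [apply Rmin_r|apply Rmin_r]).
    assert (Hd5 : d * (1 + Rabs c) <= q).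
    { replace q with (q / (1 + Rabs c) * (1 + Rabs c)) by (field; lra).
      apply Rmult_le_compat_r; lra. }
    exists d. split; [repeat apply Rmin_glb_lt; lra || now apply Rmult_lt_0_compat|].
    intros x y Hx Hy. rewrite !Rabs_div by easy.
    assert (Hx0 := Rabs_pos x).
    repeat split.
    - apply Rmult_lt_reg_r with (Rabs j); [easy|].
      replace (Rabs x / Rabs j * Rabs j) with (Rabs x) by (field; lra). lra.
    - apply Rmult_lt_reg_r with (Rabs k); [easy|].
      replace (Rabs y / Rabs k * Rabs k) with (Rabs y) by (field; lra). lra.
    - nra.
    - eapply Rle_lt_trans; [apply Rabs_triang|]. rewrite !Rabs_mult.
      assert (Rabs x * Rabs x <= d) by nra. nra. }
  destruct Hdom as (d & Hd & Hdom).
  assert (Hjc : forall w, j * w / j = w) by (intros; field; easy).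
  assert (Hkc : forall w, k * w / k = w) by (intros; field; easy).
  assert (Hfin : forall x y, Rabs x < d -> Rabs y < d -> g (f1 x y) (f2 x y) = y ^ 2 + x ^ 5).
  { intros x y Hx Hy. destruct (Hdom x y Hx Hy) as (H1 & H2 & _).
    destruct (HR (x / j) (y / k) H1 H2) as (H3 & H4 & H5 & H6).
    fold (u (x / j) (y / k)) in H3, H4, H5, H6. fold (v (x / j) (y / k)) in H3, H4, H5, H6.
    unfold f2. replace (- c * (f1 x y * f1 x y)) with (- c * f1 x y ^ 2) by ring.
    rewrite Hnf by easy. unfold f1. rewrite H3, H4. field. easy. }
  split.
  - split.
    { split; rewrite (rep_coeff r g G _ _ Hrep); rewrite ?G10, ?G01; ring. }
    exists f1, f2. split.
    + split; [repeat split; [now apply rep_analytic in Hf1|now apply rep_analytic in Hf2|easy|easy]|].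
      exists g1, g2. split.
      { repeat split; [now apply rep_analytic in Hg1|now apply rep_analytic in Hg2|easy|easy]. }
      split; exists (mkposreal d Hd); simpl; intros x y; rewrite !Rminus_0_r; intros Hx Hy;
        destruct (Hdom x y Hx Hy) as (H1 & H2 & H3 & H4).
      * destruct (HL x (y + c * (x * x)) H3 H4) as [H5 H6].
        assert (Ha : f1 (g1 x y) (g2 x y) = x).
        { unfold f1, u, g1, g2. rewrite Hjc, Hkc. easy. }
        split; [easy|]. unfold f2. rewrite Ha. unfold v, g1, g2.
        rewrite Hjc, Hkc.
        rewrite H6. ring.
      * destruct (HR (x / j) (y / k) H1 H2) as (H5 & H6 & _).
        fold (u (x / j) (y / k)) in H5, H6. fold (v (x / j) (y / k)) in H5, H6.
        unfold g1, g2, f2.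
        replace (v (x / j) (y / k) + - c * (f1 x y * f1 x y) + c * (f1 x y * f1 x y))
          with (v (x / j) (y / k)) by ring.
        unfold f1. rewrite H5, H6. split; field; easy.
    + exists (mkposreal d Hd); simpl; intros x y; rewrite !Rminus_0_r. apply Hfin.
  - intros e He.
    assert (HF10 : F1 O O = 0).
    { rewrite <- ev_0. destruct Hf1 as (H1 & _ & H2).
      rewrite <- H2 by (rewrite Rabs_R0; easy). easy. }
    assert (HF20 : F2 O O = 0).
    { rewrite <- ev_0. destruct Hf2 as (H1 & _ & H2).
      rewrite <- H2 by (rewrite Rabs_R0; easy). easy. }
    destruct Hf1 as (Hdf & HcF1 & Hf1). destruct Hf2 as (_ & HcF2 & Hf2).
    destruct (ev_small_near_0 df F1 e Hdf HcF1 HF10 He) as (d1 & Hd1 & Hsm1).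
    destruct (ev_small_near_0 df F2 e Hdf HcF2 HF20 He) as (d2 & Hd2 & Hsm2).
    set (w := Rmin d (Rmin d1 d2) / 2).
    assert (Ht' : 0 < Rmin d (Rmin d1 d2)) by (repeat apply Rmin_glb_lt; lra).
    assert (T1 := Rmin_l d (Rmin d1 d2)). assert (T2 := Rmin_r d (Rmin d1 d2)).
    assert (T3 := Rmin_l d1 d2). assert (T4 := Rmin_r d1 d2).
    assert (Hat : Rabs (- w) = w) by (rewrite Rabs_Ropp, Rabs_pos_eq; unfold w; lra).
    exists (f1 (- w) 0), (f2 (- w) 0). split; [|split].
    + rewrite Hf1; try (rewrite ?Hat, ?Rabs_R0; unfold w; lra).
      apply Hsm1; rewrite ?Hat, ?Rabs_R0; unfold w; lra.
    + rewrite Hf2; try (rewrite ?Hat, ?Rabs_R0; unfold w; lra).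
      apply Hsm2; rewrite ?Hat, ?Rabs_R0; unfold w; lra.
    + rewrite Hfin; try (rewrite ?Hat, ?Rabs_R0; unfold w; lra).
      assert (0 < w ^ 5) by (apply pow_lt; unfold w; lra).
      replace (0 ^ 2 + (- w) ^ 5) with (- w ^ 5) by ring. lra.
Qed.

(** * The Taylor expansions of W and of the discriminant *)

Definition psub (a b : fam) : fam := padd a (pscal (-1) b).
Definition dxy (i j : nat) (a : fam) : fam := Nat.iter i dx (Nat.iter j dy a).

Definition det3 (a1 a2 a3 b1 b2 b3 c1 c2 c3 : R) : R :=
  a1 * (b2 * c3 - b3 * c2) - a2 * (b1 * c3 - b3 * c1) + a3 * (b1 * c2 - b2 * c1).

Definition Wser (a b : fam) : fam :=
  padd (psub
    (pmul (psub (dxy 0 1 b) (dxy 1 0 a))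
      (psub (pmul (dxy 2 0 b) (dxy 0 2 a)) (pmul (dxy 2 0 a) (dxy 0 2 b))))
    (pmul (pscal 2 (dxy 0 1 a))
      (psub (pmul (dxy 2 0 a) (dxy 1 1 b)) (pmul (dxy 2 0 b) (dxy 1 1 a)))))
    (pmul (pscal 2 (dxy 1 0 b))
      (psub (pmul (dxy 1 1 a) (dxy 0 2 b)) (pmul (dxy 0 2 a) (dxy 1 1 b)))).

Definition dser (a b : fam) : fam :=
  padd (pmul (psub (dxy 1 0 a) (dxy 0 1 b)) (psub (dxy 1 0 a) (dxy 0 1 b)))
    (pmul (pscal 4 (dxy 0 1 a)) (dxy 1 0 b)).

Lemma rep_sub r f g a b : rep r f a -> rep r g b -> rep r (fun x y => f x y - g x y) (psub a b).
Proof.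
  intros Hf Hg. apply rep_ext with (fun x y => f x y + -1 * g x y); [intros; ring|].
  apply rep_add; [easy|]. now apply rep_scal.
Qed.

Lemma rep_W r xi a b : rep r (xi1 xi) a -> rep r (xi2 xi) b -> rep r (W xi) (Wser a b).
Proof.
  intros Ha Hb. unfold W, Wser.
  assert (H1 : forall i j, rep r (partial_derive i j (xi1 xi)) (dxy i j a))
    by (intros; now apply rep_partial).
  assert (H2 : forall i j, rep r (partial_derive i j (xi2 xi)) (dxy i j b))
    by (intros; now apply rep_partial).
  apply (rep_add r (fun x y => _ - _)); [apply (rep_sub r (fun x y => _ * _))|].
  - apply (rep_mul r (fun x y => _ - _)); [now apply rep_sub|].
    apply (rep_sub r (fun x y => _ * _)); now apply rep_mul.
  - apply (rep_mul r (fun x y => _ * _)); [now apply rep_scal|].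
    apply (rep_sub r (fun x y => _ * _)); now apply rep_mul.
  - apply (rep_mul r (fun x y => _ * _)); [now apply rep_scal|].
    apply (rep_sub r (fun x y => _ * _)); now apply rep_mul.
Qed.

Lemma rep_discriminant r xi a b :
  rep r (xi1 xi) a -> rep r (xi2 xi) b -> rep r (discriminant xi) (dser a b).
Proof.
  intros Ha Hb. unfold discriminant, dser.
  assert (H1 : forall i j, rep r (partial_derive i j (xi1 xi)) (dxy i j a))
    by (intros; now apply rep_partial).
  assert (H2 : forall i j, rep r (partial_derive i j (xi2 xi)) (dxy i j b))
    by (intros; now apply rep_partial).
  apply (rep_ext r (fun x y =>
    (partial_derive 1 0 (xi1 xi) x y - partial_derive 0 1 (xi2 xi) x y)
    * (partial_derive 1 0 (xi1 xi) x y - partial_derive 0 1 (xi2 xi) x y)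
    + 4 * partial_derive 0 1 (xi1 xi) x y * partial_derive 1 0 (xi2 xi) x y));
    [intros; simpl; ring|].
  apply (rep_add r (fun x y => _ * _)).
  - apply (rep_mul r (fun x y => _ - _)); now apply rep_sub.
  - apply (rep_mul r (fun x y => _ * _)); [now apply rep_scal|easy].
Qed.

(** For [m = 4] the sum [p11 + q02 = - 3 p11] is nonzero, whence [q20 = 0]; [P] is [p11]. *)
Definition normal_2jet (P : R) (a b : fam) : Prop :=
  P <> 0 /\ a O O = 0 /\ b O O = 0 /\ b 0%nat 1%nat = a 1%nat 0%nat /\
  a 0%nat 1%nat = 0 /\ b 1%nat 0%nat = 0 /\
  a 2%nat 0%nat = 0 /\ a 0%nat 2%nat = 0 /\ b 1%nat 1%nat = 0 /\ b 2%nat 0%nat = 0 /\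
  a 1%nat 1%nat = P /\ b 0%nat 2%nat = -2 * P.

Ltac coef := unfold Wser, dser, dxy, psub, padd, pscal, pmul, dx, dy; simpl.

(** These are the relations that make the weight-four part of the discriminant the square
    of [5 (P y + a30 x^2)]. *)
Lemma W_relations P a b : normal_2jet P a b ->
  Wser a b 2%nat 0%nat = 0 -> Wser a b 1%nat 1%nat = 0 -> Wser a b 3%nat 0%nat = 0 ->
  b 3%nat 0%nat = 0 /\ b 2%nat 1%nat = - 10 * a 3%nat 0%nat /\
  b 4%nat 0%nat * P = - 9 * a 3%nat 0%nat ^ 2.
Proof.
  intros (HP & a00 & b00 & b01 & a01 & b10 & a20 & a02 & b11 & b20 & a11 & b02).
  coef. rewrite ?a00, ?b00, ?b01, ?a01, ?b10, ?a20, ?a02, ?b11, ?b20, ?a11, ?b02.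
  intros H20 H11 H30. ring_simplify in H20. ring_simplify in H11. ring_simplify in H30.
  assert (HP2 : P ^ 2 <> 0) by now apply pow_nonzero.
  assert (E1 : b 3%nat 0%nat = 0) by (apply Rmult_eq_reg_r with (P ^ 2); [lra|easy]).
  rewrite E1 in *. split; [easy|].
  split; [apply Rmult_eq_reg_r with (P ^ 2); [lra|easy]|].
  apply Rmult_eq_reg_r with P; [|easy]. nra.
Qed.

(** [P ^ 2] times the value of the weight-five part of the discriminant on the parabola
    where its weight-four part vanishes. *)
Definition A4_obstruction (a b : fam) : R :=
  a 3%nat 0%nat ^ 2 * dser a b 1%nat 2%nat
  - a 3%nat 0%nat * a 1%nat 1%nat * dser a b 3%nat 1%nat
  + a 1%nat 1%nat ^ 2 * dser a b 5%nat 0%nat.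

Lemma discriminant_A4 P r xi a b :
  rep r (xi1 xi) a -> rep r (xi2 xi) b -> normal_2jet P a b -> Wser a b = pzero ->
  A4_obstruction a b <> 0 ->
  type_A4 (discriminant xi) /\
  forall e, 0 < e -> exists u v, Rabs u < e /\ Rabs v < e /\ discriminant xi u v < 0.
Proof.
  intros Ha Hb Hn HW HJ.
  destruct (W_relations P a b Hn) as (b30 & b21 & b40); try (now rewrite HW).
  destruct Hn as (HP & a00 & b00 & b01 & a01 & b10 & a20 & a02 & b11 & b20 & a11 & b02).
  assert (HG02 : dser a b 0%nat 2%nat = 25 * P ^ 2).
  { coef. rewrite ?a00, ?b00, ?b01, ?a01, ?b10, ?a20, ?a02, ?b11, ?b20, ?a11, ?b02. ring. }
  assert (0 < P ^ 2) by (apply pow2_gt_0; easy).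
  apply (A4_criterion r (discriminant xi) (dser a b) (a 3%nat 0%nat / P));
    [now apply rep_discriminant| | | | | | |lra| | |];
  try (coef; rewrite ?a00, ?b00, ?b01, ?a01, ?b10, ?a20, ?a02, ?b11, ?b20, ?a11, ?b02, ?b30, ?b21;
    ring).
  - rewrite HG02. coef.
    rewrite ?a00, ?b00, ?b01, ?a01, ?b10, ?a20, ?a02, ?b11, ?b20, ?a11, ?b02, ?b30, ?b21.
    field. easy.
  - rewrite HG02. coef.
    rewrite ?a00, ?b00, ?b01, ?a01, ?b10, ?a20, ?a02, ?b11, ?b20, ?a11, ?b02, ?b30, ?b21.
    replace (b 4%nat 0%nat) with (- 9 * a 3%nat 0%nat ^ 2 / P) by (rewrite <- b40; field; easy).
    field. easy.
  - intros H0. apply HJ. unfold A4_obstruction. rewrite a11.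
    replace (_ - _ + _) with (P ^ 2 * (dser a b 1%nat 2%nat * (a 3%nat 0%nat / P) ^ 2
      - dser a b 3%nat 1%nat * (a 3%nat 0%nat / P) + dser a b 5%nat 0%nat)) by (field; easy).
    rewrite H0. ring.
Qed.

(** The coefficient [b50] enters the obstruction affinely and with a nonzero factor. *)
Lemma A4_obstruction_perturb P a b a' b' e : normal_2jet P a b ->
  (forall i j, (i + j <= 5)%nat -> a' i j = a i j) ->
  (forall i j, (i + j <= 5)%nat -> b' i j = b i j + (if Nat.eq_dec i 5 then e else 0)) ->
  A4_obstruction a' b' = A4_obstruction a b + 20 * P ^ 3 * e.
Proof.
  intros (HP & a00 & b00 & b01 & a01 & b10 & a20 & a02 & b11 & b20 & a11 & b02) Ha Hb.
  unfold A4_obstruction. coef.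
  repeat match goal with
  | |- context [a' ?i ?j] => rewrite (Ha i j) by lia
  | |- context [b' ?i ?j] => rewrite (Hb i j) by lia
  end. simpl.
  rewrite ?a00, ?b00, ?b01, ?a01, ?b10, ?a20, ?a02, ?b11, ?b20, ?a11, ?b02. ring.
Qed.

Lemma W_series_zero r xi a b :
  rep r (xi1 xi) a -> rep r (xi2 xi) b -> W_congruence xi -> Wser a b = pzero.
Proof.
  intros Ha Hb [d Hd]. assert (HW := rep_W r xi a b Ha Hb).
  assert (Hr : 0 < r) by apply Ha.
  assert (Hm : 0 < Rmin r d) by (apply Rmin_glb_lt; [easy|apply cond_pos]).
  assert (H0 : rep (Rmin r d) (W xi) (pconst 0)).
  { apply rep_ext with (fun _ _ => 0); [|now apply rep_const].
    intros x y Hx Hy. assert (H := Rmin_r r d). apply Hd; rewrite Rminus_0_r; lra. }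
  now apply (rep_unique _ _ _ _ _ HW H0).
Qed.

(** * The identity theorem *)

Definition pasc (n j : nat) : R :=
  INR (fact (n + j)) / (INR (fact n) * INR (fact j)).

Lemma fact_pos n : 0 < INR (fact n).
Proof. apply lt_0_INR, lt_O_fact. Qed.

Lemma fact_S n : INR (fact (S n)) = (INR n + 1) * INR (fact n).
Proof. change (fact (S n)) with (S n * fact n)%nat.
  rewrite mult_INR, S_INR. easy. Qed.

Lemma pasc_pos n j : 0 < pasc n j.
Proof.
  unfold pasc. apply Rdiv_lt_0_compat; [|apply Rmult_lt_0_compat]; apply fact_pos.
Qed.

Lemma pasc_0_l j : pasc 0 j = 1.
Proof. unfold pasc. simpl. field. apply Rgt_not_eq, fact_pos. Qed.

Lemma pasc_0_r n : pasc n 0 = 1.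
Proof. unfold pasc. rewrite Nat.add_0_r. simpl. field. apply Rgt_not_eq, fact_pos. Qed.

Lemma pasc_rec n j : pasc (S n) (S j) = pasc n (S j) + pasc (S n) j.
Proof.
  unfold pasc. replace (S n + S j)%nat with (S (S (n + j))) by lia.
  replace (n + S j)%nat with (S (n + j)) by lia.
  replace (S n + j)%nat with (S (n + j)) by lia.
  rewrite !fact_S, !S_INR, plus_INR.
  assert (0 <= INR n) by apply pos_INR. assert (0 <= INR j) by apply pos_INR.
  field. repeat split; try lra; apply Rgt_not_eq, fact_pos.
Qed.

(** The absorption identity of binomial coefficients. *)
Lemma pasc_swap n j : (INR n + 1) * pasc (S n) j = (INR j + 1) * pasc n (S j).
Proof.
  unfold pasc. replace (n + S j)%nat with (S n + j)%nat by lia.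
  rewrite !fact_S.
  assert (0 <= INR n) by apply pos_INR. assert (0 <= INR j) by apply pos_INR.
  field. repeat split; try lra; apply Rgt_not_eq, fact_pos.
Qed.

Lemma pasc_binomial x y n j : 0 <= x -> 0 <= y ->
  pasc n j * x ^ n * y ^ j <= (x + y) ^ (n + j).
Proof.
  intros Hx Hy. revert j. induction n as [|n IHn]; intros j.
  - rewrite pasc_0_l. simpl. rewrite !Rmult_1_l. apply pow_incr. lra.
  - induction j as [|j IHj].
    + rewrite pasc_0_r, Nat.add_0_r. simpl pow at 2. rewrite Rmult_1_l, Rmult_1_r.
      apply pow_incr. lra.
    + rewrite pasc_rec. specialize (IHn (S j)).
      replace (S n + S j)%nat with (S (n + S j)) by lia. simpl pow at 3.
      replace (S n + j)%nat with (n + S j)%nat in IHj by lia.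
      apply Rle_trans with (x * (pasc n (S j) * x ^ n * y ^ S j)
        + y * (pasc (S n) j * x ^ S n * y ^ j)); [apply Req_le; simpl; ring|].
      rewrite Rmult_plus_distr_r.
      apply Rplus_le_compat; apply Rmult_le_compat_l; easy.
Qed.

Lemma abs_bound_shifts k c M : abs_bound c M -> abs_bound (fun i j => c (i + k)%nat j) M.
Proof.
  intros H. induction k as [|k IH].
  - replace (fun i j : nat => c (i + 0)%nat j) with c; [easy|].
    apply fam_ext; intros. now rewrite Nat.add_0_r.
  - apply abs_bound_shift in IH. eapply abs_bound_le; [|apply IH].
    intros i j. simpl. rewrite Nat.add_succ_r. apply Rle_refl.
Qed.

Lemma bnd_iter_dx k a r s q M : 0 <= r -> 0 < s -> 0 <= q -> bnd a (monom (r + s) q) M ->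
  bnd (Nat.iter k dx a) (monom r q) (INR (fact k) / s ^ k * M).
Proof.
  intros Hr Hs Hq Ha.
  assert (Hsk : 0 < s ^ k) by now apply pow_lt.
  assert (Hp : 0 <= INR (fact k) / s ^ k).
  { apply Rdiv_le_0_compat; [left; apply fact_pos|easy]. }
  assert (H := abs_bound_scal (INR (fact k) / s ^ k) _ _ (abs_bound_shifts k _ _ Ha)).
  rewrite (Rabs_pos_eq _ Hp) in H. eapply abs_bound_le; [|apply H]. intros i j.
  assert (Hi := fact_pos i). assert (Hk := fact_pos k).
  assert (E : Nat.iter k dx a i j = pasc i k * INR (fact k) * a (i + k)%nat j).
  { apply Rmult_eq_reg_l with (INR (fact i)); [|lra].
    rewrite iter_dx. unfold pasc. field. lra. }
  rewrite E. unfold monom. rewrite !Rabs_mult, (Rabs_pos_eq _ Hp).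
  rewrite !(Rabs_pos_eq (_ ^ _)) by (apply pow_le; lra).
  rewrite (Rabs_pos_eq (pasc i k)) by (left; apply pasc_pos).
  rewrite (Rabs_pos_eq (INR _)) by lra.
  assert (Hb := pasc_binomial r s i k Hr ltac:(lra)).
  apply Rle_trans with (INR (fact k) / s ^ k * (Rabs (a (i + k)%nat j) * q ^ j)
    * (pasc i k * r ^ i * s ^ k)).
  - apply Req_le. field. lra.
  - apply Rle_trans with (INR (fact k) / s ^ k * (Rabs (a (i + k)%nat j) * q ^ j)
      * (r + s) ^ (i + k)); [|apply Req_le; ring].
    apply Rmult_le_compat_l; [|easy].
    apply Rmult_le_pos; [easy|]. apply Rmult_le_pos; [apply Rabs_pos|now apply pow_le].
Qed.

Lemma pow_lim_0 q : 0 <= q < 1 -> forall M e, 0 <= M -> 0 < e -> exists n, M * q ^ n < e.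
Proof.
  intros Hq M e HM He.
  destruct (pow_lt_1_zero q) with (y := e / (M + 1)) as [n Hn].
  - rewrite Rabs_pos_eq; lra.
  - apply Rdiv_lt_0_compat; lra.
  - exists n. specialize (Hn n (Nat.le_refl n)).
    rewrite Rabs_pos_eq in Hn by (apply pow_le; lra).
    assert (0 <= q ^ n) by (apply pow_le; lra).
    apply Rle_lt_trans with ((M + 1) * q ^ n); [nra|].
    apply Rlt_le_trans with ((M + 1) * (e / (M + 1))); [apply Rmult_lt_compat_l; lra|].
    apply Req_le. field. lra.
Qed.

(** Only the remainder of Taylor's formula at [x1] survives, and it is at most
    [M ((x - x1) / s) ^ n] for every [n]. *)
Lemma flat_right (F : nat -> R -> R) r M s x1 x :
  (forall k t, Rabs t < r -> is_derive (F k) t (F (S k) t)) ->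
  0 < s -> (forall k t, Rabs t < r -> Rabs (F k t) <= INR (fact k) / s ^ k * M) ->
  (forall k, F k x1 = 0) -> Rabs x1 < r -> Rabs x < r -> x1 < x < x1 + s -> F O x = 0.
Proof.
  intros HF Hs HM H0 Hx1 Hx Hxx.
  assert (HM0 : 0 <= M).
  { specialize (HM O x Hx). simpl in HM. generalize (Rabs_pos (F O x)). lra. }
  assert (Hin : forall t, x1 <= t <= x -> Rabs t < r).
  { intros t Ht. apply Rabs_def1; [apply Rabs_def2 in Hx; lra|apply Rabs_def2 in Hx1; lra]. }
  assert (HD : forall k t, Rabs t < r -> Derive_n (F O) k t = F k t).
  { induction k as [|k IH]; intros t Ht; [easy|]. simpl.
    apply is_derive_unique. apply is_derive_ext_loc with (F k); [|now apply HF].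
    generalize (ball_nbhd t r Ht). apply filter_imp. intros; symmetry; auto. }
  assert (HE : forall k t, Rabs t < r -> ex_derive_n (F O) k t).
  { intros [|k] t Ht; [easy|]. simpl. exists (F (S k) t).
    apply is_derive_ext_loc with (F k); [|now apply HF].
    generalize (ball_nbhd t r Ht). apply filter_imp. intros; symmetry; auto. }
  assert (Hle : forall n, Rabs (F O x) <= M * ((x - x1) / s) ^ S n).
  { intros n. destruct (Taylor_Lagrange (F O) n x1 x) as [z [Hz Hzz]]; [lra| |].
    - intros t Ht k Hk. apply HE. now apply Hin.
    - rewrite Hzz. rewrite sum_eq_R0.
      + rewrite Rplus_0_l, HD by (apply Hin; lra). rewrite Rabs_mult.
        assert (Hp : 0 < (x - x1) ^ S n) by (apply pow_lt; lra).
        assert (Hf := fact_pos (S n)).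
        rewrite Rabs_pos_eq by (apply Rdiv_le_0_compat; lra).
        eapply Rle_trans; [apply Rmult_le_compat_l; [|apply HM, Hin; lra]|].
        * apply Rdiv_le_0_compat; lra.
        * unfold Rdiv. rewrite (Rpow_mult_distr (x - x1) (/ s)), pow_inv.
          apply Req_le. field. split; [apply pow_nonzero; lra|lra].
      + intros m Hm. rewrite HD, H0 by easy. ring. }
  assert (Hq : 0 <= (x - x1) / s < 1).
  { split; [apply Rdiv_le_0_compat; lra|]. apply Rmult_lt_reg_r with s; [easy|].
    unfold Rdiv. rewrite Rmult_assoc, Rinv_l by lra. lra. }
  apply Rabs_eq_0. apply Rle_antisym; [|apply Rabs_pos]. apply Rnot_lt_le. intros Hpos.
  destruct (pow_lim_0 _ Hq M _ HM0 Hpos) as [n Hn].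
  specialize (Hle n). simpl pow in Hle.
  assert (0 <= ((x - x1) / s) ^ n) by (apply pow_le; lra).
  assert ((x - x1) / s * ((x - x1) / s) ^ n <= ((x - x1) / s) ^ n) by nra.
  assert (M * ((x - x1) / s * ((x - x1) / s) ^ n) <= M * ((x - x1) / s) ^ n)
    by (apply Rmult_le_compat_l; easy). lra.
Qed.

Lemma flat_near (F : nat -> R -> R) r M s x1 x :
  (forall k t, Rabs t < r -> is_derive (F k) t (F (S k) t)) ->
  0 < s -> (forall k t, Rabs t < r -> Rabs (F k t) <= INR (fact k) / s ^ k * M) ->
  (forall k, F k x1 = 0) -> Rabs x1 < r -> Rabs x < r -> Rabs (x - x1) < s -> F O x = 0.
Proof.
  intros HF Hs HM H0 Hx1 Hx Hxx. apply Rabs_def2 in Hxx.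
  destruct (Rtotal_order x1 x) as [H|[<-|H]].
  - apply (flat_right F r M s x1 x); try easy; lra.
  - apply H0.
  - replace x with (- - x) by ring.
    transitivity ((-1) ^ 0 * F O (- - x)); [simpl; ring|].
    apply (flat_right (fun k t => (-1) ^ k * F k (- t)) r M s (- x1) (- x));
      rewrite ?Rabs_Ropp; try easy; try lra.
    + intros k t Ht. rewrite <- Rabs_Ropp in Ht. specialize (HF k (- t) Ht).
      replace ((-1) ^ S k * F (S k) (- t)) with ((-1) ^ k * (-1 * F (S k) (- t))) by (simpl; ring).
      apply (is_derive_scal (fun t => F k (- t)) t).
      apply (is_derive_comp (F k) Ropp); [easy|].
      apply (is_derive_opp (fun t : R => t) t 1). apply (is_derive_id (K := R_AbsRing)).
    + intros k t Ht. rewrite Rabs_mult, pow_1_abs, Rmult_1_l. apply HM. now rewrite Rabs_Ropp.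
    + intros k. rewrite Ropp_involutive, H0. ring.
Qed.

(** A function vanishing near [x0] is flat at each point of that neighbourhood, hence vanishes
    within the fixed distance [s] of it; repeat. *)
Lemma spread (F : nat -> R -> R) r M s x0 h :
  (forall k t, Rabs t < r -> is_derive (F k) t (F (S k) t)) ->
  0 < s -> (forall k t, Rabs t < r -> Rabs (F k t) <= INR (fact k) / s ^ k * M) ->
  Rabs x0 < r -> 0 < h -> (forall t, Rabs t < r -> Rabs (t - x0) < h -> F O t = 0) ->
  forall x, Rabs x < r -> F O x = 0.
Proof.
  intros HF Hs HM Hx0 Hh H0.
  assert (Hstep : forall n t, Rabs t < r -> Rabs (t - x0) < h + INR n * (s / 2) -> F O t = 0).
  { induction n as [|n IH]; intros x Hx Hxx.
    - apply H0; [easy|]. simpl in Hxx. lra.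
    - rewrite S_INR in Hxx. set (w := h + INR n * (s / 2)) in *.
      assert (Hn := pos_INR n). assert (Hw : 0 < w) by (unfold w; nra).
      destruct (Rlt_le_dec (Rabs (x - x0)) w) as [H|H]; [now apply IH|].
      set (d := Rabs (x - x0)) in *.
      set (e := Rmin w s / 4).
      assert (He : 0 < e) by (unfold e; assert (0 < Rmin w s) by (apply Rmin_glb_lt; lra); lra).
      assert (He1 : e <= w / 4) by (unfold e; generalize (Rmin_l w s); lra).
      assert (He2 : e <= s / 4) by (unfold e; generalize (Rmin_r w s); lra).
      set (la := (w - e) / d).
      assert (Hla : la * d = w - e) by (unfold la; field; lra).
      assert (Hla01 : 0 < la < 1) by nra.
      set (x1 := x0 + la * (x - x0)).
      assert (Hx1 : Rabs (x1 - x0) = w - e).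
      { unfold x1. replace (x0 + la * (x - x0) - x0) with (la * (x - x0)) by ring.
        rewrite Rabs_mult, Rabs_pos_eq by lra. easy. }
      assert (Hx1x : Rabs (x - x1) = d - (w - e)).
      { unfold x1. replace (x - (x0 + la * (x - x0))) with ((1 - la) * (x - x0)) by ring.
        rewrite Rabs_mult, Rabs_pos_eq by lra. fold d. lra. }
      assert (Hxr := Hx).
      assert (Hx1r : Rabs x1 < r).
      { unfold x1. replace (x0 + la * (x - x0)) with ((1 - la) * x0 + la * x) by ring.
        eapply Rle_lt_trans; [apply Rabs_triang|]. rewrite !Rabs_mult.
        rewrite (Rabs_pos_eq la), (Rabs_pos_eq (1 - la)) by lra. nra. }
      apply (flat_near F r M s x1 x); try easy; [|rewrite Hx1x; unfold w in *; lra].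
      assert (Hflat : forall k, locally x1 (fun t => F k t = 0)).
      { induction k as [|k IHk].
        - apply filter_imp with (P := fun t => Rabs t < r /\ Rabs (t - x0) < w).
          + intros t [Ht1 Ht2]. now apply IH.
          + apply filter_and; [now apply ball_nbhd|].
            assert (Hee : 0 < e) by easy. exists (mkposreal e Hee). intros t Ht.
            assert (Ht' : Rabs (t - x1) < e) by apply Ht.
            replace (t - x0) with ((t - x1) + (x1 - x0)) by ring.
            eapply Rle_lt_trans; [apply Rabs_triang|]. lra.
        - apply filter_imp with (P := fun t => Rabs t < r /\ locally t (fun u => F k u = 0)).
          + intros t [Ht1 Ht2]. rewrite <- (is_derive_unique _ _ _ (HF k t Ht1)).
            rewrite (Derive_ext_loc _ (fun _ => 0)); [apply Derive_const|easy].
          + apply filter_and; [now apply ball_nbhd|]. now apply locally_locally. }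
      intros k. apply (locally_singleton _ _ (Hflat k)). }
  intros x Hx.
  destruct (INR_unbounded (Rabs (x - x0) / (s / 2))) as [n Hn].
  apply (Hstep n); [easy|].
  assert (Rabs (x - x0) < INR n * (s / 2)); [|lra].
  apply Rmult_lt_reg_r with (/ (s / 2)); [apply Rinv_0_lt_compat; lra|].
  rewrite Rmult_assoc, Rinv_r by lra. lra.
Qed.

Lemma identity_slice r a x0 y h : cvr r a -> Rabs x0 < r -> Rabs y < r -> 0 < h ->
  (forall x, Rabs x < r -> Rabs (x - x0) < h -> ev a x y = 0) ->
  forall x, Rabs x < r -> ev a x y = 0.
Proof.
  intros Ha Hx0 Hy Hh H0 x Hx.
  assert (Hm : Rmax (Rmax (Rabs x) (Rabs x0)) (Rabs y) < r)
    by (repeat apply Rmax_lub_lt; easy).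
  set (m := Rmax (Rmax (Rabs x) (Rabs x0)) (Rabs y)) in *.
  assert (Hm1 : Rabs x <= m) by (eapply Rle_trans; [apply Rmax_l|apply Rmax_l]).
  assert (Hm2 : Rabs x0 <= m) by (eapply Rle_trans; [apply Rmax_r|apply Rmax_l]).
  assert (Hm3 : Rabs y <= m) by apply Rmax_r.
  assert (Hx' := Rabs_pos x).
  set (s := (r - m) / 3). set (r1 := m + s).
  assert (Hs : 0 < s) by (unfold s; lra).
  assert (Hr2 : r1 + s < r) by (unfold r1, s; lra).
  destruct (Ha (r1 + s)) as [M HM]; [unfold r1 in *; lra|].
  assert (Hcv : forall k, cvr r (Nat.iter k dx a)).
  { induction k as [|k IH]; [easy|]. now apply cvr_dx. }
  apply (spread (fun k t => ev (Nat.iter k dx a) t y) r1 M s x0 h); try easy.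
  - intros k t Ht. apply (eva_dx r); [apply Hcv|lra|lra].
  - intros k t Ht. apply ev_bound with r1 (r1 + s); [lra|unfold r1 in *; lra|].
    apply bnd_iter_dx; [unfold r1 in *; lra|easy|unfold r1 in *; lra|easy].
  - unfold r1 in *; lra.
  - intros t Ht Htt. apply H0; lra.
  - unfold r1 in *; lra.
Qed.

(** First along the horizontal lines that meet the small square, then along all vertical ones. *)
Theorem identity_theorem r a x0 y0 h : cvr r a -> Rabs x0 < r -> Rabs y0 < r -> 0 < h ->
  (forall x y, Rabs x < r -> Rabs y < r -> Rabs (x - x0) < h -> Rabs (y - y0) < h ->
    ev a x y = 0) ->
  a = pzero.
Proof.
  intros Ha Hx0 Hy0 Hh H0.
  assert (Hall : forall x y, Rabs x < r -> Rabs y < r -> ev a x y = 0).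
  { intros x y Hx Hy. rewrite <- ev_transpose.
    apply (identity_slice r (transpose a) y0 x h); try easy; [now apply cvr_transpose|].
    intros y' Hy' Hyy. rewrite ev_transpose.
    apply (identity_slice r a x0 y' h); try easy. intros x' Hx' Hxx. now apply H0. }
  assert (Hr : 0 < r) by (generalize (Rabs_pos x0); lra).
  apply (rep_unique r r (ev a)).
  - now apply rep_ev.
  - apply rep_ext with (fun _ _ => 0); [easy|now apply rep_const].
Qed.

Lemma ev_continuous r a x0 y0 e : cvr r a -> Rabs x0 < r -> Rabs y0 < r -> 0 < e ->
  exists d, 0 < d /\ forall x y, Rabs (x - x0) < d -> Rabs (y - y0) < d ->
    Rabs x < r /\ Rabs y < r /\ Rabs (ev a x y - ev a x0 y0) < e.
Proof.
  intros Ha Hx0 Hy0 He.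
  assert (Hm : Rmax (Rabs x0) (Rabs y0) < r) by now apply Rmax_lub_lt.
  set (m := Rmax (Rabs x0) (Rabs y0)) in *.
  assert (Hm1 : Rabs x0 <= m) by apply Rmax_l. assert (Hm2 : Rabs y0 <= m) by apply Rmax_r.
  assert (Hx' := Rabs_pos x0). set (r1 := (m + r) / 2).
  destruct (cvr_dx r a Ha r1) as [M HM]; [unfold r1; lra|].
  destruct (cvr_dy r a Ha r1) as [N HN]; [unfold r1; lra|].
  assert (HM0 := bnd_nonneg _ _ _ HM). assert (HN0 := bnd_nonneg _ _ _ HN).
  set (d := Rmin (r1 - m) (e / (M + N + 1))).
  assert (Hq : 0 < e / (M + N + 1)) by (apply Rdiv_lt_0_compat; lra).
  assert (Hd1 : d <= r1 - m) by apply Rmin_l.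
  assert (Hd2 : d <= e / (M + N + 1)) by apply Rmin_r.
  assert (Hd : 0 < d) by (apply Rmin_glb_lt; unfold r1 in *; lra).
  assert (Hd3 : d * (M + N + 1) <= e).
  { apply Rle_trans with (e / (M + N + 1) * (M + N + 1));
      [apply Rmult_le_compat_r; lra|apply Req_le; field; lra]. }
  assert (Hin : forall t t0, Rabs t0 <= m -> Rabs (t - t0) < d -> Rabs t < r1).
  { intros t t0 Ht0 Ht. replace t with ((t - t0) + t0) by ring.
    eapply Rle_lt_trans; [apply Rabs_triang|]. lra. }
  exists d. split; [easy|]. intros x y Hx Hy.
  assert (Hxr := Hin x x0 Hm1 Hx). assert (Hyr := Hin y y0 Hm2 Hy).
  assert (Hr1 : r1 < r) by (unfold r1; lra).
  split; [lra|]. split; [lra|].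
  replace (ev a x y - ev a x0 y0) with ((ev a x y - ev a x0 y) + (ev a x0 y - ev a x0 y0)) by ring.
  eapply Rle_lt_trans; [apply Rabs_triang|].
  assert (H1 : Rabs (ev a x y - ev a x0 y) <= M * Rabs (x - x0)).
  { apply (bounded_variation (fun x => ev a x y) (fun t => ev (dx a) t y) M x0 x).
    intros t Ht. assert (Rabs t < r1) by (apply Hin with x0; lra).
    split; [apply (eva_dx r); lra || easy|].
    apply ev_bound with r1 r1; lra || easy. }
  assert (H2 : Rabs (ev a x0 y - ev a x0 y0) <= N * Rabs (y - y0)).
  { apply (bounded_variation (fun y => ev a x0 y) (fun t => ev (dy a) x0 t) N y0 y).
    intros t Ht. assert (Rabs t < r1) by (apply Hin with y0; lra).
    split; [apply (eva_dy r); lra || easy|].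
    apply ev_bound with r1 r1; [unfold r1; lra|lra|easy]. }
  nra.
Qed.

(** * Stationary eigenvalues *)

Lemma is_derive_fst (f : R -> C) x l :
  is_derive (K := R_AbsRing) (V := C_R_NormedModule) f x l ->
  is_derive (fun t => fst (f t)) x (fst l).
Proof.
  intros H. unfold is_derive in *.
  apply (filterdiff_ext_lin (fun t => fst (f t)) (fun y => fst (scal (V := C_R_NormedModule) y l))).
  - apply (filterdiff_comp (V := C_R_NormedModule) f (fun z : C => fst z)
      (fun y => scal (V := C_R_NormedModule) y l) (fun z : C => fst z)); [easy|].
    apply (filterdiff_linear (U := C_R_NormedModule)).
    apply (is_linear_fst (U := R_NormedModule) (V := R_NormedModule)).
  - easy.
Qed.

Lemma is_derive_snd (f : R -> C) x l :
  is_derive (K := R_AbsRing) (V := C_R_NormedModule) f x l ->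
  is_derive (fun t => snd (f t)) x (snd l).
Proof.
  intros H. unfold is_derive in *.
  apply (filterdiff_ext_lin (fun t => snd (f t)) (fun y => snd (scal (V := C_R_NormedModule) y l))).
  - apply (filterdiff_comp (V := C_R_NormedModule) f (fun z : C => snd z)
      (fun y => scal (V := C_R_NormedModule) y l) (fun z : C => snd z)); [easy|].
    apply (filterdiff_linear (U := C_R_NormedModule)).
    apply (is_linear_snd (U := R_NormedModule) (V := R_NormedModule)).
  - easy.
Qed.

Lemma Cmult_cancel (x y z : C) : z <> RtoC 0 -> Cmult x z = Cmult y z -> x = y.
Proof.
  intros Hz H. rewrite <- (Cmult_1_r x), <- (Cmult_1_r y), <- (Cinv_r z Hz).
  rewrite !Cmult_assoc, H. easy.
Qed.

Lemma eigenvalue_discriminant (a b c d l v1 v2 : C) : (v1, v2) <> (RtoC 0, RtoC 0) ->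
  (a * v1 + b * v2 = l * v1)%C -> (c * v1 + d * v2 = l * v2)%C ->
  ((2 * l - (a + d)) * (2 * l - (a + d)) = (a - d) * (a - d) + 4 * b * c)%C.
Proof.
  intros Hv H1 H2.
  assert (H : ((l - a) * (l - d) = b * c)%C).
  { assert (E1 : ((l - a) * v1 = b * v2)%C).
    { replace ((l - a) * v1)%C with (l * v1 - a * v1)%C by ring. rewrite <- H1. ring. }
    assert (E2 : ((l - d) * v2 = c * v1)%C).
    { replace ((l - d) * v2)%C with (l * v2 - d * v2)%C by ring. rewrite <- H2. ring. }
    destruct (Classical_Prop.classic (v1 = RtoC 0)) as [Z1|Z1].
    - assert (Z2 : v2 <> RtoC 0) by (intros Z2; apply Hv; now rewrite Z1, Z2).
      apply (Cmult_cancel _ _ v2 Z2).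
      replace ((l - a) * (l - d) * v2)%C with ((l - a) * ((l - d) * v2))%C by ring.
      rewrite E2. replace ((l - a) * (c * v1))%C with (c * ((l - a) * v1))%C by ring.
      rewrite E1. ring.
    - apply (Cmult_cancel _ _ v1 Z1).
      replace ((l - a) * (l - d) * v1)%C with ((l - d) * ((l - a) * v1))%C by ring.
      rewrite E1. replace ((l - d) * (b * v2))%C with (b * ((l - d) * v2))%C by ring.
      rewrite E2. ring. }
  replace ((2 * l - (a + d)) * (2 * l - (a + d)))%C
    with (4 * ((l - a) * (l - d)) + (a - d) * (a - d))%C by ring.
  rewrite H. ring.
Qed.

Lemma locally_zero_derive (f : R -> R) x l :
  locally x (fun t => f t = 0) -> is_derive f x l -> l = 0.
Proof.
  intros H Hf. rewrite <- (is_derive_unique _ _ _ Hf).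
  rewrite (Derive_ext_loc _ (fun _ => 0)); [apply Derive_const|easy].
Qed.

(** Obtained by differentiating [(2 l - trace)^2 = discriminant] along a line; a complex
    equation between real and imaginary parts. *)
Lemma eigenvalue_derivative (lam : R -> C) (l' : C) (tau del : R -> R) (tau' del' : R) x :
  is_derive (K := R_AbsRing) (V := C_R_NormedModule) lam x l' ->
  is_derive tau x tau' -> is_derive del x del' ->
  locally x (fun t => ((2 * lam t - RtoC (tau t)) * (2 * lam t - RtoC (tau t)) = RtoC (del t))%C) ->
  (4 * (2 * lam x - RtoC (tau x)) * l' = RtoC del' + 2 * (2 * lam x - RtoC (tau x)) * RtoC tau')%C.
Proof.
  intros Hl Ht Hd H.
  assert (H1 := is_derive_fst _ _ _ Hl). assert (H2 := is_derive_snd _ _ _ Hl).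
  set (u := fun t => 2 * fst (lam t) - tau t). set (w := fun t => 2 * snd (lam t)).
  assert (Hu : is_derive u x (2 * fst l' - tau')).
  { apply (is_derive_minus (fun t => 2 * fst (lam t)) tau x); [|easy].
    now apply (is_derive_scal (fun t => fst (lam t))). }
  assert (Hw : is_derive w x (2 * snd l')) by now apply (is_derive_scal (fun t => snd (lam t))).
  assert (E1 : locally x (fun t => u t * u t - w t * w t - del t = 0)).
  { revert H. apply filter_imp. intros t E. apply (f_equal fst) in E.
    revert E. unfold u, w. simpl. intros <-. ring. }
  assert (E2 : locally x (fun t => u t * w t = 0)).
  { revert H. apply filter_imp. intros t E. apply (f_equal snd) in E.
    revert E. unfold u, w. simpl. intros E. nra. }
  assert (D1 : (2 * fst l' - tau') * u x + u x * (2 * fst l' - tau')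
    - (2 * snd l' * w x + w x * (2 * snd l')) - del' = 0).
  { apply (locally_zero_derive _ x _ E1).
    apply (is_derive_minus (fun t => u t * u t - w t * w t) del x); [|easy].
    apply (is_derive_minus (fun t => u t * u t) (fun t => w t * w t) x).
    - apply (is_derive_mult u u x); [easy|easy|intros; apply Rmult_comm].
    - apply (is_derive_mult w w x); [easy|easy|intros; apply Rmult_comm]. }
  assert (D2 : (2 * fst l' - tau') * w x + u x * (2 * snd l') = 0).
  { apply (locally_zero_derive _ x _ E2).
    apply (is_derive_mult u w x); [easy|easy|intros; apply Rmult_comm]. }
  unfold u, w in D1, D2.
  apply injective_projections; simpl; lra.
Qed.

(** With [r = 2 l - trace] the eigenvector is proportional to [(2 b, r + d - a)], and the
    derivative of [l] along it is a multiple of [X + r Y]. Multiplying by the conjugate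
    branch removes the irrational [r]. *)
Lemma stationary_elimination (a b d l v1 v2 lx ly dl tx ty dx_ dy_ : C) :
  b <> RtoC 0 -> (v1, v2) <> (RtoC 0, RtoC 0) ->
  (a * v1 + b * v2 = l * v1)%C ->
  let r := (2 * l - (a + d))%C in
  (r * r = dl)%C ->
  (4 * r * lx = dx_ + 2 * r * tx)%C -> (4 * r * ly = dy_ + 2 * r * ty)%C ->
  (v1 * lx + v2 * ly = 0)%C ->
  let X := (2 * b * dx_ + (d - a) * dy_ + 2 * dl * ty)%C in
  let Y := (4 * b * tx + 2 * (d - a) * ty + dy_)%C in
  (X * X = dl * (Y * Y))%C.
Proof.
  intros Hb Hv H1 r Hr Hx Hy H X Y.
  assert (Hv1 : v1 <> RtoC 0).
  { intros Z. apply Hv. f_equal; [easy|]. rewrite Z in H1.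
    apply (Cmult_cancel _ _ b Hb). replace (v2 * b)%C with (a * RtoC 0 + b * v2)%C by ring.
    rewrite H1. ring. }
  assert (E : (2 * b * v2 = (r + d - a) * v1)%C).
  { replace (2 * b * v2)%C with (2 * (a * v1 + b * v2) - 2 * a * v1)%C by ring.
    rewrite H1. unfold r. ring. }
  assert (E2 : (v1 * (dx_ + 2 * r * tx) + v2 * (dy_ + 2 * r * ty) = 0)%C).
  { rewrite <- Hx, <- Hy. replace (v1 * (4 * r * lx) + v2 * (4 * r * ly))%C
      with (4 * r * (v1 * lx + v2 * ly))%C by ring. rewrite H. ring. }
  assert (E3 : (X + r * Y = 0)%C).
  { apply (Cmult_cancel _ _ v1 Hv1). unfold X, Y. rewrite <- Hr.
    transitivity (2 * b * (v1 * (dx_ + 2 * r * tx))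
      + ((r + d - a) * v1) * (dy_ + 2 * r * ty))%C; [ring|].
    rewrite <- E.
    transitivity (2 * b * (v1 * (dx_ + 2 * r * tx) + v2 * (dy_ + 2 * r * ty)))%C; [ring|].
    rewrite E2. ring. }
  assert (E4 : X = (- (r * Y))%C).
  { replace X with (X + r * Y - r * Y)%C by ring. rewrite E3. ring. }
  rewrite E4, <- Hr. ring.
Qed.

Definition trace_ser (a b : fam) : fam := pscal (-1) (padd (dxy 1 0 a) (dxy 0 1 b)).
Definition skew_ser (a b : fam) : fam := psub (dxy 1 0 a) (dxy 0 1 b).
Definition upper_ser (a : fam) : fam := pscal (-1) (dxy 0 1 a).

(** For an eigenvalue [(trace + r) / 2], with [r ^ 2] the discriminant, stationarity says
    [X + r Y = 0] for the two functions with these expansions. *)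
Definition X_ser (a b : fam) : fam :=
  padd (padd (pmul (pscal 2 (upper_ser a)) (dx (dser a b))) (pmul (skew_ser a b) (dy (dser a b))))
    (pmul (pscal 2 (dser a b)) (dy (trace_ser a b))).
Definition Y_ser (a b : fam) : fam :=
  padd (padd (pmul (pscal 4 (upper_ser a)) (dx (trace_ser a b)))
    (pmul (pscal 2 (skew_ser a b)) (dy (trace_ser a b)))) (dy (dser a b)).

Lemma cvr_dxy r i j a : cvr r a -> cvr r (dxy i j a).
Proof.
  intros Ha. unfold dxy.
  assert (Hj : cvr r (Nat.iter j dy a)) by (induction j; [easy|now apply cvr_dy]).
  induction i; [easy|now apply cvr_dx].
Qed.

Lemma cvr_dser r a b : cvr r a -> cvr r b -> cvr r (dser a b).
Proof. intros. unfold dser, psub. cvr_tac; now apply cvr_dxy. Qed.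

Lemma cvr_skew r a b : cvr r a -> cvr r b -> cvr r (skew_ser a b).
Proof. intros. unfold skew_ser, psub. cvr_tac; now apply cvr_dxy. Qed.

Lemma cvr_trace r a b : cvr r a -> cvr r b -> cvr r (trace_ser a b).
Proof. intros. unfold trace_ser. cvr_tac; now apply cvr_dxy. Qed.

Lemma cvr_upper r a : cvr r a -> cvr r (upper_ser a).
Proof. intros. unfold upper_ser. cvr_tac; now apply cvr_dxy. Qed.

Lemma cvr_XY r a b : cvr r a -> cvr r b -> cvr r (X_ser a b) /\ cvr r (Y_ser a b).
Proof.
  intros Ha Hb. assert (H1 := cvr_dser r a b Ha Hb). assert (H2 := cvr_skew r a b Ha Hb).
  assert (H3 := cvr_trace r a b Ha Hb). assert (H4 := cvr_upper r a Ha).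
  unfold X_ser, Y_ser. split; cvr_tac.
Qed.

Lemma stationary_relation r xi a b x y :
  rep r (xi1 xi) a -> rep r (xi2 xi) b -> Rabs x < r -> Rabs y < r ->
  stationary_eigenvalue xi x y -> ev (upper_ser a) x y <> 0 ->
  ev (X_ser a b) x y ^ 2 = ev (dser a b) x y * ev (Y_ser a b) x y ^ 2.
Proof.
  intros Ha Hb Hx Hy (lam & v & lx & ly & Hloc & (Hv & Hv1 & Hv2) & Hlx & Hly & Hst) Hup.
  assert (Hr : 0 < r) by apply Ha.
  assert (Hca : cvr r a) by apply Ha. assert (Hcb : cvr r b) by apply Hb.
  assert (H1 := cvr_dser r a b Hca Hcb). assert (H2 := cvr_skew r a b Hca Hcb).
  assert (H3 := cvr_trace r a b Hca Hcb). assert (H4 := cvr_upper r a Hca).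
  assert (Hp1 : forall i j, rep r (partial_derive i j (xi1 xi)) (dxy i j a))
    by (intros; now apply rep_partial).
  assert (Hp2 : forall i j, rep r (partial_derive i j (xi2 xi)) (dxy i j b))
    by (intros; now apply rep_partial).
  assert (Hd1 : forall i j, cvr r (dxy i j a)) by (intros; now apply cvr_dxy).
  assert (Hd2 : forall i j, cvr r (dxy i j b)) by (intros; now apply cvr_dxy).
  assert (Htr : forall s t, Rabs s < r -> Rabs t < r -> ev (trace_ser a b) s t =
    - partial_derive 1 0 (xi1 xi) s t + - partial_derive 0 1 (xi2 xi) s t).
  { intros s t Hs Ht. unfold trace_ser. rewrite ev_scal, (eva_add r) by (easy || apply Hd1 || apply Hd2).
    destruct (Hp1 1%nat 0%nat) as (_ & _ & ->); [|easy|easy].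
    destruct (Hp2 0%nat 1%nat) as (_ & _ & ->); [|easy|easy]. ring. }
  assert (Hdi : forall s t, Rabs s < r -> Rabs t < r -> ev (dser a b) s t = discriminant xi s t).
  { intros s t Hs Ht. symmetry. apply (rep_discriminant r xi a b Ha Hb); easy. }
  assert (Hsq : forall s t, Rabs s < r -> Rabs t < r -> (exists w, is_eigenpair xi s t (lam s t) w) ->
    ((2 * lam s t - RtoC (ev (trace_ser a b) s t)) * (2 * lam s t - RtoC (ev (trace_ser a b) s t))
      = RtoC (ev (dser a b) s t))%C).
  { intros s t Hs Ht [[w1 w2] (Hw & Hw1 & Hw2)]. rewrite Htr, Hdi by easy. rewrite RtoC_plus.
    rewrite (eigenvalue_discriminant _ _ _ _ _ _ _ Hw Hw1 Hw2).
    unfold discriminant. apply injective_projections; simpl; ring. }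
  assert (HX : (4 * (2 * lam x y - RtoC (ev (trace_ser a b) x y)) * lx =
    RtoC (ev (dx (dser a b)) x y) + 2 * (2 * lam x y - RtoC (ev (trace_ser a b) x y))
      * RtoC (ev (dx (trace_ser a b)) x y))%C).
  { apply (eigenvalue_derivative (fun s => lam s y) lx (fun s => ev (trace_ser a b) s y)
      (fun s => ev (dser a b) s y)); [easy|now apply (eva_dx r)|now apply (eva_dx r)|].
    apply filter_imp with (P := fun s => Rabs s < r /\ exists w, is_eigenpair xi s y (lam s y) w).
    - intros s [Hs Hw]. now apply Hsq.
    - apply filter_and; [now apply ball_nbhd|]. apply (locally_2d_1d_const_y (fun s t => exists w, is_eigenpair xi s t (lam s t) w) x y Hloc). }
  assert (HY : (4 * (2 * lam x y - RtoC (ev (trace_ser a b) x y)) * ly =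
    RtoC (ev (dy (dser a b)) x y) + 2 * (2 * lam x y - RtoC (ev (trace_ser a b) x y))
      * RtoC (ev (dy (trace_ser a b)) x y))%C).
  { apply (eigenvalue_derivative (fun s => lam x s) ly (fun s => ev (trace_ser a b) x s)
      (fun s => ev (dser a b) x s)); [easy|now apply (eva_dy r)|now apply (eva_dy r)|].
    apply filter_imp with (P := fun s => Rabs s < r /\ exists w, is_eigenpair xi x s (lam x s) w).
    - intros s [Hs Hw]. now apply Hsq.
    - apply filter_and; [now apply ball_nbhd|]. apply (locally_2d_1d_const_x (fun s t => exists w, is_eigenpair xi s t (lam s t) w) x y Hloc). }
  assert (Hee : exists w, is_eigenpair xi x y (lam x y) w) by (exists v; easy).
  assert (Hrr := Hsq x y Hx Hy Hee).
  destruct v as [v1 v2]. simpl fst in *. simpl snd in *.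
  assert (Hbe : ev (upper_ser a) x y = - partial_derive 0 1 (xi1 xi) x y).
  { unfold upper_ser. rewrite ev_scal.
    destruct (Hp1 0%nat 1%nat) as (_ & _ & ->); [|easy|easy]. ring. }
  rewrite Hbe in Hup.
  assert (Hb0 : RtoC (- partial_derive 0 1 (xi1 xi) x y) <> RtoC 0).
  { intros E. apply Hup. now apply RtoC_inj. }
  rewrite (Htr x y Hx Hy), RtoC_plus in Hrr, HX, HY.
  assert (HS := stationary_elimination _ _ _ _ _ _ _ _ _ _ _ _ _ Hb0 Hv Hv1 Hrr HX HY Hst).
  cbv zeta in HS.
  assert (EX : ev (X_ser a b) x y = 2 * - partial_derive 0 1 (xi1 xi) x y * ev (dx (dser a b)) x y
    + (- partial_derive 0 1 (xi2 xi) x y - - partial_derive 1 0 (xi1 xi) x y) * ev (dy (dser a b)) x y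
    + 2 * ev (dser a b) x y * ev (dy (trace_ser a b)) x y).
  { unfold X_ser. rewrite !(eva_add r), !(eva_mul r), !ev_scal, Hbe by (easy || cvr_tac).
    unfold skew_ser, psub. rewrite (eva_add r), ev_scal by (easy || apply Hd1 || (apply cvr_scal, Hd2)).
    destruct (Hp1 1%nat 0%nat) as (_ & _ & ->); [|easy|easy].
    destruct (Hp2 0%nat 1%nat) as (_ & _ & ->); [|easy|easy]. ring. }
  assert (EY : ev (Y_ser a b) x y = 4 * - partial_derive 0 1 (xi1 xi) x y * ev (dx (trace_ser a b)) x y
    + 2 * (- partial_derive 0 1 (xi2 xi) x y - - partial_derive 1 0 (xi1 xi) x y)
      * ev (dy (trace_ser a b)) x y + ev (dy (dser a b)) x y).
  { unfold Y_ser. rewrite !(eva_add r), !(eva_mul r), !ev_scal, Hbe by (easy || cvr_tac).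
    unfold skew_ser, psub. rewrite (eva_add r), ev_scal by (easy || apply Hd1 || (apply cvr_scal, Hd2)).
    destruct (Hp1 1%nat 0%nat) as (_ & _ & ->); [|easy|easy].
    destruct (Hp2 0%nat 1%nat) as (_ & _ & ->); [|easy|easy]. ring. }
  rewrite EX, EY. apply RtoC_inj.
  apply (f_equal fst) in HS. simpl in HS. apply injective_projections; simpl; [|ring].
  lra.
Qed.

(** * Regular points are dense *)

Lemma normal_Y_series P a b : normal_2jet P a b ->
  pmul (upper_ser a) (Y_ser a b) 1%nat 1%nat = -80 * P ^ 3.
Proof.
  intros (HP & a00 & b00 & b01 & a01 & b10 & a20 & a02 & b11 & b20 & a11 & b02).
  unfold upper_ser, Y_ser, trace_ser, skew_ser, upper_ser. coef.
  rewrite ?a00, ?b00, ?b01, ?a01, ?b10, ?a20, ?a02, ?b11, ?b20, ?a11, ?b02. ring.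
Qed.

(** If all points of an open set were singular, [del * B * (X^2 - del Y^2)] would vanish
    identically. Where [del < 0] this forces [B Y = 0], hence [B Y = 0] everywhere, against its
    nonzero coefficient of [x y]. *)
Lemma regular_points_dense P r xi a b :
  rep r (xi1 xi) a -> rep r (xi2 xi) b -> normal_2jet P a b ->
  (forall e, 0 < e -> exists u v, Rabs u < e /\ Rabs v < e /\ discriminant xi u v < 0) ->
  singular_points_limits_of_regular xi.
Proof.
  intros Ha Hb Hn Hneg.
  assert (Hr : 0 < r) by apply Ha.
  assert (Hca : cvr r a) by apply Ha. assert (Hcb : cvr r b) by apply Hb.
  assert (H1 := cvr_dser r a b Hca Hcb). assert (H4 := cvr_upper r a Hca).
  destruct (cvr_XY r a b Hca Hcb) as [HX HY].
  set (G := pmul (dser a b) (pmul (upper_ser a)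
    (psub (pmul (X_ser a b) (X_ser a b)) (pmul (dser a b) (pmul (Y_ser a b) (Y_ser a b)))))).
  assert (HG : cvr r G) by (unfold G, psub; cvr_tac).
  assert (HevG : forall x y, Rabs x < r -> Rabs y < r -> ev G x y =
    ev (dser a b) x y * (ev (upper_ser a) x y *
      (ev (X_ser a b) x y ^ 2 - ev (dser a b) x y * ev (Y_ser a b) x y ^ 2))).
  { intros x y Hx Hy. unfold G, psub.
    rewrite !(eva_mul r), (eva_add r), ev_scal, !(eva_mul r) by (easy || cvr_tac). ring. }
  exists (mkposreal r Hr). simpl. intros x y. rewrite !Rminus_0_r. intros Hx Hy _ eps.
  apply Classical_Prop.NNPP. intros Hno.
  assert (Hdi : forall s t, Rabs s < r -> Rabs t < r -> ev (dser a b) s t = discriminant xi s t).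
  { intros s t Hs Ht. symmetry. apply (rep_discriminant r xi a b Ha Hb); easy. }
  assert (HG0 : G = pzero).
  { apply (identity_theorem r G x y eps); try easy; [apply cond_pos|].
    intros u v Hu Hv Hux Hvy. rewrite HevG by easy.
    assert (Hsing : singular_point xi u v).
    { apply Classical_Prop.NNPP. intros Hreg. apply Hno. now exists u, v. }
    destruct Hsing as [H0|[H0 Hst]]; [rewrite Hdi, H0 by easy; ring|].
    destruct (Req_dec (ev (upper_ser a) u v) 0) as [E|E]; [rewrite E; ring|].
    rewrite (stationary_relation r xi a b u v Ha Hb Hu Hv Hst E). ring. }
  destruct (Hneg r Hr) as (u & v & Hu & Hv & Huv). rewrite <- Hdi in Huv by easy.
  destruct (ev_continuous r (dser a b) u v (- ev (dser a b) u v) H1 Hu Hv) as (d & Hd & Hcont);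
    [lra|].
  assert (HBY : pmul (upper_ser a) (Y_ser a b) = pzero).
  { apply (identity_theorem r _ u v d); try easy; [cvr_tac|].
    intros s t Hs Ht Hsu Htv. rewrite (eva_mul r) by easy.
    destruct (Hcont s t Hsu Htv) as (_ & _ & Hc). apply Rabs_def2 in Hc.
    assert (E := HevG s t Hs Ht). rewrite HG0 in E.
    unfold pzero in E. rewrite ev_const in E. symmetry in E.
    apply Rmult_integral in E. destruct E as [E|E]; [lra|].
    apply Rmult_integral in E. destruct E as [E|E]; [rewrite E; ring|].
    assert (EY : ev (Y_ser a b) s t = 0); [|rewrite EY; ring].
    assert (Hx2 : 0 <= ev (X_ser a b) s t ^ 2) by apply pow2_ge_0.
    assert (Hy2 : 0 <= ev (Y_ser a b) s t ^ 2) by apply pow2_ge_0.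
    apply Rsqr_0_uniq. rewrite Rsqr_pow2. nra. }
  assert (HP : P <> 0) by apply Hn.
  assert (Hc := normal_Y_series P a b Hn). rewrite HBY in Hc.
  change (pzero 1%nat 1%nat) with 0 in Hc. apply (pow_nonzero P 3) in HP. lra.
Qed.

(** * A norm adapted to Fuchsian equations *)

Lemma pasc_mono_r n j : pasc n j <= pasc n (S j).
Proof.
  destruct n as [|n]; [rewrite !pasc_0_l; lra|].
  rewrite pasc_rec. assert (H := pasc_pos n (S j)). lra.
Qed.

Lemma pasc_mono_l n j : pasc n j <= pasc (S n) j.
Proof.
  destruct j as [|j]; [rewrite !pasc_0_r; lra|].
  rewrite pasc_rec. assert (H := pasc_pos (S n) j). lra.
Qed.

Lemma pasc_le n n' j j' : (n <= n')%nat -> (j <= j')%nat -> pasc n j <= pasc n' j'.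
Proof.
  intros Hn Hj. apply Rle_trans with (pasc n' j).
  - induction Hn as [|n' _ IH]; [lra|]. eapply Rle_trans; [apply IH|apply pasc_mono_l].
  - induction Hj as [|j' _ IH]; [lra|]. eapply Rle_trans; [apply IH|apply pasc_mono_r].
Qed.

Lemma pasc_mul n j n' j' : pasc n j * pasc n' j' <= pasc (n + n') (j + j').
Proof.
  assert (Hp := pasc_pos n' j').
  revert j. induction n as [|n IHn]; intros j.
  - rewrite pasc_0_l, Rmult_1_l. apply pasc_le; lia.
  - induction j as [|j IHj].
    + rewrite pasc_0_r, Rmult_1_l. apply pasc_le; lia.
    + rewrite pasc_rec. simpl. rewrite pasc_rec, Rmult_plus_distr_r.
      specialize (IHn (S j)). simpl in IHn, IHj. lra.
Qed.

(** The weight tolerates two derivatives in [y] for one power of [x]: by [pasc_swap], moving two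
    units from [j] to [2 n] costs the factor [j^2 / n^2] that the inverse of a Fuchsian
    operator of order two provides. *)
Definition wt (s : R) : fam := fun n j => s ^ (3 * n + j) / pasc (2 * n) j.

Lemma wt_pos s n j : 0 < s -> 0 < wt s n j.
Proof. intros Hs. apply Rdiv_lt_0_compat; [now apply pow_lt|apply pasc_pos]. Qed.

Lemma wt_submult s : 0 < s -> submult (wt s).
Proof.
  intros Hs. split; [intros; left; now apply wt_pos|]. intros i j k l. unfold wt.
  replace (3 * (i + k) + (j + l))%nat with ((3 * i + j) + (3 * k + l))%nat by lia.
  replace (2 * (i + k))%nat with (2 * i + 2 * k)%nat by lia.
  assert (H1 := pasc_pos (2 * i) j). assert (H2 := pasc_pos (2 * k) l).
  assert (H3 := pasc_pos (2 * i + 2 * k) (j + l)).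
  assert (H4 := pasc_mul (2 * i) j (2 * k) l).
  assert (H5 : 0 < s ^ (3 * i + j)) by now apply pow_lt.
  assert (H6 : 0 < s ^ (3 * k + l)) by now apply pow_lt.
  rewrite pow_add.
  replace (s ^ (3 * i + j) / pasc (2 * i) j * (s ^ (3 * k + l) / pasc (2 * k) l))
    with (s ^ (3 * i + j) * s ^ (3 * k + l) / (pasc (2 * i) j * pasc (2 * k) l))
    by (field; lra).
  apply Rmult_le_compat_l; [left; now apply Rmult_lt_0_compat|].
  apply Rinv_le_contravar; [now apply Rmult_lt_0_compat|easy].
Qed.

Lemma pasc_ge_1 n j : 1 <= pasc n j.
Proof. rewrite <- (pasc_0_r 0). apply pasc_le; lia. Qed.

(** Operators on series with a parameter [e], [|e| <= 1], whose values have weighted order at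
    least [k], which gain [k] degrees, and whose norm is [O(s ^ k)]. *)
Definition ctrl (k : nat) (Psi : R -> fam -> fam) : Prop :=
  (forall e d g g', (forall n j, (3 * n + j < d)%nat -> g n j = g' n j) ->
     forall n j, (3 * n + j < d + k)%nat -> Psi e g n j = Psi e g' n j) /\
  (forall e g n j, (3 * n + j < k)%nat -> Psi e g n j = 0) /\
  (forall M, exists C s0, 0 <= C /\ 0 < s0 <= 1 /\ forall e s g, Rabs e <= 1 -> 0 < s <= s0 ->
     bnd g (wt s) M -> bnd (Psi e g) (wt s) (C * s ^ k)).

Lemma ctrl_add k F G : ctrl k F -> ctrl k G -> ctrl k (fun e g => padd (F e g) (G e g)).
Proof.
  intros (F1 & F2 & F3) (G1 & G2 & G3). split; [|split].
  - intros e d g g' H n j Hn. unfold padd. now rewrite (F1 e d g g'), (G1 e d g g').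
  - intros e g n j Hn. unfold padd. rewrite F2, G2 by easy. ring.
  - intros M. destruct (F3 M) as (C & s & HC & Hs & HF). destruct (G3 M) as (D & t & HD & Ht & HG).
    exists (C + D), (Rmin s t). assert (H1 := Rmin_l s t). assert (H2 := Rmin_r s t).
    split; [lra|]. split; [split; [apply Rmin_glb_lt; lra|lra]|].
    intros e q g He Hq Hg. rewrite Rmult_plus_distr_r.
    apply bnd_add; [apply HF|apply HG]; easy || lra.
Qed.

Lemma ctrl_scal k c F : ctrl k F -> ctrl k (fun e g => pscal c (F e g)).
Proof.
  intros (F1 & F2 & F3). split; [|split].
  - intros e d g g' H n j Hn. unfold pscal. now rewrite (F1 e d g g').
  - intros e g n j Hn. unfold pscal. rewrite F2 by easy. ring.
  - intros M. destruct (F3 M) as (C & s & HC & Hs & HF).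
    exists (Rabs c * C), s. split; [apply Rmult_le_pos; [apply Rabs_pos|easy]|].
    split; [easy|]. intros e q g He Hq Hg. rewrite Rmult_assoc. now apply bnd_scal, HF.
Qed.

Lemma ctrl_eps k F : ctrl k F -> ctrl k (fun e g => pscal e (F e g)).
Proof.
  intros (F1 & F2 & F3). split; [|split].
  - intros e d g g' H n j Hn. unfold pscal. now rewrite (F1 e d g g').
  - intros e g n j Hn. unfold pscal. rewrite F2 by easy. ring.
  - intros M. destruct (F3 M) as (C & s & HC & Hs & HF).
    exists C, s. split; [easy|]. split; [easy|].
    intros e q g He Hq Hg. eapply bnd_le; [apply bnd_scal, HF; easy|].
    rewrite <- (Rmult_1_l (C * q ^ k)) at 2. apply Rmult_le_compat_r; [|easy].
    apply Rmult_le_pos; [easy|apply pow_le; lra].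
Qed.

(** The orders are needed here: the product gains as many degrees as both factors together
    only because each factor starts at its own order. *)
Lemma ctrl_mul k l F G : ctrl k F -> ctrl l G -> ctrl (k + l) (fun e g => pmul (F e g) (G e g)).
Proof.
  intros (F1 & F2 & F3) (G1 & G2 & G3). split; [|split].
  - intros e d g g' H n m Hn. apply fsum_ext; intros i Hi. apply fsum_ext; intros j Hj.
    destruct (lt_dec (3 * i + j) (d + k)) as [H1|H1].
    + rewrite (F1 e d g g' H i j H1).
      destruct (lt_dec (3 * (n - i) + (m - j)) (d + l)) as [H2|H2].
      * now rewrite (G1 e d g g').
      * rewrite F2 by lia. ring.
    + rewrite !G2 by lia. ring.
  - intros e g n m Hn. apply fsum_0; intros i Hi. apply fsum_0; intros j Hj.
    destruct (lt_dec (3 * i + j) k) as [H1|H1]; [rewrite F2 by easy; ring|].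
    rewrite G2 by lia. ring.
  - intros M. destruct (F3 M) as (C & s & HC & Hs & HF). destruct (G3 M) as (D & t & HD & Ht & HG).
    exists (C * D), (Rmin s t). assert (H1 := Rmin_l s t). assert (H2 := Rmin_r s t).
    split; [now apply Rmult_le_pos|]. split; [split; [apply Rmin_glb_lt; lra|lra]|].
    intros e q g He Hq Hg.
    replace (C * D * q ^ (k + l)) with ((C * q ^ k) * (D * q ^ l)) by (rewrite pow_add; ring).
    apply bnd_mul; [apply wt_submult; lra|apply HF|apply HG]; easy || lra.
Qed.

Lemma ctrl_weaken k l F : (l <= k)%nat -> ctrl k F -> ctrl l F.
Proof.
  intros Hkl (F1 & F2 & F3). split; [|split].
  - intros e d g g' H n j Hn. apply (F1 e d g g' H). lia.
  - intros e g n j Hn. apply F2. lia.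
  - intros M. destruct (F3 M) as (C & s & HC & Hs & HF). exists C, s. split; [easy|].
    split; [easy|]. intros e q g He Hq Hg. eapply bnd_le; [apply HF; easy|].
    apply Rmult_le_compat_l; [easy|].
    replace k with (l + (k - l))%nat by lia. rewrite pow_add.
    rewrite <- (Rmult_1_r (q ^ l)) at 2. apply Rmult_le_compat_l; [apply pow_le; lra|].
    rewrite <- (pow1 (k - l)). apply pow_incr. lra.
Qed.

Lemma ctrl_mul_l F G : ctrl 1 F -> ctrl 0 G -> ctrl 1 (fun e g => pmul (F e g) (G e g)).
Proof. intros HF HG. apply (ctrl_mul 1 0 F G HF HG). Qed.

Lemma ctrl_mul_r F G : ctrl 0 F -> ctrl 1 G -> ctrl 1 (fun e g => pmul (F e g) (G e g)).
Proof. intros HF HG. apply (ctrl_mul 0 1 F G HF HG). Qed.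

Lemma ctrl_mul_0 F G : ctrl 0 F -> ctrl 0 G -> ctrl 0 (fun e g => pmul (F e g) (G e g)).
Proof. intros HF HG. apply (ctrl_mul 0 0 F G HF HG). Qed.

Lemma ctrl_const_ord k r c : 0 < r -> (k <= 1)%nat -> cvr r c -> ord k c -> ctrl k (fun _ _ => c).
Proof.
  intros Hr Hk Hc Ho. split; [easy|]. split.
  - intros e g n j Hn. apply Ho. lia.
  - intros M. destruct (cvr_ord k c r Hr Hc Ho) as (C & HC & H).
    exists C, (Rmin (r / 2) 1). assert (H1 := Rmin_l (r / 2) 1). assert (H2 := Rmin_r (r / 2) 1).
    split; [lra|]. split; [split; [apply Rmin_glb_lt; lra|easy]|].
    intros e s g He Hs _. apply bnd_weight with (monom s s); [|apply H; lra].
    intros n j. split; [left; apply wt_pos; lra|]. unfold wt, monom. rewrite <- pow_add.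
    apply Rle_trans with (s ^ (3 * n + j)).
    + rewrite <- (Rmult_1_r (s ^ (3 * n + j))) at 2. apply Rmult_le_compat_l; [apply pow_le; lra|].
      rewrite <- Rinv_1. apply Rinv_le_contravar; [lra|apply pasc_ge_1].
    + replace (3 * n + j)%nat with ((n + j) + 2 * n)%nat by lia. rewrite pow_add.
      rewrite <- (Rmult_1_r (s ^ (n + j))) at 2. apply Rmult_le_compat_l; [apply pow_le; lra|].
      rewrite <- (pow1 (2 * n)). apply pow_incr. lra.
Qed.

Lemma ctrl_const r c : 0 < r -> cvr r c -> ctrl 0 (fun _ _ => c).
Proof. intros. apply ctrl_const_ord with r; try easy; lia. Qed.

Lemma ctrl_const_small r c : 0 < r -> cvr r c -> c O O = 0 -> ctrl 1 (fun _ _ => c).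
Proof. intros. apply ctrl_const_ord with r; try easy. now apply ord1_iff. Qed.

(** * The operators of the indicial inversion *)

(** With [u = x^5 + x^6 w], the function [g] below is [(E + 6) (E + 1) w], [E = x d/dx]; the
    derivatives of [u] are [u_x = x^4 (5 + x th1)], [u_xx = x^3 (20 + x th2)], [u_xy = x^4 mxy],
    [u_yy = x^5 myy] and [u_y = x^5 my]. *)
Definition op_w (g : fam) : fam := fun n j => / ((INR n + 6) * (INR n + 1)) * g n j.
Definition op_th1 (g : fam) : fam := fun n j => / (INR n + 1) * g n j.
Definition op_th2 (g : fam) : fam := fun n j => (INR n + 5) / (INR n + 1) * g n j.
Definition op_mxy (g : fam) : fam := fun n j => match n with
  | O => 0
  | S k => (INR j + 1) / (INR k + 1) * g k (j + 1)%nat end.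
Definition op_my (g : fam) : fam := fun n j => match n with
  | O => 0
  | S k => (INR j + 1) / ((INR k + 6) * (INR k + 1)) * g k (j + 1)%nat end.
Definition op_myy (g : fam) : fam := fun n j => match n with
  | O => 0
  | S k => (INR j + 2) * (INR j + 1) / ((INR k + 6) * (INR k + 1)) * g k (j + 2)%nat end.

Lemma ctrl_diagonal (c : nat -> R) K :
  (forall n, Rabs (c n) <= K) -> ctrl 0 (fun _ g n j => c n * g n j).
Proof.
  intros Hc. assert (HK : 0 <= K) by (eapply Rle_trans; [apply Rabs_pos|apply (Hc O)]).
  split; [|split].
  - intros e d g g' H n j Hn. rewrite H by lia. easy.
  - intros; lia.
  - intros M. exists (K * Rabs M), 1. split; [apply Rmult_le_pos; [easy|apply Rabs_pos]|].
    split; [lra|]. intros e s g _ Hs Hg. simpl. rewrite Rmult_1_r.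
    assert (HM := bnd_nonneg _ _ _ Hg). rewrite (Rabs_pos_eq M) by easy.
    assert (H := abs_bound_scal K _ _ Hg). rewrite (Rabs_pos_eq K) in H by easy.
    eapply abs_bound_le; [|apply H]. intros n j. rewrite !Rabs_mult, (Rabs_pos_eq K) by easy.
    rewrite Rmult_assoc. apply Rmult_le_compat_r; [|apply Hc].
    apply Rmult_le_pos; apply Rabs_pos.
Qed.

Lemma ctrl_w : ctrl 0 (fun _ g => op_w g).
Proof.
  apply (ctrl_diagonal (fun n => / ((INR n + 6) * (INR n + 1))) 1). intros n.
  assert (Hn := pos_INR n).
  rewrite Rabs_pos_eq by (left; apply Rinv_0_lt_compat; nra).
  rewrite <- Rinv_1. apply Rinv_le_contravar; nra.
Qed.

Lemma ctrl_th1 : ctrl 0 (fun _ g => op_th1 g).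
Proof.
  apply (ctrl_diagonal (fun n => / (INR n + 1)) 1). intros n. assert (Hn := pos_INR n).
  rewrite Rabs_pos_eq by (left; apply Rinv_0_lt_compat; lra).
  rewrite <- Rinv_1. apply Rinv_le_contravar; lra.
Qed.

Lemma ctrl_th2 : ctrl 0 (fun _ g => op_th2 g).
Proof.
  apply (ctrl_diagonal (fun n => (INR n + 5) / (INR n + 1)) 5). intros n.
  assert (Hn := pos_INR n).
  rewrite Rabs_pos_eq by (apply Rdiv_le_0_compat; lra).
  apply Rmult_le_reg_r with (INR n + 1); [lra|].
  unfold Rdiv. rewrite Rmult_assoc, Rinv_l by lra. lra.
Qed.

(** Terms [x d^p/dy^p] with [p <= 2], composed with an inverse in the degree of [x]: the loss of
    [p] units of [j] and the gain of two units of [2 n] change the weight by a ratio of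
    binomial coefficients that the multiplier must compensate. *)
Lemma ctrl_shift (c : nat -> nat -> R) p K : (p <= 2)%nat -> 0 <= K ->
  (forall n j, Rabs (c n j) * pasc (2 * n) (j + p) <= K * pasc (2 * S n) j) ->
  ctrl 1 (fun _ g n j => match n with O => 0 | S k => c k j * g k (j + p)%nat end).
Proof.
  intros Hp HK Hc. split; [|split].
  - intros e d g g' H [|n] j Hn; [easy|]. rewrite H by lia. easy.
  - intros e g [|n] j Hn; [easy|lia].
  - intros M. exists (K * Rabs M), 1. split; [apply Rmult_le_pos; [easy|apply Rabs_pos]|].
    split; [lra|]. intros e s g _ Hs Hg.
    assert (HM := bnd_nonneg _ _ _ Hg). rewrite (Rabs_pos_eq M), pow_1 by easy.
    assert (Hsh : forall c M, abs_bound c M -> abs_bound (fun n j => c n (j + p)%nat) M).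
    { intros c' M' H'. apply (abs_bound_transpose (fun j n => c' n (j + p)%nat)).
      apply (abs_bound_shifts p (fun j n => c' n j)). now apply (abs_bound_transpose c'). }
    apply Hsh in Hg. assert (H := abs_bound_scal (K * s) _ _ Hg).
    rewrite Rabs_pos_eq in H by (apply Rmult_le_pos; lra).
    replace (K * M * s) with (K * s * M) by ring.
    intros D. eapply Rle_trans; [|apply (H D)].
    unfold bsum. destruct D as [|D]; [simpl; lra|].
    change (S D) with (1 + D)%nat at 1. rewrite fsum_split.
    rewrite (fsum_0 1), Rplus_0_l.
    2:{ intros i Hi. replace i with O by lia. apply fsum_0; intros.
        rewrite Rmult_0_l; apply Rabs_R0. }
    apply Rle_trans with (fsum D (fun i => fsum (S D) (fun j =>
      Rabs (K * s * (g i (j + p)%nat * wt s i (j + p)%nat)))));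
      [|apply fsum_mono; [lia|intros; apply fsum_nonneg; intros; apply Rabs_pos]].
    apply fsum_le; intros i _. apply fsum_le; intros j _. simpl (1 + i)%nat. cbv iota beta.
    rewrite !Rabs_mult, (Rabs_pos_eq K), (Rabs_pos_eq s) by lra.
    rewrite !(Rabs_pos_eq (wt s _ _)) by (left; apply wt_pos; lra).
    apply Rle_trans with (Rabs (g i (j + p)%nat) * (Rabs (c i j) * wt s (S i) j));
      [apply Req_le; ring|].
    apply Rle_trans with (Rabs (g i (j + p)%nat) * (K * s * wt s i (j + p)%nat));
      [|apply Req_le; ring].
    apply Rmult_le_compat_l; [apply Rabs_pos|]. unfold wt.
    assert (P1 := pasc_pos (2 * S i) j). assert (P2 := pasc_pos (2 * i) (j + p)).
    assert (Hpw : s ^ (3 * S i + j) <= s * s ^ (3 * i + (j + p))).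
    { replace (3 * S i + j)%nat with (S (3 * i + (j + p)) + (2 - p))%nat by lia.
      rewrite pow_add. change (s ^ S (3 * i + (j + p))) with (s * s ^ (3 * i + (j + p))).
      assert (0 < s ^ (3 * i + (j + p))) by (apply pow_lt; lra).
      assert (s ^ (2 - p) <= 1) by (rewrite <- (pow1 (2 - p)); apply pow_incr; lra).
      assert (0 < s * s ^ (3 * i + (j + p))) by (apply Rmult_lt_0_compat; lra).
      nra. }
    apply Rle_trans with (Rabs (c i j) * (s * s ^ (3 * i + (j + p)) / pasc (2 * S i) j)).
    { apply Rmult_le_compat_l; [apply Rabs_pos|]. apply Rmult_le_compat_r; [|easy].
      left; now apply Rinv_0_lt_compat. }
    apply Rmult_le_reg_r with (pasc (2 * S i) j * pasc (2 * i) (j + p));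
      [now apply Rmult_lt_0_compat|].
    assert (0 < s * s ^ (3 * i + (j + p))) by (apply Rmult_lt_0_compat; [lra|apply pow_lt; lra]).
    apply Rle_trans with (s * s ^ (3 * i + (j + p)) * (Rabs (c i j) * pasc (2 * i) (j + p)));
      [apply Req_le; field; lra|].
    apply Rle_trans with (s * s ^ (3 * i + (j + p)) * (K * pasc (2 * S i) j));
      [|apply Req_le; field; lra].
    apply Rmult_le_compat_l; [lra|apply Hc].
Qed.

Lemma pasc_swap2 n j : (INR j + 2) * (INR j + 1) * pasc (2 * n) (S (S j)) =
  (2 * INR n + 2) * (2 * INR n + 1) * pasc (2 * S n) j.
Proof.
  assert (H1 := pasc_swap (2 * n) (S j)). assert (H2 := pasc_swap (S (2 * n)) j).
  replace (2 * S n)%nat with (S (S (2 * n))) by lia.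
  rewrite S_INR in H1. rewrite S_INR, mult_INR in H2. rewrite mult_INR in H1.
  change (INR 2) with 2 in *.
  replace ((INR j + 2) * (INR j + 1) * pasc (2 * n) (S (S j)))
    with ((INR j + 1) * ((INR j + 1 + 1) * pasc (2 * n) (S (S j)))) by ring.
  rewrite <- H1.
  replace ((INR j + 1) * ((2 * INR n + 1) * pasc (S (2 * n)) (S j)))
    with ((2 * INR n + 1) * ((INR j + 1) * pasc (S (2 * n)) (S j))) by ring.
  rewrite <- H2. ring.
Qed.

Lemma pasc_swap1 n j : (INR j + 1) * pasc (2 * n) (S j) <= (2 * INR n + 1) * pasc (2 * S n) j.
Proof.
  rewrite <- pasc_swap, mult_INR. change (INR 2) with 2.
  apply Rmult_le_compat_l; [generalize (pos_INR n); lra|]. apply pasc_le; lia.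
Qed.

Lemma ctrl_mxy : ctrl 1 (fun _ g => op_mxy g).
Proof.
  apply (ctrl_shift (fun n j => (INR j + 1) / (INR n + 1)) 1 2); [lia|lra|].
  intros n j. assert (Hn := pos_INR n). assert (Hj := pos_INR j).
  rewrite Rabs_pos_eq by (apply Rdiv_le_0_compat; lra).
  replace (j + 1)%nat with (S j) by lia. assert (H := pasc_swap1 n j).
  assert (Hp := pasc_pos (2 * S n) j).
  apply Rmult_le_reg_l with (INR n + 1); [lra|].
  apply Rle_trans with ((INR j + 1) * pasc (2 * n) (S j)); [apply Req_le; field; lra|].
  nra.
Qed.

Lemma ctrl_my : ctrl 1 (fun _ g => op_my g).
Proof.
  apply (ctrl_shift (fun n j => (INR j + 1) / ((INR n + 6) * (INR n + 1))) 1 2); [lia|lra|].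
  intros n j. assert (Hn := pos_INR n). assert (Hj := pos_INR j).
  assert (Hd : 0 < (INR n + 6) * (INR n + 1)) by nra.
  rewrite Rabs_pos_eq by (apply Rdiv_le_0_compat; lra).
  replace (j + 1)%nat with (S j) by lia. assert (H := pasc_swap1 n j).
  assert (Hp := pasc_pos (2 * S n) j).
  apply Rmult_le_reg_l with ((INR n + 6) * (INR n + 1)); [easy|].
  apply Rle_trans with ((INR j + 1) * pasc (2 * n) (S j)); [apply Req_le; field; lra|].
  nra.
Qed.

Lemma ctrl_myy : ctrl 1 (fun _ g => op_myy g).
Proof.
  apply (ctrl_shift (fun n j => (INR j + 2) * (INR j + 1) / ((INR n + 6) * (INR n + 1))) 2 4);
    [lia|lra|].
  intros n j. assert (Hn := pos_INR n). assert (Hj := pos_INR j).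
  assert (Hd : 0 < (INR n + 6) * (INR n + 1)) by nra.
  rewrite Rabs_pos_eq by (apply Rdiv_le_0_compat; nra).
  replace (j + 2)%nat with (S (S j)) by lia. assert (H := pasc_swap2 n j).
  assert (Hp := pasc_pos (2 * S n) j).
  apply Rmult_le_reg_l with ((INR n + 6) * (INR n + 1)); [easy|].
  apply Rle_trans with ((INR j + 2) * (INR j + 1) * pasc (2 * n) (S (S j)));
    [apply Req_le; field; lra|].
  rewrite H. nra.
Qed.

(** Causality yields a formal solution; for small [s] the ball of radius [M0 + 1] is preserved,
    where [M0] bounds the source, and so the solution converges, uniformly in [e]. *)
Theorem ctrl_fixpoint r c Psi : 0 < r -> cvr r c -> ctrl 1 Psi ->
  exists s M, 0 < s <= 1 /\ forall e, Rabs e <= 1 ->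
    exists g, bnd g (wt s) M /\ g = padd c (Psi e g).
Proof.
  intros Hr Hc HPsi.
  destruct (ctrl_const r c Hr Hc) as (_ & _ & H3). destruct (H3 0) as (M0 & s1 & HM0 & Hs1 & Hc0).
  destruct HPsi as (P1 & P2 & P3). destruct (P3 (M0 + 1)) as (C & s2 & HC & Hs2 & HP).
  set (s := Rmin (Rmin s1 s2) (/ (C + 1))).
  assert (Hi : 0 < / (C + 1)) by (apply Rinv_0_lt_compat; lra).
  assert (Hs : 0 < s) by (repeat apply Rmin_glb_lt; lra).
  assert (S1 : s <= s1) by (eapply Rle_trans; [apply Rmin_l|apply Rmin_l]).
  assert (S2 : s <= s2) by (eapply Rle_trans; [apply Rmin_l|apply Rmin_r]).
  assert (S3 : C * s <= 1).
  { assert (Hsi : s <= / (C + 1)) by apply Rmin_r.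
    apply Rle_trans with ((C + 1) * / (C + 1)); [|rewrite Rinv_r; lra].
    apply Rmult_le_compat; lra. }
  exists s, (M0 + 1). split; [lra|]. intros e He.
  set (unc := fun (f : nat * nat -> R) n j => f (n, j)).
  destruct (causal_fixpoint (nat * nat) (fun i => (3 * fst i + snd i)%nat)
    (fun f i => padd c (Psi e (unc f)) (fst i) (snd i))) as [f [Hf HfP]].
  { intros d f g Hfg [n j] Hi'. simpl in Hi'. simpl fst; simpl snd. unfold padd. f_equal.
    apply (P1 e d); [|lia]. intros n' j' H'. now apply Hfg. }
  exists (unc f). split.
  - apply bnd_limit. intros d.
    destruct (HfP (fun f => bnd (unc f) (wt s) (M0 + 1))) with (d := (3 * d)%nat) as [g [Hg Ha]].
    + intros D. apply Rle_trans with 0; [|lra]. apply Req_le.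
      apply fsum_0; intros. apply fsum_0; intros. unfold unc. rewrite Rmult_0_l; apply Rabs_R0.
    + intros g Hg.
      assert (H1 : bnd c (wt s) M0).
      { rewrite <- (Rmult_1_r M0). change 1 with (s ^ 0).
        apply (Hc0 0 s (fun _ _ => 0)); [rewrite Rabs_R0; lra|lra|].
        intros D. apply Req_le. apply fsum_0; intros. apply fsum_0; intros.
        rewrite Rmult_0_l; apply Rabs_R0. }
      assert (H2 : bnd (Psi e (unc g)) (wt s) (C * s ^ 1)) by (apply HP; easy || lra).
      rewrite pow_1 in H2. eapply bnd_le; [apply (bnd_add _ _ _ _ _ H1 H2)|lra].
    + exists (unc g). split; [easy|]. intros n j Hnj. apply Ha. simpl. lia.
  - apply fam_ext; intros n j. symmetry. apply (Hf (n, j)).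
Qed.

Lemma pasc_bound n j : pasc n j <= 2 ^ (n + j).
Proof.
  assert (H := pasc_binomial 1 1 n j ltac:(lra) ltac:(lra)).
  rewrite !pow1 in H. replace (1 + 1) with 2 in H by ring. lra.
Qed.

Lemma cvr_wt s g M : 0 < s <= 1 -> bnd g (wt s) M -> cvr (s ^ 3 / 4) g.
Proof.
  intros Hs Hg. assert (Hs3 : 0 < s ^ 3) by (apply pow_lt; lra).
  apply cvr_bnd with M; [lra|]. apply bnd_weight with (2 := Hg).
  intros n j. unfold monom, wt. rewrite <- pow_add.
  split; [apply pow_le; lra|].
  assert (Hp := pasc_pos (2 * n) j). assert (Hb := pasc_bound (2 * n) j).
  apply Rmult_le_reg_r with (pasc (2 * n) j); [easy|].
  unfold Rdiv at 2. rewrite Rmult_assoc, Rinv_l, Rmult_1_r by lra.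
  apply Rle_trans with ((s ^ 3 / 4) ^ (n + j) * 2 ^ (2 * n + j)).
  { apply Rmult_le_compat_l; [apply pow_le; lra|easy]. }
  apply Rle_trans with ((s ^ 3 / 4) ^ (n + j) * 4 ^ (n + j)).
  { apply Rmult_le_compat_l; [apply pow_le; lra|].
    replace 4 with (2 ^ 2) by ring. rewrite <- pow_mult. apply Rle_pow; [lra|lia]. }
  rewrite <- Rpow_mult_distr. replace (s ^ 3 / 4 * 4) with (s ^ 3) by field.
  rewrite <- pow_mult. replace (3 * (n + j))%nat with ((3 * n + j) + 2 * j)%nat by lia.
  rewrite pow_add. rewrite <- (Rmult_1_r (s ^ (3 * n + j))) at 2.
  apply Rmult_le_compat_l; [apply pow_le; lra|].
  rewrite <- (pow1 (2 * j)). apply pow_incr. lra.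
Qed.

(** * Choice of the gauge *)

Definition minor (p q r s : fam) : fam := psub (pmul p q) (pmul r s).

Definition pdet (a1 a2 a3 b1 b2 b3 c1 c2 c3 : fam) : fam :=
  padd (psub (pmul a1 (minor b2 c3 b3 c2)) (pmul a2 (minor b1 c3 b3 c1)))
    (pmul a3 (minor b1 c2 b2 c1)).

Definition qx (b : fam) : fam := pscal 2 (dxy 1 0 b).
Definition qm (a b : fam) : fam := psub (dxy 0 1 b) (dxy 1 0 a).
Definition qy (a : fam) : fam := pscal (-2) (dxy 0 1 a).

Lemma cvr_minor r p q u s : cvr r p -> cvr r q -> cvr r u -> cvr r s -> cvr r (minor p q u s).
Proof. intros. unfold minor, psub. cvr_tac. Qed.

Lemma cvr_psub r p q : cvr r p -> cvr r q -> cvr r (psub p q).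
Proof. intros. unfold psub. cvr_tac. Qed.

Lemma cvr_pdet r a1 a2 a3 b1 b2 b3 c1 c2 c3 :
  cvr r a1 -> cvr r a2 -> cvr r a3 -> cvr r b1 -> cvr r b2 -> cvr r b3 ->
  cvr r c1 -> cvr r c2 -> cvr r c3 -> cvr r (pdet a1 a2 a3 b1 b2 b3 c1 c2 c3).
Proof.
  intros. unfold pdet, psub. cvr_tac; apply cvr_minor; easy.
Qed.

Lemma eva_sub r a b x y : cvr r a -> cvr r b -> Rabs x < r -> Rabs y < r ->
  ev (psub a b) x y = ev a x y - ev b x y.
Proof.
  intros. unfold psub. rewrite (eva_add r), ev_scal by (easy || now apply cvr_scal). ring.
Qed.

Lemma eva_minor r p q u s x y : cvr r p -> cvr r q -> cvr r u -> cvr r s ->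
  Rabs x < r -> Rabs y < r ->
  ev (minor p q u s) x y = ev p x y * ev q x y - ev u x y * ev s x y.
Proof.
  intros. unfold minor. rewrite (eva_sub r), !(eva_mul r) by (easy || now apply cvr_mul). ring.
Qed.

Lemma eva_pdet r a1 a2 a3 b1 b2 b3 c1 c2 c3 x y :
  cvr r a1 -> cvr r a2 -> cvr r a3 -> cvr r b1 -> cvr r b2 -> cvr r b3 ->
  cvr r c1 -> cvr r c2 -> cvr r c3 -> Rabs x < r -> Rabs y < r ->
  ev (pdet a1 a2 a3 b1 b2 b3 c1 c2 c3) x y =
  det3 (ev a1 x y) (ev a2 x y) (ev a3 x y) (ev b1 x y) (ev b2 x y) (ev b3 x y)
    (ev c1 x y) (ev c2 x y) (ev c3 x y).
Proof.
  intros. unfold pdet, det3.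
  assert (forall p q u s, cvr r p -> cvr r q -> cvr r u -> cvr r s -> cvr r (minor p q u s))
    by (intros; now apply cvr_minor).
  rewrite (eva_add r), (eva_sub r), !(eva_mul r), !(eva_minor r)
    by (easy || (unfold psub; cvr_tac; auto)). ring.
Qed.

Lemma ev_row0 a x y : ev (row0 a) x y = ev a 0 y.
Proof.
  unfold ev. f_equal. apply fam_ext; intros i j. unfold row0, monom.
  destruct i as [|i]; simpl; ring.
Qed.

Lemma ev_divx r a x y : cvr r a -> Rabs x < r -> Rabs y < r ->
  ev a x y = ev a 0 y + x * ev (divx a) x y.
Proof.
  intros Ha Hx Hy. assert (H1 := cvr_divx r a Ha). assert (H2 := cvr_row0 r a Ha).
  rewrite (row0_divx a) at 1.
  rewrite (eva_add r), (eva_mul r), ev_px, ev_row0; try easy; cvr_tac.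
Qed.

Lemma ev_divy_axis r a y : cvr r a -> a O O = 0 -> Rabs y < r ->
  ev a 0 y = y * ev (divy a) 0 y.
Proof.
  intros Ha Ha0 Hy.
  assert (Hr : Rabs 0 < r) by (rewrite Rabs_R0; generalize (Rabs_pos y); lra).
  unfold divy. rewrite <- (ev_transpose a 0 y), (ev_transpose (divx (transpose a)) y 0).
  rewrite (ev_divx r (transpose a) y 0) at 1 by (easy || now apply cvr_transpose).
  rewrite ev_0. unfold transpose at 1. rewrite Ha0. ring.
Qed.

Lemma Wser_det r a b x y : cvr r a -> cvr r b -> Rabs x < r -> Rabs y < r ->
  ev (Wser a b) x y =
  det3 (ev (qx b) x y) (ev (qm a b) x y) (ev (qy a) x y)
    (ev (dxy 2 0 a) x y) (ev (dxy 1 1 a) x y) (ev (dxy 0 2 a) x y)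
    (ev (dxy 2 0 b) x y) (ev (dxy 1 1 b) x y) (ev (dxy 0 2 b) x y).
Proof.
  intros Ha Hb Hx Hy.
  assert (H1 : forall i j, cvr r (dxy i j a)) by (intros; now apply cvr_dxy).
  assert (H2 : forall i j, cvr r (dxy i j b)) by (intros; now apply cvr_dxy).
  unfold Wser, qx, qm, qy, det3.
  rewrite !(eva_add r), !(eva_sub r), !(eva_mul r), !(eva_sub r), !(eva_mul r), !ev_scal
    by (easy || (unfold psub; cvr_tac; auto)). ring.
Qed.

Definition free_of_x (a : fam) : Prop := forall i j, i <> O -> a i j = 0.

Lemma free_row0 a : free_of_x (row0 a).
Proof. intros i j Hi. unfold row0. destruct (Nat.eq_dec i 0); easy. Qed.

(** The cross product of [Q] and [R1 - mu R2], for the rows of the determinant W. *)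
Definition cross1 (a b mu : fam) : fam :=
  minor (qm a b) (psub (dxy 0 2 a) (pmul mu (dxy 0 2 b)))
    (qy a) (psub (dxy 1 1 a) (pmul mu (dxy 1 1 b))).
Definition cross2 (a b mu : fam) : fam :=
  minor (qy a) (psub (dxy 2 0 a) (pmul mu (dxy 2 0 b)))
    (qx b) (psub (dxy 0 2 a) (pmul mu (dxy 0 2 b))).
Definition cross3 (a b mu : fam) : fam :=
  minor (qx b) (psub (dxy 1 1 a) (pmul mu (dxy 1 1 b)))
    (qm a b) (psub (dxy 2 0 a) (pmul mu (dxy 2 0 b))).

(** The coefficient of [x^4] in the linearization of W at the perturbation whose leading
    terms are [x^5] in the second component and [mu x^5 + phi x^6] in the first. *)
Definition leading_defect (a b mu phi : fam) : fam :=
  padd (pscal 20 (divx (cross1 a b mu)))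
    (padd (pdet (pconst 10) (pscal (-5) mu) pzero
        (dxy 2 0 a) (dxy 1 1 a) (dxy 0 2 a) (dxy 2 0 b) (dxy 1 1 b) (dxy 0 2 b))
      (pdet (qx b) (qm a b) (qy a) (pscal 30 phi) (pscal 5 (dy mu)) pzero
        (dxy 2 0 b) (dxy 1 1 b) (dxy 0 2 b))).

(** The singular curve of the linearized equation is straightened to [x = 0] by moving the first
    component along with the second, with ratio [mu y]; since [W = 0] makes [Q] a combination of the
    Hessians, cancelling one component of the cross product on [x = 0] cancels all three. At the
    resonant order [x^5] the first component is used again, through [phi], to remove the
    obstruction. Both [mu] and [phi] are quotients by a function of [y] with a simple zero. *)
Lemma gauge_exists r P a b : 0 < r -> cvr r a -> cvr r b -> normal_2jet P a b ->
  Wser a b = pzero ->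
  exists t mu phi, 0 < t <= r /\ cvr t mu /\ cvr t phi /\ mu O O = 0 /\
    free_of_x mu /\ free_of_x phi /\ divx (cross1 a b mu) O O = 2 * P ^ 2 /\
    forall y, Rabs y < t ->
      ev (cross1 a b mu) 0 y = 0 /\ ev (cross2 a b mu) 0 y = 0 /\
      ev (cross3 a b mu) 0 y = 0 /\ ev (leading_defect a b mu phi) 0 y = 0.
Proof.
  intros Hr Ha Hb Hn HW.
  assert (H1 : forall s, 0 < s <= r -> forall i j, cvr s (dxy i j a)).
  { intros s Hs i j. apply cvr_shrink with r; [lra|]. now apply cvr_dxy. }
  assert (H2 : forall s, 0 < s <= r -> forall i j, cvr s (dxy i j b)).
  { intros s Hs i j. apply cvr_shrink with r; [lra|]. now apply cvr_dxy. }
  assert (Hq1 : forall s, 0 < s <= r -> cvr s (qx b)) by (intros; apply cvr_scal, H2; easy).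
  assert (Hq2 : forall s, 0 < s <= r -> cvr s (qm a b)).
  { intros; apply cvr_psub; [apply H2|apply H1]; easy. }
  assert (Hq3 : forall s, 0 < s <= r -> cvr s (qy a)) by (intros; apply cvr_scal, H1; easy).
  set (D0 := minor (qm a b) (dxy 0 2 b) (qy a) (dxy 1 1 b)).
  set (N0 := minor (qm a b) (dxy 0 2 a) (qy a) (dxy 1 1 a)).
  set (E3 := minor (dxy 1 1 a) (dxy 0 2 b) (dxy 0 2 a) (dxy 1 1 b)).
  assert (Hrr : 0 < r <= r) by lra.
  assert (HD0 : cvr r D0) by (apply cvr_minor; auto).
  assert (HN0 : cvr r N0) by (apply cvr_minor; auto).
  assert (HE3 : cvr r E3) by (apply cvr_minor; auto).
  assert (HP : P <> 0) by apply Hn.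
  assert (HP2 : 0 < P ^ 2) by (apply pow2_gt_0; easy).
  set (kap := 20 * P ^ 2). assert (Hkap : 0 < kap) by (unfold kap; lra).
  pose proof Hn as (_ & a00 & b00 & b01 & a01 & b10 & a20 & a02 & b11 & b20 & a11 & b02).
  assert (D00 : D0 O O = 0).
  { unfold D0, minor, qm, qy. coef. rewrite ?b01, ?a01. ring. }
  assert (D01 : D0 0%nat 1%nat = kap).
  { unfold D0, minor, qm, qy. coef. rewrite ?b01, ?a01, ?a02, ?a11, ?b02, ?b11. unfold kap. ring. }
  assert (N00 : N0 O O = 0).
  { unfold N0, minor, qm, qy. coef. rewrite ?b01, ?a01. ring. }
  assert (N01 : N0 0%nat 1%nat = 0).
  { unfold N0, minor, qm, qy. coef. rewrite ?b01, ?a01, ?a02, ?a11, ?b02, ?b11. ring. }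
  assert (E30 : E3 O O = -4 * P ^ 2).
  { unfold E3, minor. coef. rewrite ?a02, ?a11, ?b02, ?b11. ring. }
  set (V := padd (pscal (/ kap) (divy D0)) (pconst (-1))).
  assert (HdD : cvr r (divy D0)) by now apply cvr_divy.
  assert (HdN : cvr r (divy N0)) by now apply cvr_divy.
  assert (HV : cvr r V) by (unfold V; cvr_tac).
  assert (HV0 : V O O = 0).
  { unfold V, padd, pscal, divy, transpose, divx. rewrite D01. unfold pconst, single; simpl.
    field. lra. }
  destruct (unit_inverse r V Hr HV HV0) as (s & K & Hs & HK & HVK).
  destruct (ev_continuous r E3 0 0 (P ^ 2)) as (d & Hd & Hcont); try easy;
    try (rewrite Rabs_R0; easy).
  set (t := Rmin s d).
  assert (Ht1 : t <= s) by apply Rmin_l. assert (Ht2 : t <= d) by apply Rmin_r.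
  assert (Ht : 0 < t) by (apply Rmin_glb_lt; lra).
  assert (Htr : 0 < t <= r) by lra.
  assert (HKt : cvr t K) by (apply cvr_shrink with s; lra || easy).
  assert (Hz : Rabs 0 < t) by (rewrite Rabs_R0; easy).
  assert (HDK : forall y, Rabs y < t -> ev (divy D0) 0 y * ev K 0 y = kap).
  { intros y Hy. specialize (HVK 0 y ltac:(lra) ltac:(lra)). unfold V in HVK.
    rewrite (eva_add r), ev_scal, ev_const in HVK by (cvr_tac || lra).
    replace kap with (kap * 1) by ring. rewrite <- HVK. field. lra. }
  set (mu := row0 (pscal (/ kap) (pmul (divy N0) K))).
  assert (HdNt : cvr t (divy N0)) by (apply cvr_shrink with r; lra || easy).
  assert (Hmu : cvr t mu) by (apply cvr_row0; cvr_tac).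
  assert (Hmu0 : mu O O = 0).
  { unfold mu, row0, pscal, pmul, divy, transpose, divx. simpl. rewrite N01. ring. }
  assert (Hmuv : forall x y, Rabs y < t ->
    ev mu x y = / kap * (ev (divy N0) 0 y * ev K 0 y)).
  { intros x y Hy. unfold mu. rewrite ev_row0, ev_scal, (eva_mul t) by easy. easy. }
  assert (HT : forall i j, cvr t (psub (dxy i j a) (pmul mu (dxy i j b)))).
  { intros i j. apply cvr_psub; [auto|]. apply cvr_mul; auto. }
  assert (HX1 : cvr t (cross1 a b mu)) by (apply cvr_minor; auto).
  assert (HevT : forall i j x y, Rabs x < t -> Rabs y < t ->
    ev (psub (dxy i j a) (pmul mu (dxy i j b))) x y =
    ev (dxy i j a) x y - ev mu x y * ev (dxy i j b) x y).
  { intros i j x y Hx Hy. rewrite (eva_sub t), (eva_mul t); auto. apply cvr_mul; auto. }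
  assert (Hc1 : forall y, Rabs y < t -> ev (cross1 a b mu) 0 y = 0).
  { intros y Hy. unfold cross1. rewrite (eva_minor t), !HevT, Hmuv by auto.
    assert (F1 : ev D0 0 y = y * ev (divy D0) 0 y) by (apply (ev_divy_axis r); lra || easy).
    assert (F2 : ev N0 0 y = y * ev (divy N0) 0 y) by (apply (ev_divy_axis r); lra || easy).
    unfold D0 in F1 at 1. unfold N0 in F2 at 1.
    rewrite (eva_minor t) in F1, F2 by auto.
    specialize (HDK y Hy).
    transitivity (y * ev (divy N0) 0 y - / kap * (ev (divy N0) 0 y * ev K 0 y) * (y * ev (divy D0) 0 y)).
    - rewrite <- F1, <- F2. ring.
    - replace (/ kap * (ev (divy N0) 0 y * ev K 0 y) * (y * ev (divy D0) 0 y))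
        with (/ kap * y * ev (divy N0) 0 y * (ev (divy D0) 0 y * ev K 0 y)) by ring.
      rewrite HDK. field. lra. }
  assert (Hc23 : forall y, Rabs y < t -> ev (cross2 a b mu) 0 y = 0 /\ ev (cross3 a b mu) 0 y = 0).
  { intros y Hy. specialize (Hc1 y Hy). unfold cross1 in Hc1. unfold cross2, cross3.
    rewrite (eva_minor t), !HevT in Hc1 by auto.
    rewrite !(eva_minor t), !HevT by auto.
    assert (HW0 : ev (Wser a b) 0 y = 0).
    { rewrite HW. apply ev_const. }
    rewrite (Wser_det r) in HW0 by (easy || lra).
    destruct (Hcont 0 y) as (_ & _ & Hce); [rewrite Rminus_diag, Rabs_R0; easy|
      rewrite Rminus_0_r; lra|].
    rewrite ev_0, E30 in Hce. apply Rabs_def2 in Hce.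
    unfold E3 in Hce. rewrite (eva_minor t) in Hce by auto.
    set (A1 := ev (dxy 2 0 a) 0 y) in *. set (A2 := ev (dxy 1 1 a) 0 y) in *.
    set (A3 := ev (dxy 0 2 a) 0 y) in *. set (B1 := ev (dxy 2 0 b) 0 y) in *.
    set (B2 := ev (dxy 1 1 b) 0 y) in *. set (B3 := ev (dxy 0 2 b) 0 y) in *.
    set (q1 := ev (qx b) 0 y) in *. set (q2 := ev (qm a b) 0 y) in *.
    set (q3 := ev (qy a) 0 y) in *. set (m := ev mu 0 y) in *.
    assert (Hne : A2 * B3 - A3 * B2 <> 0) by lra.
    set (v1 := q2 * (A3 - m * B3) - q3 * (A2 - m * B2)) in *.
    set (v2 := q3 * (A1 - m * B1) - q1 * (A3 - m * B3)).
    set (v3 := q1 * (A2 - m * B2) - q2 * (A1 - m * B1)).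
    assert (G1 : v1 * A1 + v2 * A2 + v3 * A3 = m * det3 q1 q2 q3 A1 A2 A3 B1 B2 B3)
      by (unfold v1, v2, v3, det3; ring).
    assert (G2 : v1 * B1 + v2 * B2 + v3 * B3 = det3 q1 q2 q3 A1 A2 A3 B1 B2 B3)
      by (unfold v1, v2, v3, det3; ring).
    rewrite Hc1, HW0 in G1, G2.
    split; apply Rmult_eq_reg_r with (A2 * B3 - A3 * B2); try easy; rewrite Rmult_0_l.
    - transitivity (B3 * (0 * A1 + v2 * A2 + v3 * A3) - A3 * (0 * B1 + v2 * B2 + v3 * B3)); [ring|].
      rewrite G1, G2. ring.
    - transitivity (A2 * (0 * B1 + v2 * B2 + v3 * B3) - B2 * (0 * A1 + v2 * A2 + v3 * A3)); [ring|].
      rewrite G1, G2. ring. }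
  set (K1 := divx (cross1 a b mu)).
  assert (HK1 : cvr t K1) by now apply cvr_divx.
  assert (Hfree : free_of_x mu) by apply free_row0.
  assert (HK10 : K1 O O = 2 * P ^ 2).
  { unfold K1, divx, cross1, minor, qm, qy. coef.
    rewrite ?(Hfree 1%nat), ?Hmu0, ?b01, ?a01, ?a20, ?a02, ?a11, ?b02, ?b11, ?b20, ?b10 by easy. ring. }
  set (Y := minor (qx b) (dxy 0 2 b) (qy a) (dxy 2 0 b)).
  assert (HY : cvr t Y) by (apply cvr_minor; auto).
  set (Z := pdet (pconst 10) (pscal (-5) mu) pzero
        (dxy 2 0 a) (dxy 1 1 a) (dxy 0 2 a) (dxy 2 0 b) (dxy 1 1 b) (dxy 0 2 b)).
  assert (HZ : cvr t Z) by (apply cvr_pdet; auto; unfold pzero; cvr_tac).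
  set (E0 := padd (pscal 20 K1) (padd Z (pmul (pscal 5 (dy mu)) Y))).
  assert (HE0 : cvr t E0) by (unfold E0; cvr_tac).
  assert (E00 : E0 O O = 0).
  { unfold E0, padd, pscal. rewrite HK10. unfold Z, Y, pdet, pzero, minor, qx, qm, qy, pconst, single.
    coef. rewrite ?Hmu0, ?b01, ?a01, ?a20, ?a02, ?a11, ?b02, ?b11, ?b20, ?b10. ring. }
  assert (HdE : cvr t (divy E0)) by now apply cvr_divy.
  set (phi := row0 (pscal (/ (30 * kap)) (pmul (divy E0) K))).
  assert (Hphi : cvr t phi) by (apply cvr_row0; cvr_tac).
  exists t, mu, phi. do 3 (split; [easy|]). split; [easy|]. split; [easy|].
  split; [apply free_row0|]. split; [easy|].
  intros y Hy. split; [auto|]. split; [now apply Hc23|]. split; [now apply Hc23|].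
  unfold leading_defect. fold K1. fold Z.
  assert (HU : cvr t (pdet (qx b) (qm a b) (qy a) (pscal 30 phi) (pscal 5 (dy mu)) pzero
        (dxy 2 0 b) (dxy 1 1 b) (dxy 0 2 b))).
  { apply cvr_pdet; auto; unfold pzero; cvr_tac. }
  rewrite !(eva_add t), (eva_pdet t), !ev_scal by (auto; unfold pzero; cvr_tac; auto).
  assert (Hphiv : ev phi 0 y = / (30 * kap) * (ev (divy E0) 0 y * ev K 0 y)).
  { unfold phi. rewrite ev_row0, ev_scal, (eva_mul t) by easy. easy. }
  assert (F1 : ev D0 0 y = y * ev (divy D0) 0 y) by (apply (ev_divy_axis r); lra || easy).
  assert (F2 : ev E0 0 y = y * ev (divy E0) 0 y) by now apply (ev_divy_axis t).
  unfold D0 in F1 at 1. unfold E0 in F2 at 1. unfold Y in F2.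
  rewrite (eva_minor t) in F1 by auto.
  rewrite !(eva_add t), (eva_mul t), (eva_minor t), !ev_scal in F2 by (auto; cvr_tac).
  specialize (HDK y Hy). rewrite Hphiv. unfold pzero. rewrite ev_const. unfold det3.
  match goal with |- ?L = 0 => transitivity
    (y * ev (divy E0) 0 y - / kap * (ev (divy E0) 0 y * ev K 0 y) * (y * ev (divy D0) 0 y)) end.
  - rewrite <- F1, <- F2. field. lra.
  - replace (/ kap * (ev (divy E0) 0 y * ev K 0 y) * (y * ev (divy D0) 0 y))
      with (/ kap * y * ev (divy E0) 0 y * (ev (divy D0) 0 y * ev K 0 y)) by ring.
    rewrite HDK. field. lra.
Qed.

(** * Perturbing a W-congruence at the resonant order *)

Lemma dx_add a b : dx (padd a b) = padd (dx a) (dx b).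
Proof. apply fam_ext; intros. unfold dx, padd. ring. Qed.

Lemma dy_add a b : dy (padd a b) = padd (dy a) (dy b).
Proof. apply fam_ext; intros. unfold dy, padd. ring. Qed.

Lemma dx_scal k a : dx (pscal k a) = pscal k (dx a).
Proof. apply fam_ext; intros. unfold dx, pscal. ring. Qed.

Lemma dy_scal k a : dy (pscal k a) = pscal k (dy a).
Proof. apply fam_ext; intros. unfold dy, pscal. ring. Qed.

Lemma dxy_perturb i j a e f : dxy i j (padd a (pscal e f)) = padd (dxy i j a) (pscal e (dxy i j f)).
Proof.
  unfold dxy.
  assert (Hj : Nat.iter j dy (padd a (pscal e f)) =
    padd (Nat.iter j dy a) (pscal e (Nat.iter j dy f))).
  { induction j as [|j IH]; simpl; [easy|]. now rewrite IH, dy_add, dy_scal. }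
  rewrite Hj. induction i as [|i IH]; simpl; [easy|]. now rewrite IH, dx_add, dx_scal.
Qed.

Lemma dx_mul r a b : 0 < r -> cvr r a -> cvr r b ->
  dx (pmul a b) = padd (pmul (dx a) b) (pmul a (dx b)).
Proof.
  intros Hr Ha Hb. apply (rep_unique r r (ev (dx (pmul a b)))).
  - apply rep_ev; [easy|]. cvr_tac.
  - split; [easy|]. split; [cvr_tac|]. intros x y Hx Hy.
    rewrite (eva_add r), !(eva_mul r) by (easy || cvr_tac).
    rewrite <- (is_derive_unique _ _ _ (eva_dx r (pmul a b) x y (cvr_mul r a b Ha Hb) Hx Hy)).
    apply is_derive_unique.
    apply is_derive_ext_loc with (fun t => ev a t y * ev b t y).
    + generalize (ball_nbhd x r Hx). apply filter_imp. intros t Ht. symmetry. now apply (eva_mul r).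
    + apply (is_derive_mult (fun t => ev a t y) (fun t => ev b t y) x);
        [now apply (eva_dx r)|now apply (eva_dx r)|intros; apply Rmult_comm].
Qed.

Lemma transpose_mul a b : transpose (pmul a b) = pmul (transpose a) (transpose b).
Proof. apply fam_ext; intros i j. unfold transpose, pmul. apply fsum_switch. Qed.

Lemma dy_mul r a b : 0 < r -> cvr r a -> cvr r b ->
  dy (pmul a b) = padd (pmul (dy a) b) (pmul a (dy b)).
Proof.
  intros Hr Ha Hb. rewrite dy_transpose, transpose_mul.
  rewrite (dx_mul r) by (easy || now apply cvr_transpose).
  rewrite !(dy_transpose a), !(dy_transpose b).
  apply fam_ext; intros i j. unfold padd. unfold transpose at 1.
  f_equal.
  - change (transpose (pmul (dx (transpose a)) (transpose b)) i j
      = pmul (transpose (dx (transpose a))) b i j). now rewrite transpose_mul.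
  - change (transpose (pmul (transpose a) (dx (transpose b))) i j
      = pmul a (transpose (dx (transpose b))) i j). now rewrite transpose_mul.
Qed.

Lemma dx_free a : free_of_x a -> dx a = pconst 0.
Proof.
  intros H. apply fam_ext; intros i j. unfold dx. rewrite H by easy.
  unfold pconst, single. destruct (Nat.eq_dec i 0), (Nat.eq_dec j 0); ring.
Qed.

Lemma free_dy a : free_of_x a -> free_of_x (dy a).
Proof. intros H i j Hi. unfold dy. rewrite H by easy. ring. Qed.

Lemma dx_x_power k v : dx (single (S k) 0 v) = single k 0 (INR (S k) * v).
Proof.
  apply fam_ext; intros i j. unfold dx, single.
  destruct (Nat.eq_dec (S i) (S k)) as [E|E], (Nat.eq_dec i k) as [F|F], (Nat.eq_dec j 0);
    try lia; try ring. now rewrite F.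
Qed.

Lemma dy_x_power k v : dy (single k 0 v) = pconst 0.
Proof.
  apply fam_ext; intros i j. unfold dy, pconst, single.
  destruct (Nat.eq_dec i k), (Nat.eq_dec (S j) 0), (Nat.eq_dec i 0), (Nat.eq_dec j 0);
    try lia; ring.
Qed.

Lemma dx_const v : dx (pconst v) = pconst 0.
Proof.
  apply fam_ext; intros i j. unfold dx, pconst, single. simpl.
  destruct (Nat.eq_dec i 0), (Nat.eq_dec j 0); ring.
Qed.

(** The term [x^5] is resonant for the linearized equation, so its coefficient is free; the
    correction of higher order is parametrized by [g]. *)
Definition pert2 (g : fam) : fam := padd (single 5 0 1) (pmul (single 6 0 1) (op_w g)).

Definition pert1 (mu phi g : fam) : fam := padd (pmul mu (pert2 g)) (pmul (single 6 0 1) phi).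

Ltac pert_coef :=
  apply fam_ext; intros i j; unfold dx, dy, pert2, padd; rewrite ?pmul_single;
  unfold single, op_w, op_th1, op_th2, op_mxy, op_my, op_myy.

Lemma INR_shift k i : (k <= i)%nat -> INR i = INR (i - k) + INR k.
Proof. intros H. rewrite <- plus_INR. f_equal. lia. Qed.

Ltac pert_cases :=
  repeat match goal with |- context [le_dec ?a ?b] => destruct (le_dec a b) end;
  repeat match goal with |- context [Nat.eq_dec ?a ?b] => destruct (Nat.eq_dec a b) end;
  try lia; subst.

Lemma pert2_x g : dx (pert2 g) = padd (single 4 0 5) (pmul (single 5 0 1) (op_th1 g)).
Proof.
  pert_coef. pert_cases; try (simpl; ring).
  replace (S i - 6)%nat with (i - 5)%nat by lia.
  rewrite S_INR, (INR_shift 5 i) by lia. rewrite !Nat.sub_0_r.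
  assert (H := pos_INR (i - 5)). simpl (INR 5). field. lra.
Qed.

Lemma pert2_xx g : dx (dx (pert2 g)) = padd (single 3 0 20) (pmul (single 4 0 1) (op_th2 g)).
Proof.
  rewrite pert2_x. pert_coef. pert_cases; try (simpl; ring).
  replace (S i - 5)%nat with (i - 4)%nat by lia.
  rewrite S_INR, (INR_shift 4 i) by lia. rewrite !Nat.sub_0_r.
  assert (H := pos_INR (i - 4)). simpl (INR 4). field. lra.
Qed.

Lemma pert2_y g : dy (pert2 g) = pmul (single 5 0 1) (op_my g).
Proof.
  pert_coef. pert_cases; try (simpl; ring).
  rewrite !Nat.sub_0_r, Nat.add_1_r. replace (i - 5)%nat with (S (i - 6)) by lia.
  assert (H := pos_INR (i - 6)). rewrite S_INR. field. lra.
Qed.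

Lemma pert2_xy g : dx (dy (pert2 g)) = pmul (single 4 0 1) (op_mxy g).
Proof.
  rewrite pert2_y. pert_coef. pert_cases; try (simpl; ring).
  rewrite !Nat.sub_0_r. replace (S i - 5)%nat with (i - 4)%nat by lia.
  destruct (i - 4)%nat as [|k] eqn:E; [ring|].
  replace i with (k + 5)%nat by lia. rewrite S_INR, plus_INR, (Nat.add_1_r j). simpl (INR 5).
  assert (H := pos_INR k). field. lra.
Qed.

Lemma pert2_yy g : dy (dy (pert2 g)) = pmul (single 5 0 1) (op_myy g).
Proof.
  rewrite pert2_y. pert_coef. pert_cases; try (simpl; ring).
  rewrite !Nat.sub_0_r. destruct (i - 5)%nat as [|k] eqn:E; [ring|].
  replace (S j + 1)%nat with (j + 2)%nat by lia.
  rewrite !S_INR. assert (H := pos_INR k). field. lra.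
Qed.

Lemma op_indicial g : g = padd (op_th2 g) (pscal (-4) (op_th1 g)).
Proof.
  apply fam_ext; intros n j. unfold padd, pscal, op_th1, op_th2.
  assert (H := pos_INR n). field. lra.
Qed.

(** * The nonlinear Fuchsian equation *)

Lemma ctrl_sub k F G : ctrl k F -> ctrl k G -> ctrl k (fun e g => psub (F e g) (G e g)).
Proof. intros HF HG. apply ctrl_add; [easy|]. now apply (ctrl_scal k (-1)). Qed.

Lemma ctrl_minor F G H K : ctrl 0 F -> ctrl 0 G -> ctrl 0 H -> ctrl 0 K ->
  ctrl 0 (fun e g => minor (F e g) (G e g) (H e g) (K e g)).
Proof. intros. apply ctrl_sub; now apply ctrl_mul_0. Qed.

Lemma ctrl_pdet F1 F2 F3 G1 G2 G3 H1 H2 H3 :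
  ctrl 0 F1 -> ctrl 0 F2 -> ctrl 0 F3 -> ctrl 0 G1 -> ctrl 0 G2 -> ctrl 0 G3 ->
  ctrl 0 H1 -> ctrl 0 H2 -> ctrl 0 H3 ->
  ctrl 0 (fun e g => pdet (F1 e g) (F2 e g) (F3 e g) (G1 e g) (G2 e g) (G3 e g)
    (H1 e g) (H2 e g) (H3 e g)).
Proof.
  intros. apply ctrl_add; [apply ctrl_sub|]; apply ctrl_mul_0; try easy; now apply ctrl_minor.
Qed.

(** For the perturbation [(pert1, pert2)], the rows of the determinant W change by
    [x^4 (dq1, dq2, dq3)], [mu] times the third row plus [x^4 (df1, df2, df3)], and
    [x^3 (du1, du2, du3)]. *)
Definition dq1 (g : fam) : fam := padd (pconst 10) (pmul (pscal 2 px) (op_th1 g)).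
Definition dq2 (mu phi g : fam) : fam :=
  psub (pmul px (op_my g))
    (padd (pmul mu (padd (pconst 5) (pmul px (op_th1 g)))) (pmul (pscal 6 px) phi)).
Definition dq3 (mu phi g : fam) : fam :=
  pmul (pscal (-2) px) (padd (pmul mu (op_my g))
    (padd (pmul (dy mu) (padd (pconst 1) (pmul px (op_w g)))) (pmul px (dy phi)))).
Definition df1 (phi : fam) : fam := pscal 30 phi.
Definition df2 (mu phi g : fam) : fam :=
  padd (pmul (dy mu) (padd (pconst 5) (pmul px (op_th1 g)))) (pmul (pscal 6 px) (dy phi)).
Definition df3 (mu phi g : fam) : fam :=
  pmul px (padd (pmul (pscal 2 (dy mu)) (op_my g))
    (padd (pmul (dy (dy mu)) (padd (pconst 1) (pmul px (op_w g)))) (pmul px (dy (dy phi))))).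
Definition du1 (g : fam) : fam := padd (pconst 20) (pmul px (op_th2 g)).
Definition du2 (g : fam) : fam := pmul px (op_mxy g).
Definition du3 (g : fam) : fam := pmul (pmul px px) (op_myy g).

(** After division by [x^5] the equation W = 0 becomes
    [2 P^2 g + source + linear_rest + e x^2 quadratic_part + e^2 x^6 cubic_part = 0], where
    [2 P^2 g = 2 P^2 (th2 - 4 th1)] is what the lowest terms of the linear part contribute.
    Each summand of [linear_rest] carries either an operator that gains degrees or a
    coefficient vanishing at the origin. *)
Definition source (a b mu phi : fam) : fam :=
  padd (divx (leading_defect a b mu phi))
    (padd (pmul (pscal 6 phi) (minor (dxy 2 0 a) (dxy 0 2 b) (dxy 0 2 a) (dxy 2 0 b)))
      (pmul (pscal (-2) (dy mu)) (minor (dxy 2 0 a) (dxy 1 1 b) (dxy 1 1 a) (dxy 2 0 b)))).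

Definition linear_rest (P : R) (a b mu phi g : fam) : fam :=
  padd (pmul (psub (divx (cross1 a b mu)) (pconst (2 * P ^ 2))) (op_th2 g))
  (padd (pmul (divx (cross2 a b mu)) (op_mxy g))
  (padd (pmul (pmul px (divx (cross3 a b mu))) (op_myy g))
  (padd (pmul (padd (minor (dxy 1 1 a) (dxy 0 2 b) (dxy 0 2 a) (dxy 1 1 b)) (pconst (4 * P ^ 2))) (pscal 2 (op_th1 g)))
  (padd (pmul (pscal (-1) (minor (dxy 2 0 a) (dxy 0 2 b) (dxy 0 2 a) (dxy 2 0 b))) (psub (op_my g) (pmul mu (op_th1 g))))
  (padd (pmul (pscal (-2) (minor (dxy 2 0 a) (dxy 1 1 b) (dxy 1 1 a) (dxy 2 0 b)))
     (padd (pmul mu (op_my g)) (padd (pmul px (pmul (dy mu) (op_w g))) (pmul px (dy phi)))))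
  (padd (pmul (qx b)
      (minor (padd (pmul (dy mu) (op_th1 g)) (pscal 6 (dy phi))) (dxy 0 2 b)
         (padd (pmul (pscal 2 (dy mu)) (op_my g))
            (padd (pmul (dy (dy mu)) (padd (pconst 1) (pmul px (op_w g)))) (pmul px (dy (dy phi))))) (dxy 1 1 b)))
  (padd (pmul (qm a b)
      (pmul (padd (pmul (pscal 2 (dy mu)) (op_my g))
            (padd (pmul (dy (dy mu)) (padd (pconst 1) (pmul px (op_w g)))) (pmul px (dy (dy phi))))) (dxy 2 0 b)))
    (pmul (pscal (-1) (qy a))
      (pmul (padd (pmul (dy mu) (op_th1 g)) (pscal 6 (dy phi))) (dxy 2 0 b)))))))))).

Definition quadratic_part (a b mu phi g : fam) : fam :=
  padd (pdet (qx b) (qm a b) (qy a) (df1 phi) (df2 mu phi g) (df3 mu phi g) (du1 g) (du2 g) (du3 g))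
  (padd (pdet (dq1 g) (dq2 mu phi g) (dq3 mu phi g)
      (padd (pmul mu (du1 g)) (pmul px (df1 phi)))
      (padd (pmul mu (du2 g)) (pmul px (df2 mu phi g)))
      (padd (pmul mu (du3 g)) (pmul px (df3 mu phi g))) (dxy 2 0 b) (dxy 1 1 b) (dxy 0 2 b))
    (pdet (dq1 g) (dq2 mu phi g) (dq3 mu phi g) (dxy 2 0 a) (dxy 1 1 a) (dxy 0 2 a) (du1 g) (du2 g) (du3 g))).

Definition cubic_part (mu phi g : fam) : fam :=
  pdet (dq1 g) (dq2 mu phi g) (dq3 mu phi g) (df1 phi) (df2 mu phi g) (df3 mu phi g)
    (du1 g) (du2 g) (du3 g).

Definition fuchs_rest (P : R) (a b mu phi : fam) (e : R) (g : fam) : fam :=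
  pscal (- / (2 * P ^ 2)) (padd (linear_rest P a b mu phi g)
    (padd (pscal e (pmul (single 2 0 1) (quadratic_part a b mu phi g)))
      (pscal e (pscal e (pmul (single 6 0 1) (cubic_part mu phi g)))))).

Ltac ctrl_0 := lazymatch goal with
  | |- ctrl 0 (fun e g => padd (@?F e g) (@?G e g)) => apply (ctrl_add 0 F G); ctrl_0
  | |- ctrl 0 (fun e g => psub (@?F e g) (@?G e g)) => apply (ctrl_sub 0 F G); ctrl_0
  | |- ctrl 0 (fun e g => pmul (@?F e g) (@?G e g)) => apply (ctrl_mul_0 F G); ctrl_0
  | |- ctrl 0 (fun e g => pscal ?k (@?F e g)) => apply (ctrl_scal 0 k F); ctrl_0
  | |- ctrl 0 (fun e g => minor (@?F e g) (@?G e g) (@?H e g) (@?K e g)) =>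
      apply (ctrl_minor F G H K); ctrl_0
  | |- ctrl 0 (fun e g => pdet (@?F1 e g) (@?F2 e g) (@?F3 e g) (@?G1 e g) (@?G2 e g) (@?G3 e g)
         (@?H1 e g) (@?H2 e g) (@?H3 e g)) =>
      apply (ctrl_pdet F1 F2 F3 G1 G2 G3 H1 H2 H3); ctrl_0
  | |- ctrl 0 (fun e g => op_w g) => apply ctrl_w
  | |- ctrl 0 (fun e g => op_th1 g) => apply ctrl_th1
  | |- ctrl 0 (fun e g => op_th2 g) => apply ctrl_th2
  | |- ctrl 0 (fun e g => op_mxy g) => apply (ctrl_weaken 1 0); [lia|apply ctrl_mxy]
  | |- ctrl 0 (fun e g => op_my g) => apply (ctrl_weaken 1 0); [lia|apply ctrl_my]
  | |- ctrl 0 (fun e g => op_myy g) => apply (ctrl_weaken 1 0); [lia|apply ctrl_myy]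
  | |- ctrl 0 (fun e g => ?c) => match goal with H : 0 < ?t |- _ =>
      apply (ctrl_const t c H); solve [cvr_tac] end
  end.

Ltac ctrl_split := lazymatch goal with
  | |- ctrl 1 (fun e g => padd (@?F e g) (@?G e g)) => apply (ctrl_add 1 F G); ctrl_split
  | |- _ => idtac
  end.

Ltac ctrl_left := lazymatch goal with
  | |- ctrl 1 (fun e g => pmul (@?F e g) (@?G e g)) => apply (ctrl_mul_l F G); [|ctrl_0]
  end.

Ltac ctrl_right := lazymatch goal with
  | |- ctrl 1 (fun e g => pmul (@?F e g) (@?G e g)) => apply (ctrl_mul_r F G); [ctrl_0|]
  end.

Lemma ctrl_fuchs_rest t P a b mu phi : 0 < t -> cvr t a -> cvr t b -> cvr t mu -> cvr t phi ->
  normal_2jet P a b -> mu O O = 0 -> divx (cross1 a b mu) O O = 2 * P ^ 2 ->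
  ctrl 1 (fuchs_rest P a b mu phi).
Proof.
  intros Ht Ha Hb Hmu Hphi Hn Hmu0 HK0.
  assert (H1 : forall i j, cvr t (dxy i j a)) by (intros; now apply cvr_dxy).
  assert (H2 : forall i j, cvr t (dxy i j b)) by (intros; now apply cvr_dxy).
  assert (Hq1 : cvr t (qx b)) by (apply cvr_scal, H2).
  assert (Hq2 : cvr t (qm a b)) by (apply cvr_psub; auto).
  assert (Hq3 : cvr t (qy a)) by (apply cvr_scal, H1).
  assert (HT : forall i j, cvr t (psub (dxy i j a) (pmul mu (dxy i j b)))).
  { intros i j. apply cvr_psub; [auto|]. apply cvr_mul; auto. }
  assert (HK1 : cvr t (divx (cross1 a b mu))) by (apply cvr_divx, cvr_minor; auto).
  assert (HK2 : cvr t (divx (cross2 a b mu))) by (apply cvr_divx, cvr_minor; auto).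
  assert (HK3 : cvr t (divx (cross3 a b mu))) by (apply cvr_divx, cvr_minor; auto).
  assert (G20 := H1 2%nat 0%nat). assert (G11 := H1 1%nat 1%nat). assert (G02 := H1 0%nat 2%nat).
  assert (F20 := H2 2%nat 0%nat). assert (F11 := H2 1%nat 1%nat). assert (F02 := H2 0%nat 2%nat).
  assert (Hpx : ctrl 1 (fun _ _ => px)).
  { apply ctrl_const_small with t; [easy|apply cvr_single|easy]. }
  assert (Hmus : ctrl 1 (fun _ _ => mu)) by now apply ctrl_const_small with t.
  pose proof Hn as (_ & a00 & b00 & b01 & a01 & b10 & a20 & a02 & b11 & b20 & a11 & b02).
  assert (Hlin : ctrl 1 (fun _ g => linear_rest P a b mu phi g)).
  { unfold linear_rest. ctrl_split.
    - ctrl_left. apply ctrl_const_small with t; [easy|unfold psub; cvr_tac|].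
      unfold psub, padd, pscal, pconst, single. rewrite HK0. simpl. ring.
    - ctrl_right; apply ctrl_mxy.
    - ctrl_right; apply ctrl_myy.
    - ctrl_left. apply ctrl_const_small with t; [easy| |].
      + apply cvr_add; [now apply cvr_minor|apply cvr_single].
      + unfold minor, pconst, single. coef. rewrite ?a02, ?a11, ?b02, ?b11. ring.
    - ctrl_right. apply (ctrl_sub 1 (fun _ g => op_my g) (fun _ g => pmul mu (op_th1 g))); [apply ctrl_my|].
      ctrl_left; easy.
    - ctrl_right. ctrl_split.
      + ctrl_left; easy.
      + ctrl_left; easy.
      + ctrl_left; easy.
    - ctrl_left. apply ctrl_const_small with t; [easy|easy|].
      unfold qx. coef. rewrite b10. ring.
    - ctrl_left. apply ctrl_const_small with t; [easy|easy|].
      unfold qm. coef. rewrite b01. ring.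
    - ctrl_left. apply ctrl_const_small with t; [easy|now apply cvr_scal|].
      unfold qy. coef. rewrite a01. ring. }
  assert (Hx2 : forall k, ctrl 1 (fun _ _ => single (S k) 0 1)).
  { intros k. apply ctrl_const_small with t; [easy|apply cvr_single|easy]. }
  change (ctrl 1 (fun e g => fuchs_rest P a b mu phi e g)). unfold fuchs_rest. lazymatch goal with |- ctrl 1 (fun e g => pscal ?k (@?F e g)) => apply (ctrl_scal 1 k F) end. ctrl_split; [easy| |].
  - lazymatch goal with |- ctrl 1 (fun e g => pscal e (@?F e g)) => apply (ctrl_eps 1 F) end.
    lazymatch goal with |- ctrl 1 (fun e g => pmul (@?F e g) (@?G e g)) => apply (ctrl_mul_l F G) end; [easy|].
    unfold quadratic_part, dq1, dq2, dq3, df1, df2, df3, du1, du2, du3. ctrl_0.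
  - do 2 lazymatch goal with |- ctrl 1 (fun e g => pscal e (@?F e g)) => apply (ctrl_eps 1 F) end.
    lazymatch goal with |- ctrl 1 (fun e g => pmul (@?F e g) (@?G e g)) => apply (ctrl_mul_l F G) end; [easy|].
    unfold cubic_part, dq1, dq2, dq3, df1, df2, df3, du1, du2, du3. ctrl_0.
Qed.

Ltac cvr_full := repeat first
  [ progress cvr_tac
  | match goal with
    | |- cvr _ (psub _ _) => apply cvr_psub
    | |- cvr _ (minor _ _ _ _) => apply cvr_minor
    | |- cvr _ (pdet _ _ _ _ _ _ _ _ _) => apply cvr_pdet
    | |- cvr _ (dxy _ _ _) => apply cvr_dxy
    end ].

(** The first component moves by [m] times the second, so the second-order terms of the two
    perturbations cancel in the quadratic part. *)
Lemma det3_expand (x e m Q1 Q2 Q3 A1 A2 A3 B1 B2 B3 q1 q2 q3 f1 f2 f3 u1 u2 u3 : R) :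
  det3 (Q1 + e * (x ^ 4 * q1)) (Q2 + e * (x ^ 4 * q2)) (Q3 + e * (x ^ 4 * q3))
    (A1 + e * (m * (x ^ 3 * u1) + x ^ 4 * f1)) (A2 + e * (m * (x ^ 3 * u2) + x ^ 4 * f2))
    (A3 + e * (m * (x ^ 3 * u3) + x ^ 4 * f3))
    (B1 + e * (x ^ 3 * u1)) (B2 + e * (x ^ 3 * u2)) (B3 + e * (x ^ 3 * u3)) =
  det3 Q1 Q2 Q3 A1 A2 A3 B1 B2 B3
  + e * x ^ 3 * ((Q2 * (A3 - m * B3) - Q3 * (A2 - m * B2)) * u1
      + (Q3 * (A1 - m * B1) - Q1 * (A3 - m * B3)) * u2
      + (Q1 * (A2 - m * B2) - Q2 * (A1 - m * B1)) * u3)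
  + e * x ^ 4 * (det3 q1 q2 q3 A1 A2 A3 B1 B2 B3 + det3 Q1 Q2 Q3 f1 f2 f3 B1 B2 B3)
  + e ^ 2 * x ^ 7 * (det3 Q1 Q2 Q3 f1 f2 f3 u1 u2 u3
      + det3 q1 q2 q3 (m * u1 + x * f1) (m * u2 + x * f2) (m * u3 + x * f3) B1 B2 B3
      + det3 q1 q2 q3 A1 A2 A3 u1 u2 u3)
  + e ^ 3 * x ^ 11 * det3 q1 q2 q3 f1 f2 f3 u1 u2 u3.
Proof. unfold det3. ring. Qed.

Lemma wt_mono s s' n j : 0 < s' <= s -> wt s' n j <= wt s n j.
Proof.
  intros H. unfold wt. apply Rmult_le_compat_r.
  - left. apply Rinv_0_lt_compat, pasc_pos.
  - apply pow_incr. lra.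
Qed.

Lemma bnd_wt_mono s s' g M : 0 < s' <= s -> bnd g (wt s) M -> bnd g (wt s') M.
Proof.
  intros Hs. apply bnd_weight. intros i j. split; [left; apply wt_pos; lra|now apply wt_mono].
Qed.

Lemma ctrl_cvr k F e s g M : ctrl k F -> Rabs e <= 1 -> 0 < s -> bnd g (wt s) M ->
  exists t, 0 < t /\ cvr t (F e g).
Proof.
  intros (_ & _ & H) He Hs Hg. destruct (H M) as (C & s0 & HC & Hs0 & HF).
  set (q := Rmin s s0). assert (Hq : 0 < q) by (apply Rmin_glb_lt; lra).
  assert (H1 : q <= s) by apply Rmin_l. assert (H2 : q <= s0) by apply Rmin_r.
  assert (Hq3 : 0 < q ^ 3) by now apply pow_lt.
  exists (q ^ 3 / 4). split; [lra|].
  apply cvr_wt with (C * q ^ k); [lra|]. apply HF; [easy|lra|].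
  apply bnd_wt_mono with s; lra || easy.
Qed.

Lemma ctrl_entry k F s M : ctrl k F -> 0 < s -> exists B : nat -> nat -> R,
  forall e g, Rabs e <= 1 -> bnd g (wt s) M -> forall i j, Rabs (F e g i j) <= B i j.
Proof.
  intros (_ & _ & H) Hs. destruct (H M) as (C & s0 & HC & Hs0 & HF).
  set (q := Rmin s s0). assert (Hq : 0 < q) by (apply Rmin_glb_lt; lra).
  assert (H1 : q <= s) by apply Rmin_l. assert (H2 : q <= s0) by apply Rmin_r.
  exists (fun i j => C * q ^ k / wt q i j). intros e g He Hg i j.
  assert (Hw := wt_pos q i j Hq).
  assert (HFe : bnd (F e g) (wt q) (C * q ^ k)).
  { apply HF; [easy|lra|]. apply bnd_wt_mono with s; lra || easy. }
  assert (Hij := abs_bound_entry _ _ i j HFe). cbv beta in Hij. rewrite Rabs_mult, (Rabs_pos_eq (wt q i j)) in Hij by lra.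
  apply Rmult_le_reg_r with (wt q i j); [easy|].
  unfold Rdiv. rewrite Rmult_assoc, Rinv_l by lra. lra.
Qed.

(** By [det3_expand] the change of W is [e x^4] times the linear part plus higher powers
    of [x]; the three components of the cross product and the leading defect vanish on
    [x = 0], so one more [x] factors out and the remaining factor is the equation for [g]. *)
Lemma W_perturbed t P a b mu phi e g :
  0 < t -> cvr t a -> cvr t b -> cvr t mu -> cvr t phi -> P <> 0 ->
  Wser a b = pzero -> free_of_x mu -> free_of_x phi ->
  (forall y, Rabs y < t ->
      ev (cross1 a b mu) 0 y = 0 /\ ev (cross2 a b mu) 0 y = 0 /\
      ev (cross3 a b mu) 0 y = 0 /\ ev (leading_defect a b mu phi) 0 y = 0) ->
  cvr t (op_w g) -> cvr t (op_th1 g) -> cvr t (op_th2 g) ->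
  cvr t (op_mxy g) -> cvr t (op_my g) -> cvr t (op_myy g) ->
  g = padd (pscal (- / (2 * P ^ 2)) (source a b mu phi)) (fuchs_rest P a b mu phi e g) ->
  Wser (padd a (pscal e (pert1 mu phi g))) (padd b (pscal e (pert2 g))) = pzero.
Proof.
  intros Ht Ha Hb Hmu Hphi HP HW Hfm Hfp Hax Hw Ht1 Ht2 Hmxy Hmy Hmyy Hg.
  set (u := pert2 g). set (f := pert1 mu phi g).
  assert (Hu : cvr t u) by (unfold u, pert2; cvr_tac).
  assert (Hf : cvr t f) by (unfold f, pert1; fold u; cvr_tac).
  assert (H1 : forall i j, cvr t (dxy i j a)) by (intros; now apply cvr_dxy).
  assert (H2 : forall i j, cvr t (dxy i j b)) by (intros; now apply cvr_dxy).
  assert (Hq1 : cvr t (qx b)) by (apply cvr_scal, H2).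
  assert (Hq2 : cvr t (qm a b)) by (apply cvr_psub; auto).
  assert (Hq3 : cvr t (qy a)) by (apply cvr_scal, H1).
  assert (G20 := H1 2%nat 0%nat). assert (G11 := H1 1%nat 1%nat). assert (G02 := H1 0%nat 2%nat).
  assert (F20 := H2 2%nat 0%nat). assert (F11 := H2 1%nat 1%nat). assert (F02 := H2 0%nat 2%nat).
  assert (G10 := H1 1%nat 0%nat). assert (G01 := H1 0%nat 1%nat).
  assert (F10 := H2 1%nat 0%nat). assert (F01 := H2 0%nat 1%nat).
  assert (HX1 : cvr t (cross1 a b mu)) by (apply cvr_minor; try apply cvr_psub; cvr_tac).
  assert (HX2 : cvr t (cross2 a b mu)) by (apply cvr_minor; try apply cvr_psub; cvr_tac).
  assert (HX3 : cvr t (cross3 a b mu)) by (apply cvr_minor; try apply cvr_psub; cvr_tac).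
  assert (HK1 := cvr_divx _ _ HX1). assert (HK2 := cvr_divx _ _ HX2).
  assert (HK3 := cvr_divx _ _ HX3).
  assert (HLD : cvr t (leading_defect a b mu phi)).
  { unfold leading_defect, pzero. apply cvr_add; [|apply cvr_add]; [cvr_tac|apply cvr_pdet; cvr_tac..]. }
  assert (HLa := cvr_divx _ _ HLD).
  assert (Hf2 : cvr t (df2 mu phi g)) by (unfold df2; cvr_tac).
  assert (Hf3 : cvr t (df3 mu phi g)) by (unfold df3; cvr_tac).
  assert (Hf1 : cvr t (df1 phi)) by (unfold df1; cvr_tac).
  assert (Hdq1 : cvr t (dq1 g)) by (unfold dq1; cvr_tac).
  assert (Hdq2 : cvr t (dq2 mu phi g)) by (unfold dq2, psub; cvr_tac).
  assert (Hdq3 : cvr t (dq3 mu phi g)) by (unfold dq3; cvr_tac).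
  assert (Hdu1 : cvr t (du1 g)) by (unfold du1; cvr_tac).
  assert (Hdu2 : cvr t (du2 g)) by (unfold du2; cvr_tac).
  assert (Hdu3 : cvr t (du3 g)) by (unfold du3; cvr_tac).
  assert (Ha' : cvr t (padd a (pscal e f))) by cvr_tac.
  assert (Hb' : cvr t (padd b (pscal e u))) by cvr_tac.
  apply (identity_theorem t _ 0 0 t); try (rewrite Rabs_R0; easy); [|easy|].
  { assert (H1' : forall i j, cvr t (dxy i j (padd a (pscal e f)))) by (intros; now apply cvr_dxy).
    assert (H2' : forall i j, cvr t (dxy i j (padd b (pscal e u)))) by (intros; now apply cvr_dxy).
    unfold Wser, psub. cvr_tac; auto. }
  intros x y Hx Hy _ _.
  rewrite (Wser_det t) by easy. unfold qx, qm, qy. rewrite !dxy_perturb.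
  (* derivatives of the perturbations, without the powers of x named at [dq1] *)
  assert (Ex : ev px x y = x) by apply ev_px.
  assert (Dux : ev (dxy 1 0 u) x y = x ^ 4 * (5 + x * ev (op_th1 g) x y)).
  { change (dxy 1 0 u) with (dx (pert2 g)). rewrite pert2_x.
    rewrite (eva_add t), (eva_single_mul t), ev_single by cvr_tac. ring. }
  assert (Duy : ev (dxy 0 1 u) x y = x ^ 5 * ev (op_my g) x y).
  { change (dxy 0 1 u) with (dy (pert2 g)). rewrite pert2_y.
    rewrite (eva_single_mul t) by cvr_tac. ring. }
  assert (Duxx : ev (dxy 2 0 u) x y = x ^ 3 * ev (du1 g) x y).
  { change (dxy 2 0 u) with (dx (dx (pert2 g))). rewrite pert2_xx. unfold du1.
    rewrite !(eva_add t), (eva_single_mul t), ev_single, ev_const, (eva_mul t), ev_px by cvr_tac. ring. }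
  assert (Duxy : ev (dxy 1 1 u) x y = x ^ 3 * ev (du2 g) x y).
  { change (dxy 1 1 u) with (dx (dy (pert2 g))). rewrite pert2_xy. unfold du2.
    rewrite (eva_single_mul t), (eva_mul t), ev_px by cvr_tac. ring. }
  assert (Duyy : ev (dxy 0 2 u) x y = x ^ 3 * ev (du3 g) x y).
  { change (dxy 0 2 u) with (dy (dy (pert2 g))). rewrite pert2_yy. unfold du3.
    rewrite (eva_single_mul t), !(eva_mul t), ev_px by cvr_tac. ring. }
  assert (Eu : ev u x y = x ^ 5 * (1 + x * ev (op_w g) x y)).
  { unfold u, pert2. rewrite (eva_add t), (eva_single_mul t), ev_single by cvr_tac. ring. }
  assert (Hm0 : dx mu = pconst 0) by now apply dx_free.
  assert (Hp0 : dx phi = pconst 0) by now apply dx_free.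
  assert (Hm1 : dx (dy mu) = pconst 0) by now apply dx_free, free_dy.
  assert (Hp1 : dx (dy phi) = pconst 0) by now apply dx_free, free_dy.
  assert (Efx : dx f = padd (padd (pmul (pconst 0) u) (pmul mu (dx u)))
    (padd (pmul (single 5 0 (INR 6 * 1)) phi) (pmul (single 6 0 1) (pconst 0)))).
  { unfold f, pert1. fold u. rewrite dx_add, !(dx_mul t), dx_x_power, Hm0, Hp0 by cvr_tac. easy. }
  assert (Efy : dy f = padd (padd (pmul (dy mu) u) (pmul mu (dy u)))
    (padd (pmul (pconst 0) phi) (pmul (single 6 0 1) (dy phi)))).
  { unfold f, pert1. fold u. rewrite dy_add, !(dy_mul t), dy_x_power by cvr_tac. easy. }
  assert (I6 : INR 6 = 6) by (simpl; ring). assert (I5 : INR 5 = 5) by (simpl; ring).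
  assert (Dfx : ev (dxy 1 0 f) x y = x ^ 4 *
    (ev mu x y * (5 + x * ev (op_th1 g) x y) + 6 * x * ev phi x y)).
  { change (dxy 1 0 f) with (dx f). rewrite Efx.
    rewrite !(eva_add t), !(eva_mul t), !ev_single, !ev_const by cvr_tac.
    change (dx u) with (dxy 1 0 u). rewrite Dux, I6. ring. }
  assert (Dfy : ev (dxy 0 1 f) x y = x ^ 5 * (ev mu x y * ev (op_my g) x y
    + ev (dy mu) x y * (1 + x * ev (op_w g) x y) + x * ev (dy phi) x y)).
  { change (dxy 0 1 f) with (dy f). rewrite Efy.
    rewrite !(eva_add t), !(eva_mul t), !ev_single, !ev_const by cvr_tac.
    change (dy u) with (dxy 0 1 u). rewrite Duy, Eu. ring. }
  assert (Dfxx : ev (dxy 2 0 f) x y = ev mu x y * (x ^ 3 * ev (du1 g) x y)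
    + x ^ 4 * ev (df1 phi) x y).
  { change (dxy 2 0 f) with (dx (dx f)). rewrite Efx.
    rewrite !dx_add, !(dx_mul t), !dx_x_power, !dx_const, Hm0, Hp0 by cvr_tac.
    rewrite !(eva_add t), !(eva_mul t), !ev_single, !ev_const by cvr_tac.
    change (dx (dx u)) with (dxy 2 0 u). rewrite Duxx. unfold df1. rewrite ev_scal, I6, I5. ring. }
  assert (Dfxy : ev (dxy 1 1 f) x y = ev mu x y * (x ^ 3 * ev (du2 g) x y)
    + x ^ 4 * ev (df2 mu phi g) x y).
  { change (dxy 1 1 f) with (dx (dy f)). rewrite Efy.
    rewrite !dx_add, !(dx_mul t), !dx_x_power, !dx_const, Hm0, Hm1, Hp0, Hp1 by cvr_tac.
    rewrite !(eva_add t), !(eva_mul t), !ev_single, !ev_const by cvr_tac.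
    change (dx (dy u)) with (dxy 1 1 u). change (dx u) with (dxy 1 0 u).
    rewrite Duxy, Dux. unfold df2.
    rewrite (eva_add t), !(eva_mul t), (eva_add t), (eva_mul t), ev_scal, ev_px, ev_const, I6
      by cvr_tac. ring. }
  assert (Dfyy : ev (dxy 0 2 f) x y = ev mu x y * (x ^ 3 * ev (du3 g) x y)
    + x ^ 4 * ev (df3 mu phi g) x y).
  { change (dxy 0 2 f) with (dy (dy f)). rewrite Efy.
    rewrite !dy_add, !(dy_mul t), !dy_x_power by cvr_tac.
    rewrite !(eva_add t), !(eva_mul t), !ev_single, !ev_const by cvr_tac.
    change (dy (dy u)) with (dxy 0 2 u). change (dy u) with (dxy 0 1 u).
    rewrite Duyy, Duy, Eu. unfold df3, pconst at 1. rewrite dy_x_power.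
    rewrite !(eva_mul t), !(eva_add t), !(eva_mul t), !(eva_add t), !(eva_mul t), ev_scal, ev_px,
      !ev_const by cvr_tac. ring. }
  assert (Hdf : forall i j, cvr t (dxy i j f)) by (intros; now apply cvr_dxy).
  assert (Hdu : forall i j, cvr t (dxy i j u)) by (intros; now apply cvr_dxy).
  assert (Eq1 : ev (pscal 2 (padd (dxy 1 0 b) (pscal e (dxy 1 0 u)))) x y =
    ev (qx b) x y + e * (x ^ 4 * ev (dq1 g) x y)).
  { unfold qx, dq1. rewrite !ev_scal, !(eva_add t), ev_scal, (eva_mul t), ev_scal, ev_px, ev_const, Dux
      by (cvr_tac; auto). ring. }
  assert (Eq2 : ev (psub (padd (dxy 0 1 b) (pscal e (dxy 0 1 u)))
      (padd (dxy 1 0 a) (pscal e (dxy 1 0 f)))) x y =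
    ev (qm a b) x y + e * (x ^ 4 * ev (dq2 mu phi g) x y)).
  { unfold qm, dq2.
    rewrite !(eva_sub t), !(eva_add t), !ev_scal, !(eva_mul t), !(eva_add t), !(eva_mul t), !ev_scal,
      ev_px, ev_const, Duy, Dfx by (cvr_tac; auto). ring. }
  assert (Eq3 : ev (pscal (-2) (padd (dxy 0 1 a) (pscal e (dxy 0 1 f)))) x y =
    ev (qy a) x y + e * (x ^ 4 * ev (dq3 mu phi g) x y)).
  { unfold qy, dq3.
    rewrite !ev_scal, !(eva_add t), !ev_scal, !(eva_mul t), !(eva_add t), !(eva_mul t), !(eva_add t),
      !(eva_mul t), !ev_scal, ev_px, ev_const, Dfy by (cvr_tac; auto). ring. }
  rewrite Eq1, Eq2, Eq3.
  rewrite !(eva_add t), !ev_scal, Dfxx, Dfxy, Dfyy, Duxx, Duxy, Duyy by (cvr_tac; auto).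
  rewrite det3_expand.
  assert (EW : ev (Wser a b) x y = 0).
  { rewrite HW. apply ev_const. }
  rewrite (Wser_det t) in EW by easy. rewrite EW, Rplus_0_l.
  destruct (Hax y Hy) as (X1 & X2 & X3 & XL).
  assert (HevT : forall i j, ev (psub (dxy i j a) (pmul mu (dxy i j b))) x y =
    ev (dxy i j a) x y - ev mu x y * ev (dxy i j b) x y).
  { intros i j. rewrite (eva_sub t), (eva_mul t); auto. apply cvr_mul; auto. }
  assert (HcT : forall i j, cvr t (psub (dxy i j a) (pmul mu (dxy i j b)))).
  { intros i j. apply cvr_psub; [auto|]. apply cvr_mul; auto. }
  assert (V1 := ev_divx t _ x y HX1 Hx Hy). assert (V2 := ev_divx t _ x y HX2 Hx Hy).
  assert (V3 := ev_divx t _ x y HX3 Hx Hy). assert (VL := ev_divx t _ x y HLD Hx Hy).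
  rewrite X1 in V1. rewrite X2 in V2. rewrite X3 in V3. rewrite XL in VL.
  unfold cross1 in V1 at 1. unfold cross2 in V2 at 1. unfold cross3 in V3 at 1.
  rewrite (eva_minor t), !HevT in V1, V2, V3 by auto.
  rewrite Rplus_0_l in V1, V2, V3, VL. rewrite V1, V2, V3.
  unfold leading_defect in VL at 1. unfold pzero in VL.
  assert (HZ : cvr t (pdet (pconst 10) (pscal (-5) mu) (pconst 0)
    (dxy 2 0 a) (dxy 1 1 a) (dxy 0 2 a) (dxy 2 0 b) (dxy 1 1 b) (dxy 0 2 b)))
    by (apply cvr_pdet; cvr_tac).
  assert (HU : cvr t (pdet (qx b) (qm a b) (qy a) (pscal 30 phi) (pscal 5 (dy mu)) (pconst 0)
    (dxy 2 0 b) (dxy 1 1 b) (dxy 0 2 b))) by (apply cvr_pdet; cvr_tac).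
  rewrite !(eva_add t), !(eva_pdet t), !ev_scal, !ev_const in VL by cvr_tac.
  assert (Eg := f_equal (fun c => ev c x y) Hg). cbv beta in Eg.
  rewrite (op_indicial g) in Eg at 1.
  assert (Hlin : cvr t (linear_rest P a b mu phi g)) by (unfold linear_rest; cvr_full).
  assert (Hqu : cvr t (quadratic_part a b mu phi g)) by (unfold quadratic_part; cvr_full).
  assert (Hcu : cvr t (cubic_part mu phi g)) by (unfold cubic_part; cvr_full).
  assert (Hso : cvr t (source a b mu phi)) by (unfold source; cvr_full).
  unfold fuchs_rest in Eg.
  rewrite !(eva_add t), !ev_scal, !(eva_add t), !ev_scal, !(eva_mul t), !ev_single in Eg by cvr_tac.
  assert (Es : ev (source a b mu phi) x y = ev (divx (leading_defect a b mu phi)) x y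
    + 6 * ev phi x y * (ev (dxy 2 0 a) x y * ev (dxy 0 2 b) x y - ev (dxy 0 2 a) x y * ev (dxy 2 0 b) x y)
    - 2 * ev (dy mu) x y
      * (ev (dxy 2 0 a) x y * ev (dxy 1 1 b) x y - ev (dxy 1 1 a) x y * ev (dxy 2 0 b) x y)).
  { unfold source. rewrite !(eva_add t), !(eva_mul t), !(eva_minor t), !ev_scal by cvr_full. ring. }
  rewrite Es in Eg. clear Es.
  unfold linear_rest in Eg.
  repeat (rewrite ?(eva_add t), ?(eva_sub t), ?(eva_mul t), ?(eva_minor t), ?ev_scal, ?ev_const, ?Ex
    in Eg by cvr_full).
  assert (Equ : ev (quadratic_part a b mu phi g) x y =
    det3 (ev (qx b) x y) (ev (qm a b) x y) (ev (qy a) x y)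
     (ev (df1 phi) x y) (ev (df2 mu phi g) x y) (ev (df3 mu phi g) x y)
     (ev (du1 g) x y) (ev (du2 g) x y) (ev (du3 g) x y) +
    det3 (ev (dq1 g) x y) (ev (dq2 mu phi g) x y) (ev (dq3 mu phi g) x y)
     (ev mu x y * ev (du1 g) x y + x * ev (df1 phi) x y)
     (ev mu x y * ev (du2 g) x y + x * ev (df2 mu phi g) x y)
     (ev mu x y * ev (du3 g) x y + x * ev (df3 mu phi g) x y)
     (ev (dxy 2 0 b) x y) (ev (dxy 1 1 b) x y) (ev (dxy 0 2 b) x y) +
    det3 (ev (dq1 g) x y) (ev (dq2 mu phi g) x y) (ev (dq3 mu phi g) x y)
     (ev (dxy 2 0 a) x y) (ev (dxy 1 1 a) x y) (ev (dxy 0 2 a) x y)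
     (ev (du1 g) x y) (ev (du2 g) x y) (ev (du3 g) x y)).
  { unfold quadratic_part.
    rewrite !(eva_add t), !(eva_pdet t), !(eva_add t), !(eva_mul t), Ex by cvr_full. ring. }
  assert (Ecu : ev (cubic_part mu phi g) x y =
    det3 (ev (dq1 g) x y) (ev (dq2 mu phi g) x y) (ev (dq3 mu phi g) x y)
     (ev (df1 phi) x y) (ev (df2 mu phi g) x y) (ev (df3 mu phi g) x y)
     (ev (du1 g) x y) (ev (du2 g) x y) (ev (du3 g) x y)).
  { unfold cubic_part. now rewrite (eva_pdet t) by cvr_full. }
  rewrite <- Equ, <- Ecu. clear Equ Ecu.
  assert (Vdq1 : ev (dq1 g) x y = 10 + 2 * x * ev (op_th1 g) x y).
  { unfold dq1. rewrite (eva_add t), (eva_mul t), ev_scal, ev_const, Ex by cvr_full. ring. }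
  assert (Vdq2 : ev (dq2 mu phi g) x y = x * ev (op_my g) x y
    - (ev mu x y * (5 + x * ev (op_th1 g) x y) + 6 * x * ev phi x y)).
  { unfold dq2. rewrite (eva_sub t), !(eva_add t), !(eva_mul t), (eva_add t), (eva_mul t), ev_scal,
      ev_const, Ex by cvr_full. ring. }
  assert (Vdq3 : ev (dq3 mu phi g) x y = -2 * x * (ev mu x y * ev (op_my g) x y
    + (ev (dy mu) x y * (1 + x * ev (op_w g) x y) + x * ev (dy phi) x y))).
  { unfold dq3. rewrite !(eva_mul t), !(eva_add t), !(eva_mul t), (eva_add t), (eva_mul t), ev_scal,
      ev_const, Ex by cvr_full. ring. }
  assert (Vdf1 : ev (df1 phi) x y = 30 * ev phi x y) by apply ev_scal.
  assert (Vdf2 : ev (df2 mu phi g) x y = ev (dy mu) x y * (5 + x * ev (op_th1 g) x y)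
    + 6 * x * ev (dy phi) x y).
  { unfold df2. rewrite !(eva_add t), !(eva_mul t), (eva_add t), (eva_mul t), ev_scal,
      ev_const, Ex by cvr_full. ring. }
  assert (Vdf3 : ev (df3 mu phi g) x y = x * (2 * ev (dy mu) x y * ev (op_my g) x y
    + (ev (dy (dy mu)) x y * (1 + x * ev (op_w g) x y) + x * ev (dy (dy phi)) x y))).
  { unfold df3. rewrite !(eva_mul t), !(eva_add t), !(eva_mul t), (eva_add t), (eva_mul t), ev_scal,
      ev_const, Ex by cvr_full. ring. }
  assert (Vdu1 : ev (du1 g) x y = 20 + x * ev (op_th2 g) x y).
  { unfold du1. rewrite (eva_add t), (eva_mul t), ev_const, Ex by cvr_full. ring. }
  assert (Vdu2 : ev (du2 g) x y = x * ev (op_mxy g) x y).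
  { unfold du2. rewrite (eva_mul t), Ex by cvr_full. ring. }
  assert (Vdu3 : ev (du3 g) x y = x * x * ev (op_myy g) x y).
  { unfold du3. rewrite !(eva_mul t), Ex by cvr_full. ring. }
  rewrite Vdq1, Vdq2, Vdq3, Vdf1, Vdf2, Vdf3, Vdu1, Vdu2, Vdu3.
  match type of Eg with ?L = - / (2 * P ^ 2) * ?S + - / (2 * P ^ 2) * ?T =>
    assert (Eg' : 2 * P ^ 2 * L + S + T = 0) by (rewrite Eg; field; easy) end.
  clear Eg. revert VL Eg'. clear. unfold det3. intros VL Eg'.
  match type of VL with ?L = ?R => assert (VL' : L - R = 0) by (rewrite VL; ring) end.
  clear VL.
  match type of VL' with ?L = 0 => match type of Eg' with ?M = 0 =>
    transitivity (e * x ^ 4 * L + e * x ^ 5 * M); [ring|rewrite VL', Eg'; ring] end end.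
Qed.

(** The perturbation leaves the 5-jet unchanged except for the coefficient of [x^5] in the second
    component, and all its coefficients are bounded independently of [e]. *)
Lemma perturbation r P a b : 0 < r -> cvr r a -> cvr r b -> normal_2jet P a b ->
  Wser a b = pzero ->
  exists B : nat -> nat -> R, forall e, Rabs e <= 1 -> exists t f u,
    0 < t /\ cvr t f /\ cvr t u /\
    Wser (padd a (pscal e f)) (padd b (pscal e u)) = pzero /\
    (forall i j, (i + j <= 5)%nat -> f i j = 0) /\
    (forall i j, (i + j <= 5)%nat -> u i j = if Nat.eq_dec i 5 then 1 else 0) /\
    forall i j, Rabs (f i j) <= B i j /\ Rabs (u i j) <= B i j.
Proof.
  intros Hr Ha Hb Hn HW.
  destruct (gauge_exists r P a b Hr Ha Hb Hn HW)
    as (t & mu & phi & Ht & Hmu & Hphi & Hmu0 & Hfm & Hfp & HK0 & Hax).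
  assert (Ht0 : 0 < t) by lra.
  assert (Hat : cvr t a) by (apply cvr_shrink with r; lra || easy).
  assert (Hbt : cvr t b) by (apply cvr_shrink with r; lra || easy).
  assert (Hps := ctrl_fuchs_rest t P a b mu phi Ht0 Hat Hbt Hmu Hphi Hn Hmu0 HK0).
  assert (Hso : cvr t (source a b mu phi)).
  { assert (HX1 : cvr t (divx (cross1 a b mu)))
      by (apply cvr_divx; unfold cross1, qm, qy; cvr_full).
    assert (HL : cvr t (leading_defect a b mu phi))
      by (unfold leading_defect, qx, qm, qy, pzero; cvr_full).
    assert (HdL := cvr_divx _ _ HL). unfold source. cvr_full. }
  destruct (ctrl_fixpoint t (pscal (- / (2 * P ^ 2)) (source a b mu phi))
    (fuchs_rest P a b mu phi) Ht0) as (s & M & Hs & Hfix); [cvr_tac|easy|].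
  assert (Hs0 : 0 < s) by lra.
  assert (C2 : ctrl 0 (fun _ g => pert2 g)) by (unfold pert2; ctrl_0).
  assert (C1 : ctrl 0 (fun _ g => pert1 mu phi g)) by (unfold pert1, pert2; ctrl_0).
  destruct (ctrl_entry 0 _ s M C1 Hs0) as [B1 HB1].
  destruct (ctrl_entry 0 _ s M C2 Hs0) as [B2 HB2].
  exists (fun i j => Rmax (B1 i j) (B2 i j)). intros e He.
  destruct (Hfix e He) as (g & Hg & Hgeq).
  destruct (ctrl_cvr 0 _ e s g M ctrl_w He Hs0 Hg) as (t1 & Ht1 & D1).
  destruct (ctrl_cvr 0 _ e s g M ctrl_th1 He Hs0 Hg) as (t2 & Ht2 & D2).
  destruct (ctrl_cvr 0 _ e s g M ctrl_th2 He Hs0 Hg) as (t3 & Ht3 & D3).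
  destruct (ctrl_cvr 1 _ e s g M ctrl_mxy He Hs0 Hg) as (t4 & Ht4 & D4).
  destruct (ctrl_cvr 1 _ e s g M ctrl_my He Hs0 Hg) as (t5 & Ht5 & D5).
  destruct (ctrl_cvr 1 _ e s g M ctrl_myy He Hs0 Hg) as (t6 & Ht6 & D6).
  set (q := Rmin t (Rmin (Rmin t1 t2) (Rmin (Rmin t3 t4) (Rmin t5 t6)))).
  assert (Hq : 0 < q) by (repeat apply Rmin_glb_lt; easy).
  assert (Hqs : q <= t /\ q <= t1 /\ q <= t2 /\ q <= t3 /\ q <= t4 /\ q <= t5 /\ q <= t6).
  { unfold q. generalize (Rmin_l t (Rmin (Rmin t1 t2) (Rmin (Rmin t3 t4) (Rmin t5 t6))))
      (Rmin_r t (Rmin (Rmin t1 t2) (Rmin (Rmin t3 t4) (Rmin t5 t6))))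
      (Rmin_l (Rmin t1 t2) (Rmin (Rmin t3 t4) (Rmin t5 t6)))
      (Rmin_r (Rmin t1 t2) (Rmin (Rmin t3 t4) (Rmin t5 t6)))
      (Rmin_l (Rmin t3 t4) (Rmin t5 t6)) (Rmin_r (Rmin t3 t4) (Rmin t5 t6))
      (Rmin_l t1 t2) (Rmin_r t1 t2) (Rmin_l t3 t4) (Rmin_r t3 t4)
      (Rmin_l t5 t6) (Rmin_r t5 t6). lra. }
  destruct Hqs as (Q0 & Q1 & Q2 & Q3 & Q4 & Q5 & Q6).
  apply (cvr_shrink _ q) in D1; [|easy]. apply (cvr_shrink _ q) in D2; [|easy].
  apply (cvr_shrink _ q) in D3; [|easy]. apply (cvr_shrink _ q) in D4; [|easy].
  apply (cvr_shrink _ q) in D5; [|easy]. apply (cvr_shrink _ q) in D6; [|easy].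
  assert (Hmuq : cvr q mu) by now apply cvr_shrink with t.
  assert (Hphiq : cvr q phi) by now apply cvr_shrink with t.
  exists q, (pert1 mu phi g), (pert2 g).
  split; [easy|]. split; [unfold pert1, pert2; cvr_tac|]. split; [unfold pert2; cvr_tac|].
  split; [|split; [|split]].
  - apply (W_perturbed q P a b mu phi e g); try easy.
    + now apply cvr_shrink with t.
    + now apply cvr_shrink with t.
    + apply Hn.
    + intros y Hy. apply Hax. lra.
  - assert (Hu5 : ord 5 (pert2 g)).
    { apply ord_padd; [now apply ord_single|].
      apply ord_le with (6 + 0)%nat; [lia|]. apply ord_mul; [now apply ord_single|].
      intros ? ? ?; lia. }
    assert (Hf6 : ord 6 (pert1 mu phi g)).
    { apply ord_padd.
      - apply (ord_mul 1 5); [now apply ord1_iff|easy].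
      - apply (ord_mul 6 0); [now apply ord_single|]. intros ? ? ?; lia. }
    intros i j Hij. apply Hf6. lia.
  - intros i j Hij. unfold pert2, padd. rewrite pmul_single. unfold single.
    destruct (Nat.eq_dec i 5), (Nat.eq_dec j 0), (le_dec 6 i); try lia; ring.
  - intros i j. split.
    + eapply Rle_trans; [apply (HB1 e g He Hg)|apply Rmax_l].
    + eapply Rle_trans; [apply (HB2 e g He Hg)|apply Rmax_r].
Qed.

(** * The space of W-congruences in Taylor coefficients *)

Lemma W0_taylor xi : W0 4 xi -> exists r P a b,
  rep r (xi1 xi) a /\ rep r (xi2 xi) b /\ normal_2jet P a b /\ Wser a b = pzero.
Proof.
  intros ((Ha & Hb & Ha0 & Hb0) & HW & (U1 & U2 & U3) & (N1 & N2 & N3 & N4 & N5 & N6 & N7) & Hm & _).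
  destruct (analytic_rep _ Ha) as (ra & a & Hra). destruct (analytic_rep _ Hb) as (rb & b & Hrb).
  assert (Ra : 0 < ra) by apply Hra. assert (Rb : 0 < rb) by apply Hrb.
  set (r := Rmin ra rb). assert (Hr : 0 < r) by now apply Rmin_glb_lt.
  apply (rep_shrink _ r) in Hra; [|split; [easy|apply Rmin_l]].
  apply (rep_shrink _ r) in Hrb; [|split; [easy|apply Rmin_r]].
  assert (Hp : forall i j, p xi i j = INR (fact i) * INR (fact j) * a i j)
    by (intros; now apply rep_coeff with r).
  assert (Hq : forall i j, q xi i j = INR (fact i) * INR (fact j) * b i j)
    by (intros; now apply rep_coeff with r).
  assert (HZ : Rabs 0 < r) by (rewrite Rabs_R0; easy).
  unfold m_invariant in Hm. rewrite Hp, ?Hq in *. rewrite ?Hp in *.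
  simpl in U1, U2, U3, N1, N2, N3, N4, N5, N6, N7, Hm.
  exists r, (a 1%nat 1%nat), a, b. split; [easy|]. split; [easy|].
  assert (HP : a 1%nat 1%nat <> 0) by lra.
  assert (Hb02 : b 0%nat 2%nat = -2 * a 1%nat 1%nat).
  { apply (f_equal (fun z => z * a 1%nat 1%nat)) in Hm.
    replace (- (1 * (1 + 1) * b 0%nat 2%nat) / (1 * 1 * a 1%nat 1%nat) * a 1%nat 1%nat)
      with (-2 * b 0%nat 2%nat) in Hm by (field; easy). lra. }
  assert (Hb20 : (1 + 1) * 1 * b 2%nat 0%nat = 0) by (apply N7; lra).
  split; [|now apply (W_series_zero r xi)].
  assert (a00 : a 0%nat 0%nat = 0).
  { rewrite <- ev_0. destruct Hra as (_ & _ & H). now rewrite <- H. }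
  assert (b00 : b 0%nat 0%nat = 0).
  { rewrite <- ev_0. destruct Hrb as (_ & _ & H). now rewrite <- H. }
  repeat split; lra || easy.
Qed.

Lemma taylor_W0 r P xi a b :
  rep r (xi1 xi) a -> rep r (xi2 xi) b -> normal_2jet P a b -> Wser a b = pzero ->
  A4_obstruction a b <> 0 -> W0 4 xi.
Proof.
  intros Ha Hb Hn HW HJ.
  destruct (discriminant_A4 P r xi a b Ha Hb Hn HW HJ) as [_ Hneg].
  assert (Hlim := regular_points_dense P r xi a b Ha Hb Hn Hneg).
  assert (Hr : 0 < r) by apply Ha.
  assert (HZ : Rabs 0 < r) by (rewrite Rabs_R0; easy).
  assert (Hp : forall i j, p xi i j = INR (fact i) * INR (fact j) * a i j)
    by (intros; now apply rep_coeff with r).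
  assert (Hq : forall i j, q xi i j = INR (fact i) * INR (fact j) * b i j)
    by (intros; now apply rep_coeff with r).
  destruct Hn as (HP & a00 & b00 & b01 & a01 & b10 & a20 & a02 & b11 & b20 & a11 & b02).
  split; [|split; [|split; [|split; [|split]]]].
  - repeat split.
    + now apply rep_analytic with r a.
    + now apply rep_analytic with r b.
    + destruct Ha as (_ & _ & H). now rewrite H, ev_0.
    + destruct Hb as (_ & _ & H). now rewrite H, ev_0.
  - exists (mkposreal r Hr). simpl. intros x y. rewrite !Rminus_0_r. intros Hx Hy.
    destruct (rep_W r xi a b Ha Hb) as (_ & _ & H). rewrite H, HW by easy.
    apply ev_const.
  - unfold umbilical_origin. rewrite !Hp, !Hq, b01, a01, b10. repeat split; simpl; ring.
  - unfold nondegenerate_normal_form. rewrite !Hp, !Hq, a02, a20, b11, a11, b02, b20.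
    simpl. repeat split; lra.
  - unfold m_invariant. rewrite Hp, Hq, a11, b02. simpl. field. easy.
  - easy.
Qed.

(** * Jets *)

Definition jets (n : nat) : UniformSpace :=
  fct_UniformSpace (index n) (fct_UniformSpace (index n) (prod_UniformSpace R_UniformSpace R_UniformSpace)).

Definition jet_taylor (n : nat) (pr : R * R -> R) (s : index n -> index n -> R * R) : fam :=
  fun i j => match lt_dec i n, lt_dec j n with
  | left hi, left hj => pr (s (exist _ i hi) (exist _ j hj))
      / (INR (fact i) * INR (fact j))
  | _, _ => 0
  end.

Lemma jet_taylor_fst r n xi a i j : rep r (xi1 xi) a -> (i < n)%nat -> (j < n)%nat ->
  jet_taylor n fst (jet n xi) i j = a i j.
Proof.
  intros Ha Hi Hj. unfold jet_taylor.
  destruct (lt_dec i n) as [hi|]; [|lia]. destruct (lt_dec j n) as [hj|]; [|lia].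
  unfold jet. simpl. unfold p. rewrite (rep_coeff r _ a i j Ha).
  field. split; apply INR_fact_neq_0.
Qed.

Lemma jet_taylor_snd r n xi b i j : rep r (xi2 xi) b -> (i < n)%nat -> (j < n)%nat ->
  jet_taylor n snd (jet n xi) i j = b i j.
Proof.
  intros Ha Hi Hj. unfold jet_taylor.
  destruct (lt_dec i n) as [hi|]; [|lia]. destruct (lt_dec j n) as [hj|]; [|lia].
  unfold jet. simpl. unfold q. rewrite (rep_coeff r _ b i j Ha).
  field. split; apply INR_fact_neq_0.
Qed.

Definition cfam (T : UniformSpace) (F : T -> fam) : Prop :=
  forall i j (s : T), continuous (fun s => F s i j) s.

Lemma continuous_fsum (T : UniformSpace) n (F : T -> nat -> R) s :
  (forall i, continuous (fun s => F s i) s) -> continuous (fun s => fsum n (F s)) s.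
Proof.
  intros H. induction n as [|n IH]; simpl; [apply continuous_const|].
  apply (continuous_plus (fun s => fsum n (F s)) (fun s => F s n)); easy.
Qed.

Lemma cfam_add T F G : cfam T F -> cfam T G -> cfam T (fun s => padd (F s) (G s)).
Proof. intros HF HG i j s. apply (continuous_plus (fun s => F s i j) (fun s => G s i j)); auto. Qed.

Lemma cfam_scal T k F : cfam T F -> cfam T (fun s => pscal k (F s)).
Proof.
  intros HF i j s. apply (continuous_mult (fun _ => k) (fun s => F s i j)); [|auto].
  apply continuous_const.
Qed.

Lemma cfam_mul T F G : cfam T F -> cfam T G -> cfam T (fun s => pmul (F s) (G s)).
Proof.
  intros HF HG n m s. unfold pmul.
  apply (continuous_fsum T (S n) (fun s i => fsum (S m) (fun j => F s i j * G s (n - i)%nat (m - j)%nat))).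
  intros i. apply (continuous_fsum T (S m) (fun s j => F s i j * G s (n - i)%nat (m - j)%nat)).
  intros j. apply (continuous_mult (fun s => F s i j) (fun s => G s (n - i)%nat (m - j)%nat)); auto.
Qed.

Lemma cfam_dx T F : cfam T F -> cfam T (fun s => dx (F s)).
Proof.
  intros HF i j s. apply (continuous_mult (fun _ => INR (S i)) (fun s => F s (S i) j)); [|auto].
  apply continuous_const.
Qed.

Lemma cfam_dy T F : cfam T F -> cfam T (fun s => dy (F s)).
Proof.
  intros HF i j s. apply (continuous_mult (fun _ => INR (S j)) (fun s => F s i (S j))); [|auto].
  apply continuous_const.
Qed.

Lemma cfam_dxy T k l F : cfam T F -> cfam T (fun s => dxy k l (F s)).
Proof.
  intros HF. unfold dxy.
  assert (Hl : cfam T (fun s => Nat.iter l dy (F s))).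
  { induction l as [|l IH]; [easy|]. apply (cfam_dy T _ IH). }
  induction k as [|k IH]; [easy|]. apply (cfam_dx T _ IH).
Qed.

Lemma cfam_dser T F G : cfam T F -> cfam T G -> cfam T (fun s => dser (F s) (G s)).
Proof.
  intros HF HG. assert (H1 := cfam_dxy T 1 0 F HF). assert (H2 := cfam_dxy T 0 1 F HF).
  assert (H3 := cfam_dxy T 1 0 G HG). assert (H4 := cfam_dxy T 0 1 G HG).
  assert (H5 := cfam_add T _ _ H1 (cfam_scal T (-1) _ H4)).
  apply (cfam_add T _ _ (cfam_mul T _ _ H5 H5) (cfam_mul T _ _ (cfam_scal T 4 _ H2) H3)).
Qed.

Lemma continuous_obstruction T F G s : cfam T F -> cfam T G ->
  continuous (fun s => A4_obstruction (F s) (G s)) s.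
Proof.
  intros HF HG. assert (HD := cfam_dser T F G HF HG). unfold A4_obstruction.
  assert (Hm : forall u v : T -> R, continuous u s -> continuous v s ->
    continuous (fun s => u s * v s) s) by (intros; now apply (continuous_mult u v)).
  assert (Ha : forall u v : T -> R, continuous u s -> continuous v s ->
    continuous (fun s => u s + v s) s) by (intros; now apply (continuous_plus u v)).
  assert (Hs : forall u v : T -> R, continuous u s -> continuous v s ->
    continuous (fun s => u s - v s) s) by (intros; now apply (continuous_minus u v)).
  assert (Hsq : forall u : T -> R, continuous u s -> continuous (fun s => u s ^ 2) s).
  { intros u Hu. replace (fun s => u s ^ 2) with (fun s => u s * u s); [now apply Hm|].
    apply functional_extensionality; intros; ring. }
  apply Ha; [apply Hs|]; apply Hm; try (apply Hsq); try apply Hm; auto;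
    first [apply HF|apply HG|apply (HD _ _ s)].
Qed.

Lemma cfam_jet n pr : (forall z, continuous pr z) -> cfam (jets n) (jet_taylor n pr).
Proof.
  intros Hpr i j s. unfold jet_taylor.
  destruct (lt_dec i n) as [hi|]; [|apply continuous_const].
  destruct (lt_dec j n) as [hj|]; [|apply continuous_const].
  apply (continuous_mult (fun s : jets n => pr (s (exist _ i hi) (exist _ j hj)))
    (fun _ => / (INR (fact i) * INR (fact j)))); [|apply continuous_const].
  apply (continuous_comp (fun s : jets n => s (exist _ i hi) (exist _ j hj)) pr); [|apply Hpr].
  intros Q [eps He]. exists eps. intros s' Hs'. apply He. apply Hs'.
Qed.

(** The discriminant in degree five involves coefficients of degree six, whence the length 7. *)
Definition obstruction_of_jet (s : index 7 -> index 7 -> R * R) : R :=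
  A4_obstruction (jet_taylor 7 fst s) (jet_taylor 7 snd s).

Lemma obstruction_jet r xi a b : rep r (xi1 xi) a -> rep r (xi2 xi) b ->
  obstruction_of_jet (jet 7 xi) = A4_obstruction a b.
Proof.
  intros Ha Hb. unfold obstruction_of_jet.
  assert (H1 := fun i j => jet_taylor_fst r 7 xi a i j Ha).
  assert (H2 := fun i j => jet_taylor_snd r 7 xi b i j Hb).
  set (a' := jet_taylor 7 fst (jet 7 xi)) in *. set (b' := jet_taylor 7 snd (jet 7 xi)) in *.
  clearbody a' b'. unfold A4_obstruction. coef.
  repeat match goal with
  | |- context [a' ?i ?j] => rewrite (H1 i j) by lia
  | |- context [b' ?i ?j] => rewrite (H2 i j) by lia
  end. easy.
Qed.

Lemma open_obstruction : open (T := jets 7) (fun s => obstruction_of_jet s <> 0).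
Proof.
  apply (open_comp (T := jets 7) (U := R_UniformSpace) obstruction_of_jet (fun z => z <> 0)).
  - intros s _. apply (continuous_obstruction (jets 7)); apply cfam_jet; intros z.
    + apply continuous_fst.
    + apply continuous_snd.
  - apply open_neq.
Qed.

(** * The theorem *)

Theorem proposition4p5 :
  forall m : R, m = 4 ->
  exists U : congruence -> Prop,
    open_in (W0 m) U /\ dense_in (W0 m) U /\
    forall xi : congruence, U xi -> type_A4 (discriminant xi).
Proof.
  intros m ->.
  exists (fun xi => W0 4 xi /\ obstruction_of_jet (jet 7 xi) <> 0).
  split; [split|split].
  - now intros xi [H _].
  - intros xi [_ HJ]. exists (fun eta => obstruction_of_jet (jet 7 eta) <> 0). split; [|split].
    + exists 7%nat, (fun s => obstruction_of_jet s <> 0). split; [apply open_obstruction|easy].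
    + easy.
    + intros eta H1 H2. now split.
  - intros B (n & O & HO & HB) (xi & Hxi & HBxi).
    destruct (W0_taylor xi Hxi) as (r & P & a & b & Ha & Hb & Hn & HW).
    destruct (Req_dec (obstruction_of_jet (jet 7 xi)) 0) as [HJ|HJ]; [|now exists xi].
    rewrite (obstruction_jet r xi a b Ha Hb) in HJ.
    assert (Hr : 0 < r) by apply Ha.
    destruct (perturbation r P a b Hr) as (K & HK); try easy; [apply Ha|apply Hb|].
    apply HB in HBxi. destruct (HO _ HBxi) as [eps Heps].
    set (c := fun i j => INR (fact i) * INR (fact j) * Rabs (K i j)).
    assert (Hc : forall i j, 0 <= c i j).
    { intros. apply Rmult_le_pos; [apply Rmult_le_pos; left; apply fact_pos|apply Rabs_pos]. }
    assert (HS : 0 <= bsum n c) by now apply bsum_nonneg.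
    set (e := Rmin 1 (eps / (bsum n c + 1))).
    assert (He1 : e <= 1) by apply Rmin_l.
    assert (Hep := cond_pos eps).
    assert (He0 : 0 < e) by (apply Rmin_glb_lt; [lra|apply Rdiv_lt_0_compat; lra]).
    assert (He2 : e * bsum n c < eps).
    { apply Rlt_le_trans with (e * (bsum n c + 1)); [apply Rmult_lt_compat_l; lra|].
      apply Rle_trans with (eps / (bsum n c + 1) * (bsum n c + 1)).
      - apply Rmult_le_compat_r; [lra|apply Rmin_r].
      - apply Req_le. field. lra. }
    destruct (HK e) as (t & f & u & Ht & Hf & Hu & HW' & Hf5 & Hu5 & Hbd);
      [rewrite Rabs_pos_eq; lra|].
    set (a' := padd a (pscal e f)) in *. set (b' := padd b (pscal e u)) in *.
    set (q := Rmin r t). assert (Hq : 0 < q) by now apply Rmin_glb_lt.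
    assert (Q1 : q <= r) by apply Rmin_l. assert (Q2 : q <= t) by apply Rmin_r.
    assert (Hca : cvr q a) by (apply cvr_shrink with r; [easy|apply Ha]).
    assert (Hcb : cvr q b) by (apply cvr_shrink with r; [easy|apply Hb]).
    assert (Hcf : cvr q f) by now apply cvr_shrink with t.
    assert (Hcu : cvr q u) by now apply cvr_shrink with t.
    set (eta := Congruence (ev a') (ev b')).
    assert (Ha' : rep q (xi1 eta) a') by (apply rep_ev; [easy|cvr_tac]).
    assert (Hb' : rep q (xi2 eta) b') by (apply rep_ev; [easy|cvr_tac]).
    assert (Ea : forall i j, (i + j <= 5)%nat -> a' i j = a i j).
    { intros i j Hij. unfold a', padd, pscal. rewrite Hf5 by easy. ring. }
    assert (Eb : forall i j, (i + j <= 5)%nat ->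
      b' i j = b i j + (if Nat.eq_dec i 5 then e else 0)).
    { intros i j Hij. unfold b', padd, pscal. rewrite Hu5 by easy.
      destruct (Nat.eq_dec i 5); ring. }
    assert (Hn' : normal_2jet P a' b').
    { unfold normal_2jet in *. rewrite !Ea, !Eb by lia. simpl. rewrite !Rplus_0_r. easy. }
    assert (HJ' : A4_obstruction a' b' <> 0).
    { rewrite (A4_obstruction_perturb P a b a' b' e Hn Ea Eb), HJ, Rplus_0_l.
      assert (HP : P <> 0) by apply Hn. apply (pow_nonzero P 3) in HP.
      apply Rmult_integral_contrapositive; split; lra. }
    assert (HW0 : W0 4 eta) by now apply (taylor_W0 q P eta a' b').
    exists eta. split; [easy|]. split; [split; [easy|]|].
    + now rewrite (obstruction_jet q eta a' b').
    + apply HB, Heps. intros [i hi] [j hj].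
      assert (Hij : INR (fact i) * INR (fact j) * (e * Rabs (K i j)) < eps).
      { eapply Rle_lt_trans; [|apply He2].
        replace (INR (fact i) * INR (fact j) * (e * Rabs (K i j)))
          with (e * c i j) by (unfold c; ring).
        apply Rmult_le_compat_l; [lra|]. unfold bsum.
        eapply Rle_trans; [|apply (fsum_ge_entry n i); [easy|intros; now apply fsum_nonneg]].
        apply (fsum_ge_entry n j (c i)); easy. }
      assert (Hcl : forall z w, Rabs z <= K i j -> w = e * z ->
        Rabs (INR (fact i) * INR (fact j) * w) < eps).
      { intros z w Hz ->. eapply Rle_lt_trans; [|apply Hij].
        assert (F1 := fact_pos i). assert (F2 := fact_pos j).
        rewrite !Rabs_mult, (Rabs_pos_eq (INR (fact i))),
          (Rabs_pos_eq (INR (fact j))), (Rabs_pos_eq e) by lra.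
        apply Rmult_le_compat_l; [apply Rmult_le_pos; lra|].
        apply Rmult_le_compat_l; [lra|]. generalize (Rle_abs (K i j)); lra. }
      destruct (Hbd i j) as [Hbf Hbu]. unfold jet. simpl proj1_sig.
      split.
      * change (Rabs (p eta i j - p xi i j) < eps). unfold p.
        rewrite (rep_coeff _ _ _ i j Ha'), (rep_coeff _ _ _ i j Ha), <- Rmult_minus_distr_l.
        apply (Hcl (f i j)); [easy|]. unfold a', padd, pscal. ring.
      * change (Rabs (Defs.q eta i j - Defs.q xi i j) < eps). unfold Defs.q.
        rewrite (rep_coeff _ _ _ i j Hb'), (rep_coeff _ _ _ i j Hb), <- Rmult_minus_distr_l.
        apply (Hcl (u i j)); [easy|]. unfold b', padd, pscal. ring.
  - intros xi [Hxi HJ].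
    destruct (W0_taylor xi Hxi) as (r & P & a & b & Ha & Hb & Hn & HW).
    rewrite (obstruction_jet r xi a b Ha Hb) in HJ.
    apply (discriminant_A4 P r xi a b Ha Hb Hn HW HJ).
Qed.
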